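(* Let $N\ge 1$ be an integer. There exist two sequences of positive real numbers $(\alpha_k^+)_{k\ge 1}$ and $(\alpha_k^-)_{k\ge 1}$ such that: (i) for each choice of sign $\pm$ and each $\alpha>0$, a locally bounded radial $\alpha$-homogeneous solution $w$ of $\beta(w)_t=\Delta w$ for $t<0$ with $w(0,-1)=\pm 1$ exists if and only if $\alpha=\alpha_k^{\pm}$ (same sign) for some $k\in\mathbb{N}$; (ii) for each $k$ and each sign, the self-similar profile corresponding to $\alpha_k^{\pm}$ (that is, the profile $f$ with $f(0)=\pm1$ of the solution in (i) with $\alpha=\alpha_k^\pm$) changes sign exactly $k$ times; (iii) the sequences $(\alpha_k^+)$ and $(\alpha_k^-)$ are strictly increasing and unbounded; (iv) $0<\alpha_1^-<2<\alpha_1^+$; (v) $\alpha_k^-<\alpha_{k+1}^+<\alpha_{k+2}^-$ for all $k\in\mathbb{N}$.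
   Context: $\mathbb{N}=\{1,2,\dots\}$. The function $\beta:\mathbb{R}\to\mathbb{R}$ is $\beta(r)=2r-r^+$, i.e. $\beta(r)=r$ for $r\ge 0$ and $\beta(r)=2r$ for $r<0$. A radial $\alpha$-homogeneous (self-similar) solution of $\beta(w)_t=\Delta w$ for $t<0$ is a function of the form $$w(x,t)=(-t)^{\alpha/2}f\big(|x|/\sqrt{-t}\big),\qquad x\in\mathbb{R}^N,\ t<0,$$ where the self-similar profile $f:[0,\infty)\to\mathbb{R}$ is of class $C^{1,1}$ on bounded intervals and satisfies $f(0)\ne0$, $f'(0)=0$, $$f''(s)+\Big(\frac{N-1}{s}-s\Big)f'(s)+\alpha f(s)=0\quad\text{where } f<0,\ s>0,$$ $$f''(s)+\Big(\frac{N-1}{s}-\frac{s}{2}\Big)f'(s)+\frac{\alpha}{2}f(s)=0\quad\text{where } f>0,\ s>0.$$ Such a solution $w$ is called locally bounded if $s\mapsto s^{-\alpha}f(s)$ remains bounded as $s\to+\infty$. Note $w(0,-1)=f(0)$. *)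

(* Defs.v *)
From Stdlib Require Import Reals.
From Stdlib Require Vector.
From Coquelicot Require Import Coquelicot.
Open Scope R_scope.

Definition euclid_norm {N : nat} (x : Vector.t R N) : R :=
  sqrt (Vector.fold_right (fun a s => a ^ 2 + s) x 0).

(* [f] stands for a function on [0, +oo): only its values there are
   constrained, and [D_in] makes the derivative at 0 one-sided. *)
Definition C11_loc_with_derivative (f f1 : R -> R) : Prop :=
  (forall s, 0 <= s -> D_in f f1 (fun y => 0 <= y) s) /\
  (forall M, 0 <= M ->
     exists L, forall s r, 0 <= s <= M -> 0 <= r <= M ->
       Rabs (f1 s - f1 r) <= L * Rabs (s - r)).

(* The second-order equations hold pointwise on the open sets {f < 0} and
   {f > 0}; nothing is asked of f'' on {f = 0}. *)
Definition is_profile (N : nat) (alpha : R) (f : R -> R) : Prop :=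
  exists f1 f2 : R -> R,
    C11_loc_with_derivative f f1 /\
    f 0 <> 0 /\
    f1 0 = 0 /\
    (forall s, 0 < s -> f s < 0 ->
       is_derive f1 s (f2 s) /\
       f2 s + ((INR N - 1) / s - s) * f1 s + alpha * f s = 0) /\
    (forall s, 0 < s -> 0 < f s ->
       is_derive f1 s (f2 s) /\
       f2 s + ((INR N - 1) / s - s / 2) * f1 s + alpha / 2 * f s = 0).

Definition radial_homogeneous_solution (N : nat) (alpha : R) (f : R -> R)
    (w : Vector.t R N -> R -> R) : Prop :=
  is_profile N alpha f /\
  forall x t, t < 0 ->
    w x t = Rpower (- t) (alpha / 2) * f (euclid_norm x / sqrt (- t)).

Definition profile_growth_bounded (alpha : R) (f : R -> R) : Prop :=
  exists M S, 0 < S /\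
    forall s, S <= s -> Rabs (Rpower s (- alpha) * f s) <= M.

Definition locally_bounded_solution (N : nat) (alpha : R) (f : R -> R)
    (w : Vector.t R N -> R -> R) : Prop :=
  radial_homogeneous_solution N alpha f w /\ profile_growth_bounded alpha f.

Definition changes_sign_at_least (f : R -> R) (m : nat) : Prop :=
  exists s : nat -> R, 0 <= s 0%nat /\
    forall i, (i < m)%nat -> s i < s (S i) /\ f (s i) * f (s (S i)) < 0.

Definition changes_sign_exactly (f : R -> R) (k : nat) : Prop :=
  changes_sign_at_least f k /\ ~ changes_sign_at_least f (S k).

(* Main.v *)
(* A solution [f] is described by the angle of the pair [(f, f' - s beta(f)/2)],
   whose second entry, unlike [f'], is C^1 across the zeros of [f].  The angle
   solves a scalar ODE that decreases with alpha, and it crosses the angles where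
   [f] vanishes only downwards; so the number of zeros is nondecreasing in alpha,
   and the profiles of the two signs interlace because their angles solve the same
   equation with initial data differing by pi.  Past a distance locally uniform in
   alpha there is at most one more zero, and [f] is either [O(s^alpha)] or grows so
   fast that its sign is frozen, for nearby alpha as well.  A Wronskian argument on
   the last nodal interval shows that a profile [O(s^alpha)] gains a zero as soon as
   alpha increases.  Hence [f] is locally bounded exactly at
   [alpha_k = sup {alpha >= 0 : f has at most k zeros}], with [alpha_0 = 0] (constant
   profiles).  For [alpha = 2] the explicit solutions [1 - s^2/(2N)] and [1 - s^2/N]
   decide the position of the first eigenvalues. *)
Require Import Defs.
From Stdlib Require Import Reals.
From Stdlib Require Vector.
From Coquelicot Require Import Coquelicot.
From Stdlib Require Import Lra Lia Classical ClassicalEpsilon.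
Open Scope R_scope.

(** With [N = m + 1] the two equations of a profile are one, [f'' + (m/s) f' - (s/2) (beta f)' +
    (alpha/2) beta f = 0]. It is not linear, and no single weight makes it self-adjoint: the
    integrating factor [s^m exp(- b s^2 / 4)] depends through [b] on the sign of [f], and [f'']
    jumps at the zeros. Wronskians are therefore confined to intervals where the functions keep one
    sign, and everything global goes through the angle. Its equation closes because [beta] is
    positively homogeneous and is Lipschitz because [beta] is. The price is the singular term [m/s]
    at the origin, where all profiles of one sign start from the same angle, so that strict
    comparison has to be produced there separately. Zeros are simple and hence can only enter from
    infinity as alpha varies; this is why stability of their number needs estimates at large [s]
    that are uniform in alpha. Finally, since nothing is asked of [f''] where [f = 0], a profile
    might a priori have degenerate zeros; they are excluded by identifying it with the Picard
    solution. *)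

(** * Continuity, derivatives and mean-value tools *)

Lemma continuous_Rplus (f g : R -> R) x :
  continuous f x -> continuous g x -> continuous (fun y => f y + g y) x.
Proof. intros Hf Hg. exact (continuous_plus f g x Hf Hg). Qed.

Lemma continuous_Rmult (f g : R -> R) x :
  continuous f x -> continuous g x -> continuous (fun y => f y * g y) x.
Proof. intros Hf Hg. exact (continuous_mult f g x Hf Hg). Qed.

Lemma continuous_Ropp (f : R -> R) x :
  continuous f x -> continuous (fun y => - f y) x.
Proof. intros Hf. exact (continuous_opp f x Hf). Qed.

Lemma continuous_Rminus (f g : R -> R) x :
  continuous f x -> continuous g x -> continuous (fun y => f y - g y) x.
Proof. intros Hf Hg. exact (continuous_minus f g x Hf Hg). Qed.

Lemma continuous_Rabs_comp (f : R -> R) x :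
  continuous f x -> continuous (fun y => Rabs (f y)) x.
Proof.
intros Hf. apply (continuous_comp f Rabs); [exact Hf | apply continuous_Rabs].
Qed.

Lemma continuous_Rinv (f : R -> R) x :
  f x <> 0 -> continuous f x -> continuous (fun y => / f y) x.
Proof.
intros H Hf. apply (continuous_comp f Rinv); [exact Hf |].
apply continuity_pt_filterlim, continuity_pt_inv; [apply derivable_continuous_pt, derivable_pt_id | exact H].
Qed.

Lemma continuous_Rdiv (f g : R -> R) x :
  g x <> 0 -> continuous f x -> continuous g x ->
  continuous (fun y => f y / g y) x.
Proof.
intros H Hf Hg. apply continuous_Rmult; [exact Hf | now apply continuous_Rinv].
Qed.

Lemma continuous_of_derive (f : R -> R) x l : is_derive f x l -> continuous f x.
Proof. intros H. apply (ex_derive_continuous (V:=R_NormedModule) f x). now exists l. Qed.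

Lemma continuous_fun_comp (f g : R -> R) x :
  continuous f x -> continuous g (f x) -> continuous (fun y => g (f y)) x.
Proof. intros Hf Hg. exact (continuous_comp f g x Hf Hg). Qed.

Lemma continuous_Rpow (f : R -> R) k x :
  continuous f x -> continuous (fun y => f y ^ k) x.
Proof.
intros Hf. induction k as [|k IH]; simpl; [apply continuous_const |].
now apply continuous_Rmult.
Qed.

(** Equations produced by derivative and integral lemmas are typed in the carrier of a normed
    module; retyped over [R] they are open to [ring] and [field]. *)
Ltac eqR := cbv beta; match goal with |- ?a = ?b => change (@eq R a b) end.

Ltac solve_continuous :=
  try assumption;
  lazymatch goal with
  | |- continuous (fun _ => ?k) _ => apply (continuous_const k)
  | |- continuous (fun y => y) _ => apply continuous_id
  | |- continuous (fun y => @?f y + @?g y) _ =>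
      apply (continuous_Rplus f g); cbv beta; solve_continuous
  | |- continuous (fun y => @?f y - @?g y) _ =>
      apply (continuous_Rminus f g); cbv beta; solve_continuous
  | |- continuous (fun y => @?f y * @?g y) _ =>
      apply (continuous_Rmult f g); cbv beta; solve_continuous
  | |- continuous (fun y => - @?f y) _ =>
      apply (continuous_Ropp f); cbv beta; solve_continuous
  | |- continuous (fun y => Rabs (@?f y)) _ =>
      apply (continuous_Rabs_comp f); cbv beta; solve_continuous
  | |- continuous (fun y => @?f y ^ ?k) _ =>
      apply (continuous_Rpow f k); cbv beta; solve_continuous
  | H : forall x, continuous ?f x |- continuous ?f _ => apply H
  | |- _ =>
      match goal with
      | H : forall x, continuous ?f x |- continuous (fun y => ?f y) _ => apply H
      | H : forall x, continuous ?f x |- continuous (fun y => ?f (@?g y)) _ =>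
          apply (continuous_fun_comp g f); [cbv beta; solve_continuous | apply H]
      end
  end.

Lemma is_derive_Rplus (f g : R -> R) x a b :
  is_derive f x a -> is_derive g x b -> is_derive (fun y => f y + g y) x (a + b).
Proof. intros Hf Hg. exact (is_derive_plus f g x a b Hf Hg). Qed.

Lemma is_derive_Rminus (f g : R -> R) x a b :
  is_derive f x a -> is_derive g x b -> is_derive (fun y => f y - g y) x (a - b).
Proof. intros Hf Hg. exact (is_derive_minus f g x a b Hf Hg). Qed.

Lemma is_derive_Rscal (f : R -> R) k x a :
  is_derive f x a -> is_derive (fun y => k * f y) x (k * a).
Proof. intros Hf. exact (is_derive_scal f x k a Hf). Qed.

Lemma is_derive_Rmult (f g : R -> R) x a b :
  is_derive f x a -> is_derive g x b ->
  is_derive (fun y => f y * g y) x (a * g x + f x * b).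
Proof. intros Hf Hg. exact (is_derive_mult f g x a b Hf Hg Rmult_comm). Qed.

Lemma is_derive_Rconst k x : is_derive (fun _ : R => k) x 0.
Proof. exact (is_derive_const k x). Qed.

Lemma is_derive_Rid x : is_derive (fun y : R => y) x 1.
Proof. exact (is_derive_id (K := R_AbsRing) x). Qed.

Lemma is_derive_Rcomp (f g : R -> R) x a b :
  is_derive g (f x) b -> is_derive f x a -> is_derive (fun y => g (f y)) x (b * a).
Proof.
intros Hg Hf. rewrite Rmult_comm. exact (is_derive_comp g f x b a Hg Hf).
Qed.

Lemma ex_RInt_continuous_all (f : R -> R) a b :
  (forall x, continuous f x) -> ex_RInt f a b.
Proof. intros Hf. apply (ex_RInt_continuous f). intros z _. apply Hf. Qed.

Lemma is_derive_RInt_all (f : R -> R) a x :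
  (forall y, continuous f y) -> is_derive (fun y => RInt f a y) x (f x).
Proof.
intros Hf. apply (is_derive_RInt f _ a x); [| apply Hf].
apply filter_forall. intros y. apply (RInt_correct f).
now apply ex_RInt_continuous_all.
Qed.

Lemma derive_mean_value (f df : R -> R) a b :
  a < b ->
  (forall x, a <= x <= b -> continuous f x) ->
  (forall x, a < x < b -> is_derive f x (df x)) ->
  exists x, a < x < b /\ f b - f a = df x * (b - a).
Proof.
intros Hab Hc Hd.
assert (pr1 : forall x, a < x < b -> derivable_pt f x).
{ intros x Hx. exists (df x). apply is_derive_Reals. now apply Hd. }
assert (pr2 : forall x, a < x < b -> derivable_pt id x).
{ intros x _. apply derivable_pt_id. }
destruct (MVT f id a b pr1 pr2 Hab) as (x & Hx & E).
- intros x Hx. apply continuity_pt_filterlim. now apply Hc.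
- intros x _. apply derivable_continuous_pt, derivable_pt_id.
- exists x. split; [exact Hx |].
  assert (E1 : derive_pt f x (pr1 x Hx) = df x).
  { apply derive_pt_eq_0, is_derive_Reals. now apply Hd. }
  assert (E2 : derive_pt id x (pr2 x Hx) = 1).
  { apply derive_pt_eq_0, derivable_pt_lim_id. }
  rewrite E1, E2 in E. unfold id in E. lra.
Qed.

Lemma nondecreasing_of_derive (f df : R -> R) a b :
  a <= b ->
  (forall x, a <= x <= b -> continuous f x) ->
  (forall x, a < x < b -> is_derive f x (df x) /\ 0 <= df x) -> f a <= f b.
Proof.
intros Hab Hc Hd.
destruct (Rle_lt_or_eq_dec a b Hab) as [Hlt | ->]; [| lra].
destruct (derive_mean_value f df a b Hlt Hc) as (x & Hx & E).
{ intros x Hx. now apply Hd. }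
destruct (Hd x Hx) as [_ H]. nra.
Qed.

Lemma increasing_of_derive (f df : R -> R) a b :
  a < b ->
  (forall x, a <= x <= b -> continuous f x) ->
  (forall x, a < x < b -> is_derive f x (df x) /\ 0 < df x) -> f a < f b.
Proof.
intros Hlt Hc Hd.
destruct (derive_mean_value f df a b Hlt Hc) as (x & Hx & E).
{ intros x Hx. now apply Hd. }
destruct (Hd x Hx) as [_ H]. nra.
Qed.

Lemma constant_of_derive (f : R -> R) a b :
  a <= b ->
  (forall x, a <= x <= b -> continuous f x) ->
  (forall x, a < x < b -> is_derive f x 0) -> f b = f a.
Proof.
intros Hab Hc Hd.
destruct (Rle_lt_or_eq_dec a b Hab) as [Hlt | ->]; [| lra].
destruct (derive_mean_value f (fun _ => 0) a b Hlt Hc Hd) as (x & Hx & E). lra.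
Qed.

Lemma continuous_eps (g : R -> R) x :
  continuous g x <->
  (forall e, 0 < e -> exists d, 0 < d /\
     forall y, Rabs (y - x) < d -> Rabs (g y - g x) < e).
Proof.
split.
- intros H e He.
  destruct (proj1 (filterlim_locally g (g x)) H (mkposreal e He)) as [d Hd].
  exists d. split; [apply cond_pos |]. intros y Hy. apply (Hd y Hy).
- intros H. apply filterlim_locally. intros [e He].
  destruct (H e He) as (d & Hd & Hy). exists (mkposreal d Hd).
  intros y By. apply (Hy y By).
Qed.

Lemma continuous_pos_near (g : R -> R) x :
  continuous g x -> 0 < g x ->
  exists d, 0 < d /\ forall y, Rabs (y - x) < d -> 0 < g y.
Proof.
intros H Hx. destruct (proj1 (continuous_eps g x) H (g x) Hx) as (d & Hd & Hy).
exists d. split; [exact Hd |]. intros y By. specialize (Hy y By).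
apply Rabs_def2 in Hy. lra.
Qed.

(** Continuous induction: a supremum argument reduces positivity on a half-line to a first time [t]
    where it could fail, and there any estimate valid under positivity on [[a, t)] may be used. *)
Lemma positive_persists (g : R -> R) a :
  (forall s, a <= s -> continuous g s) -> 0 < g a ->
  (forall t, a < t -> (forall s, a <= s < t -> 0 < g s) -> 0 < g t) ->
  forall t, a <= t -> 0 < g t.
Proof.
intros Hc Ha Hstep t1 Ht1.
destruct (Rlt_le_dec 0 (g t1)) as [|Hneg]; [assumption | exfalso].
set (E := fun t => a <= t <= t1 /\ forall s, a <= s <= t -> 0 < g s).
destruct (completeness E) as [tau [Hub Hlub]].
- exists t1. intros t [Ht _]. lra.
- exists a. split; [lra |]. intros s Hs. now replace s with a by lra.
- assert (Htau : a <= tau <= t1).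
  { split.
    - apply Hub. split; [lra |]. intros s Hs. now replace s with a by lra.
    - apply Hlub. intros t [Ht _]. lra. }
  assert (Hbelow : forall s, a <= s < tau -> 0 < g s).
  { intros s Hs. destruct (classic (exists t, E t /\ s < t)) as [(t & [Et Ht] & Hst) | Hno].
    - apply Ht. lra.
    - exfalso. assert (tau <= s); [| lra].
      apply Hlub. intros t Et. destruct (Rle_lt_dec t s); [assumption |].
      exfalso. apply Hno. now exists t. }
  assert (Hgt : 0 < g tau).
  { destruct (Rle_lt_or_eq_dec a tau (proj1 Htau)) as [Hlt | <-]; [| exact Ha].
    apply Hstep; assumption. }
  destruct (continuous_pos_near g tau (Hc tau (proj1 Htau)) Hgt) as (d & Hd & Hnear).
  destruct (Rle_lt_or_eq_dec tau t1 (proj2 Htau)) as [Hlt | Heq]; [| subst; lra].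
  assert (E (Rmin t1 (tau + d / 2))) as HE.
  { pose proof (Rmin_l t1 (tau + d / 2)). pose proof (Rmin_r t1 (tau + d / 2)).
    split.
    - split; [| assumption]. apply Rmin_glb; lra.
    - intros s Hs. destruct (Rlt_le_dec s tau); [apply Hbelow; lra |].
      apply Hnear. apply Rabs_def1; lra. }
  apply Hub in HE. revert HE. apply Rlt_not_le. apply Rmin_glb_lt; lra.
Qed.

Lemma intermediate_value (g : R -> R) a b y :
  a <= b -> (forall x, continuous g x) ->
  (g a <= y <= g b \/ g b <= y <= g a) -> exists x, a <= x <= b /\ g x = y.
Proof.
intros Hab Hc Hy.
destruct (IVT_gen g a b y) as (x & Hx & E).
- intros x. apply continuity_pt_filterlim, Hc.
- destruct Hy; [rewrite Rmin_left, Rmax_right | rewrite Rmin_right, Rmax_left]; lra.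
- rewrite Rmin_left, Rmax_right in Hx by assumption. now exists x.
Qed.

Lemma continuous_bounded (g : R -> R) M :
  (forall x, continuous g x) ->
  exists B, 0 <= B /\ forall s, 0 <= s <= M -> Rabs (g s) <= B.
Proof.
intros Hc. destruct (Rle_lt_dec 0 M) as [HM | HM].
- destruct (continuity_ab_maj (fun s => Rabs (g s)) 0 M HM) as (x & Hx & _).
  + intros s _. apply continuity_pt_filterlim. change (continuous (fun s => Rabs (g s)) s). solve_continuous.
  + exists (Rabs (g x)). split; [apply Rabs_pos | exact Hx].
- exists 0. split; [lra | intros; lra].
Qed.

(** * The nonlinearity *)

Definition beta (r : R) : R := 2 * r - Rmax r 0.

Lemma beta_nonneg r : 0 <= r -> beta r = r.
Proof. intros H. unfold beta. rewrite Rmax_left; lra. Qed.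

Lemma beta_nonpos r : r <= 0 -> beta r = 2 * r.
Proof. intros H. unfold beta. rewrite Rmax_right; lra. Qed.

Ltac beta_cases r :=
  let H := fresh "H" in
  destruct (Rle_lt_dec 0 r) as [H | H];
  [rewrite (beta_nonneg r H) in * |
   rewrite (beta_nonpos r (Rlt_le _ _ H)) in *].

Lemma beta_lipschitz a b : Rabs (beta a - beta b) <= 2 * Rabs (a - b).
Proof.
beta_cases a; beta_cases b; unfold Rabs; repeat destruct Rcase_abs; lra.
Qed.

Lemma beta_bound a : Rabs (beta a) <= 2 * Rabs a.
Proof. beta_cases a; unfold Rabs; repeat destruct Rcase_abs; lra. Qed.

Lemma beta_scale k a : 0 <= k -> beta (k * a) = k * beta a.
Proof.
intros Hk. destruct (Rle_lt_dec 0 a).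
- rewrite !beta_nonneg by nra. ring.
- rewrite !beta_nonpos by nra. ring.
Qed.

Lemma beta_mult_ge a : a * a <= beta a * a.
Proof. beta_cases a; nra. Qed.

Lemma continuous_beta x : continuous beta x.
Proof.
apply continuous_eps. intros e He. exists (e / 2). split; [lra |].
intros y Hy. pose proof (beta_lipschitz y x). lra.
Qed.

Lemma continuous_beta_comp (f : R -> R) x :
  continuous f x -> continuous (fun y => beta (f y)) x.
Proof. intros Hf. apply (continuous_fun_comp f beta); [exact Hf | apply continuous_beta]. Qed.

(** * The averaging operator *)

(** For [s > 0] this is [s^(-m-1)] times the integral of [t^m g(t)] over [[0, s]]. Rescaling to the
    unit interval removes the division by zero, so that continuity at the origin comes for free. *)
Definition average (m : nat) (g : R -> R) (s : R) : R :=
  RInt (fun t => t ^ m * g (s * t)) 0 1.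

Lemma average_integrable m g s :
  (forall x, continuous g x) -> ex_RInt (fun t => t ^ m * g (s * t)) 0 1.
Proof. intros Hg. apply ex_RInt_continuous_all. intros x. solve_continuous. Qed.

Lemma pow_unit_interval m t : 0 <= t <= 1 -> 0 <= t ^ m <= 1.
Proof.
intros Ht. split; [apply pow_le; lra |]. rewrite <- (pow1 m). apply pow_incr. lra.
Qed.

Lemma average_bound m g s B :
  (forall x, continuous g x) -> 0 <= s ->
  (forall t, 0 <= t <= s -> Rabs (g t) <= B) -> Rabs (average m g s) <= B.
Proof.
intros Hg Hs HB. unfold average.
apply Rle_trans with ((1 - 0) * B); [| lra].
apply abs_RInt_le_const; [lra | now apply average_integrable |].
intros t Ht. rewrite Rabs_mult. destruct (pow_unit_interval m t Ht) as [H0 H1].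
rewrite (Rabs_pos_eq (t ^ m)) by assumption.
assert (Rabs (g (s * t)) <= B) by (apply HB; nra).
pose proof (Rabs_pos (g (s * t))). nra.
Qed.

Lemma average_minus m g h s :
  (forall x, continuous g x) -> (forall x, continuous h x) ->
  average m g s - average m h s = average m (fun t => g t - h t) s.
Proof.
intros Hg Hh. unfold average.
symmetry. etransitivity; [| apply (RInt_minus (fun t => t ^ m * g (s * t)) (fun t => t ^ m * h (s * t)));
  now apply average_integrable].
apply RInt_ext. intros t _. unfold minus, plus, opp; simpl. ring.
Qed.

Lemma average_continuous m g x :
  (forall x, continuous g x) -> continuous (average m g) x.
Proof.
intros Hg. apply continuous_eps. intros e He.
destruct (uniform_continuity_2d_1d (fun t s => g (s * t)) 0 1 x) with (eps := mkposreal (e / 2) (is_pos_div_2 (mkposreal e He)))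
  as [d Hd].
{ intros t _. apply (continuity_1d_2d_pt_comp g (fun t s => s * t)).
  - apply continuity_pt_filterlim, Hg.
  - apply continuity_2d_pt_mult; [apply continuity_2d_pt_id2 | apply continuity_2d_pt_id1]. }
exists d. split; [apply cond_pos |]. intros y Hy.
unfold average.
rewrite <- (RInt_minus (fun t => t ^ m * g (y * t)) (fun t => t ^ m * g (x * t)))
  by now apply average_integrable.
apply Rle_lt_trans with ((1 - 0) * (e / 2)); [| lra].
apply abs_RInt_le_const; [lra | |].
- apply (ex_RInt_minus (fun t => t ^ m * g (y * t)) (fun t => t ^ m * g (x * t)));
    now apply average_integrable.
- intros t Ht. unfold minus, plus, opp; simpl.
  replace (t ^ m * g (y * t) + - (t ^ m * g (x * t)))
    with (t ^ m * (g (y * t) - g (x * t))) by ring.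
  rewrite Rabs_mult. destruct (pow_unit_interval m t Ht) as [H0 H1].
  rewrite (Rabs_pos_eq (t ^ m)) by assumption.
  apply Rabs_def2 in Hy.
  assert (H : Rabs (g (y * t) - g (x * t)) < e / 2).
  { pose proof (cond_pos d).
    apply (Hd t x t y); try lra.
    rewrite Rminus_diag, Rabs_R0. assumption. }
  pose proof (Rabs_pos (g (y * t) - g (x * t))). nra.
Qed.

Lemma average_primitive m g s :
  (forall x, continuous g x) ->
  s ^ S m * average m g s = RInt (fun t => t ^ m * g t) 0 s.
Proof.
intros Hg. unfold average.
transitivity (RInt (fun t => scal (s ^ S m) (t ^ m * g (s * t))) 0 1).
{ symmetry. apply (RInt_scal (fun t => t ^ m * g (s * t))). now apply average_integrable. }
pose proof (RInt_comp_lin (fun t => t ^ m * g t) s 0 0 1) as H.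
replace (s * 0 + 0) with 0 in H by ring. replace (s * 1 + 0) with s in H by ring.
rewrite <- H by (apply ex_RInt_continuous_all; intros x; solve_continuous).
apply RInt_ext. intros t _. unfold scal; simpl; unfold mult; simpl.
eqR.
rewrite Rplus_0_r, Rpow_mult_distr. ring.
Qed.

Lemma average_derive m g s :
  (forall x, continuous g x) -> 0 < s ->
  is_derive (average m g) s ((g s - INR (S m) * average m g s) / s).
Proof.
intros Hg Hs.
set (H := fun s => RInt (fun t => t ^ m * g t) 0 s).
assert (HH : is_derive H s (s ^ m * g s)).
{ apply (is_derive_RInt_all (fun t => t ^ m * g t)). intros x; solve_continuous. }
apply (is_derive_ext_loc (fun s => H s / s ^ S m)).
{ exists (mkposreal s Hs). intros y Hy. apply Rabs_def2 in Hy. simpl in Hy.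
  unfold minus, plus, opp in Hy; simpl in Hy.
  unfold H. rewrite <- average_primitive by assumption. eqR. field. apply pow_nonzero. lra. }
assert (Hp : is_derive (fun s => s ^ S m) s (INR (S m) * s ^ m)).
{ evar_last.
  - apply (is_derive_pow (fun s => s) (S m) s 1). apply (is_derive_id (K := R_AbsRing)).
  - simpl pred. eqR. ring. }
assert (Hn : s ^ m <> 0) by (apply pow_nonzero; lra).
evar_last.
{ apply (is_derive_div H (fun s => s ^ S m)); [exact HH | exact Hp |].
  apply pow_nonzero. lra. }
unfold H. rewrite <- average_primitive by assumption.
eqR. simpl pow. field. split; [lra | assumption].
Qed.

(** * Picard iteration *)

(* With [N = m + 1] and [c = (N + alpha)/2] the profile equation integrates to
   [f' = s beta(f)/2 - c s^(1-N) int_0^s t^(N-1) beta(f(t)) dt], whose right-hand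
   side is Lipschitz in [f] even across sign changes. *)
Definition slope (m : nat) (c : R) (f : R -> R) (r : R) : R :=
  r * (beta (f r) / 2 - c * average m (fun t => beta (f t)) r).

(* [Rabs] makes the iterates even, hence continuous on the whole line. *)
Definition picard_op (m : nat) (c f0 : R) (f : R -> R) (s : R) : R :=
  f0 + RInt (slope m c f) 0 (Rabs s).

(* Chosen so that [int_0^s l r (weight l r) dr <= weight l s / 2]: in the norm
   weighted by it the Picard operator contracts by 1/2. *)
Definition weight (l r : R) : R := exp (l * r ^ 2).

Lemma weight_pos l r : 0 < weight l r.
Proof. apply exp_pos. Qed.

Lemma weight_le l r s : 0 <= l -> 0 <= r <= s -> weight l r <= weight l s.
Proof.
intros Hl Hrs. unfold weight.
destruct (Rle_lt_or_eq_dec (l * r ^ 2) (l * s ^ 2)) as [H | ->]; [| | lra].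
{ apply Rmult_le_compat_l; [assumption | now apply pow_incr]. }
left. now apply exp_increasing.
Qed.

Lemma weight_ge_1 l r : 0 <= l -> 1 <= weight l r.
Proof.
intros Hl. unfold weight. rewrite <- exp_0.
destruct (Rle_lt_or_eq_dec 0 (l * r ^ 2)) as [H | <-]; [| | lra].
{ apply Rmult_le_pos; [assumption | apply pow2_ge_0]. }
left. now apply exp_increasing.
Qed.

Lemma continuous_average_beta m f x :
  (forall y, continuous f y) -> continuous (average m (fun t => beta (f t))) x.
Proof.
intros Hf. apply average_continuous. intros y. now apply continuous_beta_comp.
Qed.

Lemma slope_continuous m c f x :
  (forall y, continuous f y) -> continuous (slope m c f) x.
Proof.
intros Hf. unfold slope.
apply continuous_Rmult; [apply continuous_id |].
apply continuous_Rminus; apply continuous_Rmult; try apply continuous_const.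
- now apply continuous_beta_comp.
- now apply continuous_average_beta.
Qed.

Lemma picard_op_continuous m c f0 f x :
  (forall y, continuous f y) -> continuous (picard_op m c f0 f) x.
Proof.
intros Hf. unfold picard_op. apply continuous_Rplus; [apply continuous_const |].
apply (continuous_fun_comp Rabs (fun y => RInt (slope m c f) 0 y)); [apply continuous_Rabs |].
eapply continuous_of_derive. apply is_derive_RInt_all.
intros y. now apply slope_continuous.
Qed.

Lemma weighted_integral_bound (l X s : R) (h : R -> R) :
  0 <= s -> (forall x, continuous h x) -> 0 <= X ->
  (forall r, 0 <= r <= s -> Rabs (h r) <= r * l * X * weight l r) ->
  Rabs (RInt h 0 s) <= X / 2 * weight l s.
Proof.
intros Hs Hh HX Hb.
assert (Hd : forall r, is_derive (fun r => X / 2 * weight l r) r (r * l * X * weight l r)).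
{ intros r. unfold weight. auto_derive; [trivial |]. eqR. simpl. field. }
assert (Hc : forall x, continuous (fun r => r * l * X * weight l r) x).
{ intros x. apply continuous_Rmult; [solve_continuous |].
  eapply continuous_of_derive. unfold weight. auto_derive; [trivial | reflexivity]. }
apply Rle_trans with (RInt (fun r => r * l * X * weight l r) 0 s).
- apply Rle_trans with (RInt (fun r => Rabs (h r)) 0 s).
  + apply abs_RInt_le; [assumption | now apply ex_RInt_continuous_all].
  + apply RInt_le; try assumption.
    * apply ex_RInt_continuous_all. intros x. solve_continuous.
    * now apply ex_RInt_continuous_all.
    * intros r Hr. apply Hb. lra.
- rewrite (is_RInt_unique _ 0 s (X / 2 * weight l s - X / 2 * weight l 0)).
  + pose proof (weight_pos l 0). nra.
  + apply (is_RInt_derive (fun r => X / 2 * weight l r) (fun r => r * l * X * weight l r)).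
    * intros; apply Hd.
    * intros; apply Hc.
Qed.

(** [beta] has Lipschitz constant 2, which the first term of [slope] halves, and averaging does not
    enlarge a uniform bound; hence the factor [1 + 2 |c|]. *)
Lemma slope_diff_bound m c f g r e :
  (forall x, continuous f x) -> (forall x, continuous g x) -> 0 <= r ->
  (forall t, 0 <= t <= r -> Rabs (f t - g t) <= e) ->
  Rabs (slope m c f r - slope m c g r) <= r * (1 + 2 * Rabs c) * e.
Proof.
intros Hf Hg Hr He. unfold slope.
set (A := average m (fun t => beta (f t)) r - average m (fun t => beta (g t)) r).
assert (HA : Rabs A <= 2 * e).
{ unfold A. rewrite average_minus by (intros; now apply continuous_beta_comp).
  apply average_bound; [| assumption |].
  - intros x. apply continuous_Rminus; now apply continuous_beta_comp.
  - intros t Ht. pose proof (beta_lipschitz (f t) (g t)). specialize (He t Ht). lra. }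
match goal with |- Rabs ?x <= _ =>
  replace x with (r * ((beta (f r) - beta (g r)) / 2 - c * A)) by (unfold A; field) end.
rewrite Rabs_mult, (Rabs_pos_eq r), Rmult_assoc by assumption.
apply Rmult_le_compat_l; [assumption |].
pose proof (beta_lipschitz (f r) (g r)).
assert (Rabs (f r - g r) <= e) by (apply He; lra).
eapply Rle_trans; [apply Rabs_triang |].
rewrite Rabs_Ropp, Rabs_mult. unfold Rdiv. rewrite Rabs_mult, (Rabs_pos_eq (/ 2)) by lra.
pose proof (Rabs_pos c). nra.
Qed.

Lemma picard_contraction m c f0 l f g M X :
  1 + 2 * Rabs c <= l ->
  (forall x, continuous f x) -> (forall x, continuous g x) -> 0 <= X ->
  (forall r, 0 <= r <= M -> Rabs (f r - g r) <= X * weight l r) ->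
  forall s, 0 <= s <= M ->
  Rabs (picard_op m c f0 f s - picard_op m c f0 g s) <= X / 2 * weight l s.
Proof.
intros Hl Hf Hg HX Hb s Hs. unfold picard_op. rewrite (Rabs_pos_eq s) by lra.
replace (f0 + RInt (slope m c f) 0 s - (f0 + RInt (slope m c g) 0 s))
  with (RInt (slope m c f) 0 s - RInt (slope m c g) 0 s) by ring.
assert (Hsf : forall x, continuous (slope m c f) x) by (intros; now apply slope_continuous).
assert (Hsg : forall x, continuous (slope m c g) x) by (intros; now apply slope_continuous).
rewrite <- (RInt_minus (slope m c f) (slope m c g)) by now apply ex_RInt_continuous_all.
apply weighted_integral_bound; try lra.
- intros x. apply continuous_Rminus; auto.
- intros r Hr. unfold minus, plus, opp; simpl.
  pose proof (Rabs_pos c). pose proof (weight_pos l r).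
  eapply Rle_trans; [apply (slope_diff_bound m c f g r (X * weight l r)); try assumption; try lra |].
  + intros t Ht. eapply Rle_trans; [apply Hb; lra |].
    apply Rmult_le_compat_l; [assumption |]. apply weight_le; lra.
  + rewrite !Rmult_assoc. apply Rmult_le_compat_l; [lra |].
    apply Rmult_le_compat_r; [nra | lra].
Qed.

(** Gronwall by iteration: the map [X -> eta + X / 2] improves any bound and has the fixed point
    [2 eta]. The case [eta = 0] gives uniqueness, a positive [eta] gives dependence on the
    parameter. *)
Lemma weighted_gronwall (w : R -> R) l M eta X0 :
  0 <= eta -> 0 <= X0 ->
  (forall r, 0 <= r <= M -> w r <= X0 * weight l r) ->
  (forall X, 0 <= X -> (forall r, 0 <= r <= M -> w r <= X * weight l r) ->
     forall s, 0 <= s <= M -> w s <= (eta + X / 2) * weight l s) ->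
  forall s, 0 <= s <= M -> w s <= 2 * eta * weight l s.
Proof.
intros He HX0 H0 Hstep s Hs.
assert (Hn : forall n s, 0 <= s <= M -> w s <= (2 * eta + X0 * (1 / 2) ^ n) * weight l s).
{ induction n as [|n IH]; intros r Hr.
  - simpl. specialize (H0 r Hr). pose proof (weight_pos l r).
    assert (0 <= eta * weight l r) by (apply Rmult_le_pos; lra). lra.
  - assert (0 <= X0 * (1 / 2) ^ n) by (apply Rmult_le_pos; [| apply pow_le]; lra).
    eapply Rle_trans; [apply (Hstep (2 * eta + X0 * (1 / 2) ^ n) ltac:(lra) IH r Hr) |].
    apply Rmult_le_compat_r; [left; apply weight_pos |]. simpl. lra. }
apply (is_lim_seq_le (fun _ => w s) (fun n => (2 * eta + X0 * (1 / 2) ^ n) * weight l s)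
  (Finite (w s)) (Finite (2 * eta * weight l s))).
- intros n. now apply Hn.
- apply is_lim_seq_const.
- replace (2 * eta * weight l s) with ((2 * eta + X0 * 0) * weight l s) by ring.
  apply (is_lim_seq_scal_r _ (weight l s) (Finite (2 * eta + X0 * 0))).
  apply (is_lim_seq_plus' _ _ (2 * eta) (X0 * 0)); [apply is_lim_seq_const |].
  apply (is_lim_seq_scal_l _ X0 (Finite 0)). apply is_lim_seq_geom.
  rewrite Rabs_pos_eq; lra.
Qed.

Lemma eventually_half_pow_lt B e :
  0 <= B -> 0 < e -> exists n, forall i, (n <= i)%nat -> B * (1 / 2) ^ i < e.
Proof.
intros HB He.
assert (He' : 0 < e / (B + 1)) by (apply Rdiv_lt_0_compat; lra).
destruct (pow_lt_1_zero (1 / 2) ltac:(rewrite Rabs_pos_eq; lra) _ He') as [n Hn].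
exists n. intros i Hi. specialize (Hn i Hi).
rewrite Rabs_pos_eq in Hn by (apply pow_le; lra).
apply (Rmult_lt_compat_r (B + 1)) in Hn; [| lra].
replace (e / (B + 1) * (B + 1)) with e in Hn by (field; lra).
assert (0 < (1 / 2) ^ i) by (apply pow_lt; lra). lra.
Qed.

Fixpoint picard (m : nat) (c f0 : R) (i : nat) : R -> R :=
  match i with
  | O => fun _ => 0
  | S j => picard_op m c f0 (picard m c f0 j)
  end.

Definition profile_sol (m : nat) (c f0 s : R) : R :=
  real (Lim_seq (fun i => picard m c f0 i s)).

Lemma picard_continuous m c f0 i x : continuous (picard m c f0 i) x.
Proof.
revert x. induction i as [|i IH]; intros x; simpl.
- apply continuous_const.
- now apply picard_op_continuous.
Qed.

Lemma picard_even m c f0 i s : picard m c f0 i (Rabs s) = picard m c f0 i s.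
Proof.
destruct i as [|i]; simpl; [reflexivity |].
unfold picard_op. now rewrite Rabs_Rabsolu.
Qed.

Lemma picard_step m c f0 l i s :
  1 + 2 * Rabs c <= l -> 0 <= s ->
  Rabs (picard m c f0 (S i) s - picard m c f0 i s) <= Rabs f0 * (1 / 2) ^ i * weight l s.
Proof.
intros Hl. pose proof (Rabs_pos c). pose proof (Rabs_pos f0). revert s. induction i as [|i IH]; intros s Hs.
- simpl picard. unfold picard_op.
  rewrite (RInt_ext _ (fun _ => 0)).
  + rewrite RInt_const. unfold scal; simpl; unfold mult; simpl.
    replace (f0 + (Rabs s - 0) * 0 - 0) with f0 by ring.
    pose proof (weight_ge_1 l s). simpl. nra.
  + intros x _. unfold slope, average. rewrite (RInt_ext _ (fun _ => 0)).
    * rewrite RInt_const, beta_nonneg by lra. unfold scal; simpl; unfold mult; simpl. eqR. field.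
    * intros t _. rewrite beta_nonneg by lra. eqR. ring.
- replace (Rabs f0 * (1 / 2) ^ S i * weight l s)
    with (Rabs f0 * (1 / 2) ^ i / 2 * weight l s) by (simpl; field).
  apply (picard_contraction m c f0 l (picard m c f0 (S i)) (picard m c f0 i) s); try lra.
  + apply picard_continuous.
  + apply picard_continuous.
  + apply Rmult_le_pos; [| apply pow_le]; lra.
  + intros r Hr. apply IH. lra.
Qed.

(** [picard_step] telescopes; the factor [1 - (1/2)^j] keeps the partial geometric sum exact, which
    is what closes the induction. *)
Lemma picard_cauchy m c f0 l i j s :
  1 + 2 * Rabs c <= l -> 0 <= s ->
  Rabs (picard m c f0 (i + j) s - picard m c f0 i s) <=
  2 * Rabs f0 * (1 / 2) ^ i * (1 - (1 / 2) ^ j) * weight l s.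
Proof.
intros Hl Hs. induction j as [|j IH].
- rewrite Nat.add_0_r, Rminus_diag, Rabs_R0. simpl. lra.
- rewrite Nat.add_succ_r.
  pose proof (picard_step m c f0 l (i + j) s Hl Hs) as H.
  rewrite Rdef_pow_add in H.
  replace (picard m c f0 (S (i + j)) s - picard m c f0 i s) with
    ((picard m c f0 (S (i + j)) s - picard m c f0 (i + j) s) +
     (picard m c f0 (i + j) s - picard m c f0 i s)) by ring.
  eapply Rle_trans; [apply Rabs_triang |].
  replace ((1 / 2) ^ S j) with ((1 / 2) ^ j / 2) by (simpl; field).
  lra.
Qed.

Lemma picard_lim m c f0 s :
  is_lim_seq (fun i => picard m c f0 i s) (profile_sol m c f0 s).
Proof.
apply Lim_seq_correct'. apply ex_lim_seq_cauchy_corr. intros e.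
set (l := 1 + 2 * Rabs c). set (W := weight l (Rabs s)).
pose proof (Rabs_pos f0) as Hf0. assert (HW : 0 < W) by apply weight_pos.
destruct (eventually_half_pow_lt (4 * Rabs f0 * W) e) as [n Hn].
{ repeat apply Rmult_le_pos; lra. }
{ apply cond_pos. }
exists n. intros p q Hp Hq.
assert (Hone : forall p, (n <= p)%nat ->
  Rabs (picard m c f0 p s - picard m c f0 n s) <= 2 * Rabs f0 * (1 / 2) ^ n * W).
{ intros k Hk. replace k with (n + (k - n))%nat by lia.
  rewrite <- !(picard_even m c f0 _ s).
  eapply Rle_trans; [apply (picard_cauchy m c f0 l); [unfold l; lra | apply Rabs_pos] |].
  assert (0 <= (1 / 2) ^ (k - n)) by (apply pow_le; lra).
  assert (0 <= (1 / 2) ^ n) by (apply pow_le; lra).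
  fold W. apply Rmult_le_compat_r; [lra |].
  assert (0 <= 2 * Rabs f0 * (1 / 2) ^ n * (1 / 2) ^ (k - n)) by (repeat apply Rmult_le_pos; lra).
  lra. }
specialize (Hn n (Nat.le_refl n)).
pose proof (Hone p Hp) as H1. pose proof (Hone q Hq) as H2.
replace (picard m c f0 p s - picard m c f0 q s) with
  ((picard m c f0 p s - picard m c f0 n s) - (picard m c f0 q s - picard m c f0 n s)) by ring.
eapply Rle_lt_trans; [apply Rabs_triang |]. rewrite Rabs_Ropp. lra.
Qed.

Lemma profile_sol_even m c f0 s : profile_sol m c f0 (Rabs s) = profile_sol m c f0 s.
Proof.
unfold profile_sol. f_equal. apply Lim_seq_ext. intros i. apply picard_even.
Qed.

Lemma picard_error m c f0 l i s :
  1 + 2 * Rabs c <= l -> 0 <= s ->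
  Rabs (profile_sol m c f0 s - picard m c f0 i s) <=
  2 * Rabs f0 * (1 / 2) ^ i * weight l s.
Proof.
intros Hl Hs.
apply (is_lim_seq_le (fun j => Rabs (picard m c f0 (j + i) s - picard m c f0 i s))
  (fun _ => 2 * Rabs f0 * (1 / 2) ^ i * weight l s)
  (Finite (Rabs (profile_sol m c f0 s - picard m c f0 i s)))
  (Finite (2 * Rabs f0 * (1 / 2) ^ i * weight l s))).
- intros j. rewrite Nat.add_comm.
  eapply Rle_trans; [apply (picard_cauchy m c f0 l); assumption |].
  pose proof (Rabs_pos f0). pose proof (weight_pos l s).
  assert (0 <= (1 / 2) ^ j) by (apply pow_le; lra).
  assert (0 <= (1 / 2) ^ i) by (apply pow_le; lra).
  apply Rmult_le_compat_r; [lra |].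
  assert (0 <= 2 * Rabs f0 * (1 / 2) ^ i * (1 / 2) ^ j) by (repeat apply Rmult_le_pos; lra). lra.
- apply (is_lim_seq_abs _ (Finite (profile_sol m c f0 s - picard m c f0 i s))).
  apply is_lim_seq_minus'; [| apply is_lim_seq_const].
  apply (is_lim_seq_incr_n (fun j => picard m c f0 j s) i). apply picard_lim.
- apply is_lim_seq_const.
Qed.

Lemma profile_sol_bound m c f0 l s :
  1 + 2 * Rabs c <= l -> 0 <= s ->
  Rabs (profile_sol m c f0 s) <= 2 * Rabs f0 * weight l s.
Proof.
intros Hl Hs. pose proof (picard_error m c f0 l 0 s Hl Hs) as H. simpl in H.
rewrite Rminus_0_r in H. lra.
Qed.

Lemma profile_sol_continuous m c f0 x : continuous (profile_sol m c f0) x.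
Proof.
set (l := 1 + 2 * Rabs c). assert (Hl : 1 + 2 * Rabs c <= l) by (unfold l; lra).
pose proof (Rabs_pos c).
apply continuous_eps. intros e He.
set (W := weight l (Rabs x + 1)).
assert (HW : 0 < W) by apply weight_pos. pose proof (Rabs_pos f0) as Hf0.
destruct (eventually_half_pow_lt (8 * Rabs f0 * W) e) as [n Hn]; [| assumption |].
{ repeat apply Rmult_le_pos; lra. }
specialize (Hn n (Nat.le_refl n)).
assert (0 < (1 / 2) ^ n) by (apply pow_lt; lra).
destruct (proj1 (continuous_eps _ x) (picard_continuous m c f0 n x) (e / 2) ltac:(lra))
  as (d & Hd & Hnear).
assert (Herr : forall y, Rabs y <= Rabs x + 1 ->
  Rabs (profile_sol m c f0 y - picard m c f0 n y) < e / 4).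
{ intros y Hy. rewrite <- profile_sol_even, <- picard_even.
  eapply Rle_lt_trans; [apply (picard_error m c f0 l); [assumption | apply Rabs_pos] |].
  assert (weight l (Rabs y) <= W).
  { apply weight_le; [lra |]. split; [apply Rabs_pos | assumption]. }
  assert (2 * Rabs f0 * (1 / 2) ^ n * weight l (Rabs y) <= 2 * Rabs f0 * (1 / 2) ^ n * W).
  { apply Rmult_le_compat_l; [| assumption]. repeat apply Rmult_le_pos; lra. }
  lra. }
exists (Rmin d 1). split; [apply Rmin_glb_lt; lra |]. intros y Hy.
assert (Hy1 : Rabs (y - x) < d) by (eapply Rlt_le_trans; [apply Hy | apply Rmin_l]).
assert (Hy2 : Rabs (y - x) < 1) by (eapply Rlt_le_trans; [apply Hy | apply Rmin_r]).
assert (Hyx : Rabs y <= Rabs x + 1).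
{ replace y with (x + (y - x)) by ring. eapply Rle_trans; [apply Rabs_triang |]. lra. }
pose proof (Herr y Hyx) as E1. pose proof (Herr x ltac:(lra)) as E2.
specialize (Hnear y Hy1).
apply Rabs_def2 in E1, E2, Hnear. apply Rabs_def1; lra.
Qed.

Lemma profile_sol_fix m c f0 s :
  profile_sol m c f0 s = picard_op m c f0 (profile_sol m c f0) s.
Proof.
set (l := 1 + 2 * Rabs c). assert (Hl : 1 + 2 * Rabs c <= l) by (unfold l; lra).
pose proof (Rabs_pos f0) as Hf0.
rewrite <- profile_sol_even.
replace (picard_op m c f0 (profile_sol m c f0) s)
  with (picard_op m c f0 (profile_sol m c f0) (Rabs s))
  by (unfold picard_op; now rewrite Rabs_Rabsolu).
pose proof (Rabs_pos s) as Hs. generalize dependent (Rabs s). clear s. intros s Hs.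
assert (H1 : is_lim_seq (fun i => picard m c f0 (S i) s) (profile_sol m c f0 s)).
{ apply (is_lim_seq_incr_1 (fun i => picard m c f0 i s)). apply picard_lim. }
assert (H2 : is_lim_seq (fun i => picard m c f0 (S i) s) (picard_op m c f0 (profile_sol m c f0) s)).
{ apply is_lim_seq_spec. intros e.
  pose proof (weight_pos l s) as HW.
  destruct (eventually_half_pow_lt (Rabs f0 * weight l s) e) as [n Hn].
  { apply Rmult_le_pos; lra. }
  { apply cond_pos. }
  exists n. intros i Hi. specialize (Hn i Hi).
  assert (0 < (1 / 2) ^ i) by (apply pow_lt; lra).
  eapply Rle_lt_trans.
  - apply (picard_contraction m c f0 l (picard m c f0 i) (profile_sol m c f0) s
      (2 * Rabs f0 * (1 / 2) ^ i) Hl).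
    + apply picard_continuous.
    + apply profile_sol_continuous.
    + nra.
    + intros r Hr. rewrite Rabs_minus_sym. apply picard_error; [assumption | lra].
    + lra.
  - lra. }
apply is_lim_seq_unique in H1. apply is_lim_seq_unique in H2.
rewrite H1 in H2. now injection H2.
Qed.

(** Uniqueness is stated on [[0, M]] because it is applied to functions known to solve the integral
    equation only so far: the explicit solutions up to their first zero, and a given profile up to a
    possible degenerate zero. *)
Lemma profile_sol_unique m c f0 g M :
  (forall x, continuous g x) ->
  (forall s, 0 <= s <= M -> g s = f0 + RInt (slope m c g) 0 s) ->
  forall s, 0 <= s <= M -> g s = profile_sol m c f0 s.
Proof.
intros Hg Hfix.
set (l := 1 + 2 * Rabs c). assert (Hl : 1 + 2 * Rabs c <= l) by (unfold l; lra).
pose proof (Rabs_pos c) as Hc.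
pose proof (profile_sol_continuous m c f0) as Hsol.
destruct (continuous_bounded (fun s => g s - profile_sol m c f0 s) M) as (B & HB & Hbound).
{ intros x. apply continuous_Rminus; auto. }
assert (H : forall s, 0 <= s <= M -> Rabs (g s - profile_sol m c f0 s) <= 2 * 0 * weight l s).
{ apply (weighted_gronwall (fun s => Rabs (g s - profile_sol m c f0 s)) l M 0 B); try lra.
  - intros r Hr. pose proof (weight_ge_1 l r ltac:(lra)). specialize (Hbound r Hr). nra.
  - intros X HX Hb s Hs. rewrite Rplus_0_l.
    rewrite (Hfix s Hs), profile_sol_fix.
    replace (f0 + RInt (slope m c g) 0 s) with (picard_op m c f0 g s)
      by (unfold picard_op; rewrite Rabs_pos_eq; lra).
    now apply (picard_contraction m c f0 l g (profile_sol m c f0) M). }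
intros s Hs. specialize (H s Hs). apply Rminus_diag_uniq.
apply Rabs_eq_0. pose proof (Rabs_pos (g s - profile_sol m c f0 s)). lra.
Qed.

Lemma profile_sol_lipschitz_c m f0 B M :
  0 <= M -> exists C, 0 <= C /\
  forall c c', Rabs c <= B -> Rabs c' <= B -> forall s, 0 <= s <= M ->
  Rabs (profile_sol m c f0 s - profile_sol m c' f0 s) <= C * Rabs (c - c').
Proof.
intros HM.
destruct (Rlt_le_dec B 0) as [HB | HB].
{ exists 0. split; [lra |]. intros c c' Hc. pose proof (Rabs_pos c). lra. }
set (l := 1 + 2 * B). set (W := weight l M). set (G := 4 * Rabs f0 * W).
assert (HW : 0 < W) by apply weight_pos. pose proof (Rabs_pos f0) as Hf0.
assert (HG : 0 <= G) by (unfold G; nra).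
exists (2 * (G * M ^ 2) * W). split.
{ apply Rmult_le_pos; [| lra]. apply Rmult_le_pos; [lra |]. apply Rmult_le_pos; [assumption | apply pow_le; lra]. }
intros c c' Hc Hc'.
assert (Hl : 1 + 2 * Rabs c <= l) by (unfold l; lra).
assert (Hl' : 1 + 2 * Rabs c' <= l) by (unfold l; lra).
set (f := profile_sol m c f0). set (g := profile_sol m c' f0).
assert (Hf : forall x, continuous f x) by apply profile_sol_continuous.
assert (Hg : forall x, continuous g x) by apply profile_sol_continuous.
pose proof (Rabs_pos (c - c')) as Hcc.
assert (HGb : forall t, 0 <= t <= M -> Rabs (beta (g t)) <= G).
{ intros t Ht. eapply Rle_trans; [apply beta_bound |].
  pose proof (profile_sol_bound m c' f0 l t Hl' (proj1 Ht)) as H. fold g in H.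
  assert (weight l t <= W) by (apply weight_le; unfold l; lra). unfold G. nra. }
assert (He : 0 <= Rabs (c - c') * (G * M ^ 2)).
{ apply Rmult_le_pos; [lra |]. apply Rmult_le_pos; [assumption | apply pow_le; lra]. }
assert (H : forall s, 0 <= s <= M -> Rabs (f s - g s) <= 2 * (Rabs (c - c') * (G * M ^ 2)) * weight l s).
{ apply (weighted_gronwall (fun s => Rabs (f s - g s)) l M _ (4 * Rabs f0)); [assumption | lra | |].
  - intros r Hr.
    pose proof (profile_sol_bound m c f0 l r Hl (proj1 Hr)) as H1.
    pose proof (profile_sol_bound m c' f0 l r Hl' (proj1 Hr)) as H2. fold f in H1. fold g in H2.
    unfold Rminus. eapply Rle_trans; [apply Rabs_triang |]. rewrite Rabs_Ropp. lra.
  - intros X HX Hb s Hs.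
    pose proof (weight_ge_1 l s ltac:(unfold l; lra)) as Hw1.
    (* The first difference changes the function at fixed [c] and contracts; the second changes [c]
       at the fixed function [g] and is the source term of the Gronwall argument. *)
    replace (f s - g s) with ((picard_op m c f0 f s - picard_op m c f0 g s) +
      (picard_op m c f0 g s - picard_op m c' f0 g s)).
    2: { unfold f, g. rewrite (profile_sol_fix m c f0 s), (profile_sol_fix m c' f0 s).
         ring. }
    eapply Rle_trans; [apply Rabs_triang |].
    pose proof (picard_contraction m c f0 l f g M X Hl Hf Hg HX Hb s Hs) as H1.
    assert (H2 : Rabs (picard_op m c f0 g s - picard_op m c' f0 g s) <= Rabs (c - c') * (G * M ^ 2)).
    { unfold picard_op. rewrite (Rabs_pos_eq s) by lra.
      replace (f0 + RInt (slope m c g) 0 s - (f0 + RInt (slope m c' g) 0 s))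
        with (RInt (slope m c g) 0 s - RInt (slope m c' g) 0 s) by ring.
      rewrite <- (RInt_minus (slope m c g) (slope m c' g))
        by (apply ex_RInt_continuous_all; intros; now apply slope_continuous).
      apply Rle_trans with ((s - 0) * (M * (Rabs (c - c') * G))).
      - apply abs_RInt_le_const; [lra | |].
        + apply ex_RInt_continuous_all. intros x. apply continuous_Rminus; now apply slope_continuous.
        + intros r Hr. unfold minus, plus, opp; simpl. unfold slope.
          match goal with |- Rabs ?x <= _ =>
            replace x with (r * ((c' - c) * average m (fun t => beta (g t)) r)) by ring end.
          assert (Rabs (average m (fun t => beta (g t)) r) <= G).
          { apply average_bound; [intros; now apply continuous_beta_comp | lra |].
            intros t Ht. apply HGb. lra. }
          rewrite !Rabs_mult, (Rabs_pos_eq r), (Rabs_minus_sym c') by lra.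
          pose proof (Rabs_pos (average m (fun t => beta (g t)) r)).
          apply Rmult_le_compat; try lra; [nra |].
          apply Rmult_le_compat; lra.
      - rewrite Rminus_0_r.
        replace (Rabs (c - c') * (G * M ^ 2)) with (M * (M * (Rabs (c - c') * G))) by ring.
        apply Rmult_le_compat_r; [| lra].
        apply Rmult_le_pos; [assumption | now apply Rmult_le_pos]. }
    rewrite Rmult_plus_distr_r. assert (Hm := Rmult_le_compat_l _ _ _ He Hw1). lra. }
intros s Hs. eapply Rle_trans; [now apply H |].
assert (Hw : weight l s <= W) by (apply weight_le; unfold l; lra).
assert (Hm := Rmult_le_compat_l _ _ _ He Hw). lra.
Qed.

(** * The solution with [f 0 = sg] and its Pruefer angle *)

Definition cst (m : nat) (al : R) : R := (INR m + 1 + al) / 2.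

Definition prof (m : nat) (al sg : R) : R -> R := profile_sol m (cst m al) sg.

Definition prof_avg (m : nat) (al sg : R) : R -> R :=
  average m (fun t => beta (prof m al sg t)).

Definition prof1 (m : nat) (al sg : R) : R -> R := slope m (cst m al) (prof m al sg).

(* This is [f' - s beta(f)/2], with derivative [flux1]. *)
Definition flux (m : nat) (al sg s : R) : R := - cst m al * (s * prof_avg m al sg s).

(** Written with the average in place of [flux / s], so that it is continuous at the origin as
    well. *)
Definition flux1 (m : nat) (al sg s : R) : R :=
  cst m al * (INR m * prof_avg m al sg s - beta (prof m al sg s)).

Definition energy (m : nat) (al sg s : R) : R := prof m al sg s ^ 2 + flux m al sg s ^ 2.

Definition turn_rate (m : nat) (al sg s : R) : R :=
  (prof m al sg s * flux1 m al sg s - flux m al sg s * prof1 m al sg s) / energy m al sg s.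

(** Integrating the angular velocity [(f q' - q f') / (f^2 + q^2)] yields a continuous branch of the
    angle without any inverse trigonometric function. The energy is known to be positive only for
    nonnegative arguments, whence [Rabs]. *)
Definition turn (m : nat) (al sg s : R) : R :=
  RInt (fun r => turn_rate m al sg (Rabs r)) 0 s.

Lemma INR_pos m : 0 <= INR m.
Proof. apply pos_INR. Qed.

Lemma prof_continuous m al sg x : continuous (prof m al sg) x.
Proof. apply profile_sol_continuous. Qed.

Lemma prof_avg_continuous m al sg x : continuous (prof_avg m al sg) x.
Proof. apply continuous_average_beta, prof_continuous. Qed.

Lemma prof1_continuous m al sg x : continuous (prof1 m al sg) x.
Proof. apply slope_continuous, prof_continuous. Qed.

Lemma prof_beta_continuous m al sg x : continuous (fun s => beta (prof m al sg s)) x.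
Proof. apply continuous_beta_comp, prof_continuous. Qed.

Lemma flux_continuous m al sg x : continuous (flux m al sg) x.
Proof.
unfold flux. pose proof (prof_avg_continuous m al sg) as H. solve_continuous.
Qed.

Lemma flux1_continuous m al sg x : continuous (flux1 m al sg) x.
Proof.
unfold flux1. pose proof (prof_avg_continuous m al sg) as H.
pose proof (prof_beta_continuous m al sg) as H1.
apply continuous_Rmult; [apply continuous_const |].
apply continuous_Rminus; [solve_continuous | apply H1].
Qed.

Lemma energy_continuous m al sg x : continuous (energy m al sg) x.
Proof.
unfold energy. pose proof (prof_continuous m al sg). pose proof (flux_continuous m al sg).
apply continuous_Rplus; apply (continuous_Rpow _ 2); auto.
Qed.

Lemma prof_integral m al sg s : 0 <= s -> prof m al sg s = sg + RInt (prof1 m al sg) 0 s.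
Proof.
intros Hs. unfold prof at 1. rewrite profile_sol_fix. unfold picard_op.
now rewrite (Rabs_pos_eq s) by assumption.
Qed.

Lemma prof_0 m al sg : prof m al sg 0 = sg.
Proof.
rewrite prof_integral by lra. rewrite RInt_point. unfold zero; simpl. lra.
Qed.

Lemma flux_0 m al sg : flux m al sg 0 = 0.
Proof. unfold flux. ring. Qed.

Lemma prof1_0 m al sg : prof1 m al sg 0 = 0.
Proof. unfold prof1, slope. ring. Qed.

Lemma prof1_flux m al sg s :
  prof1 m al sg s = s * beta (prof m al sg s) / 2 + flux m al sg s.
Proof. unfold prof1, slope, flux, prof_avg. field. Qed.

Lemma positive_near s : 0 < s ->
  locally s (fun y => 0 < y).
Proof.
intros Hs. exists (mkposreal s Hs). intros y Hy. apply Rabs_def2 in Hy.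
unfold minus, plus, opp in Hy; simpl in Hy. lra.
Qed.

Lemma prof_derive m al sg s : 0 < s -> is_derive (prof m al sg) s (prof1 m al sg s).
Proof.
intros Hs. apply (is_derive_ext_loc (fun s => sg + RInt (prof1 m al sg) 0 s)).
{ generalize (positive_near s Hs). apply filter_imp. intros y Hy. symmetry.
  apply prof_integral. lra. }
evar_last.
- apply is_derive_Rplus; [apply is_derive_Rconst |].
  apply is_derive_RInt_all. apply prof1_continuous.
- eqR. ring.
Qed.

Lemma flux_derive m al sg s : 0 < s -> is_derive (flux m al sg) s (flux1 m al sg s).
Proof.
intros Hs. unfold flux.
evar_last.
- apply is_derive_Rscal, is_derive_Rmult; [apply is_derive_Rid |].
  apply average_derive; [apply prof_beta_continuous | assumption].
- eqR. unfold flux1, prof_avg. rewrite S_INR. field. lra.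
Qed.

Lemma flux1_flux m al sg s : 0 < s ->
  flux1 m al sg s = - (INR m / s) * flux m al sg s - cst m al * beta (prof m al sg s).
Proof. intros Hs. unfold flux1, flux. field. lra. Qed.

Lemma energy_derive m al sg s : 0 < s ->
  is_derive (energy m al sg) s
    (2 * (prof m al sg s * prof1 m al sg s + flux m al sg s * flux1 m al sg s)).
Proof.
intros Hs. unfold energy. evar_last.
- apply is_derive_Rplus.
  + apply (is_derive_pow (prof m al sg) 2). now apply prof_derive.
  + apply (is_derive_pow (flux m al sg) 2). now apply flux_derive.
- eqR. simpl. ring.
Qed.

(** An estimate [E' >= - C E] makes [E exp (C s)] nondecreasing, so [f] and the flux never vanish
    together. As [m / s] is bounded only away from the origin, the estimate starts at [de], and
    continuity covers the points below [d]. *)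
Lemma energy_pos m al sg s : sg <> 0 -> 0 <= s -> 0 < energy m al sg s.
Proof.
intros Hsg Hs.
assert (H0 : 0 < energy m al sg 0).
{ unfold energy. rewrite prof_0, flux_0. nra. }
destruct (continuous_pos_near _ _ (energy_continuous m al sg 0) H0) as (d & Hd & Hnear).
destruct (Rlt_le_dec s d) as [Hsd | Hsd].
{ apply Hnear. rewrite Rminus_0_r, Rabs_pos_eq; assumption. }
set (de := d / 2). assert (Hde : 0 < de < d) by (unfold de; lra).
(* The three summands absorb [2 f q], the friction [- 2 (m/s) q^2] and [- 2 c q beta(f)]; the
   remaining term [s f beta(f)] is nonnegative. *)
set (C := 1 + 2 * (INR m / de) + 2 * Rabs (cst m al)).
assert (H : energy m al sg de * exp (C * de) <= energy m al sg s * exp (C * s)).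
{ apply (nondecreasing_of_derive (fun s => energy m al sg s * exp (C * s))
    (fun s => 2 * (prof m al sg s * prof1 m al sg s + flux m al sg s * flux1 m al sg s) * exp (C * s)
      + energy m al sg s * (C * exp (C * s)))); [lra | |].
  - intros x _. apply continuous_Rmult; [apply energy_continuous |].
    eapply continuous_of_derive. auto_derive; [trivial | reflexivity].
  - intros x Hx. split.
    + apply (is_derive_Rmult (energy m al sg) (fun s => exp (C * s))); [apply energy_derive; lra |].
      auto_derive; [trivial |]. eqR. ring.
    + replace (2 * (prof m al sg x * prof1 m al sg x + flux m al sg x * flux1 m al sg x) * exp (C * x)
      + energy m al sg x * (C * exp (C * x))) with
      ((2 * (prof m al sg x * prof1 m al sg x + flux m al sg x * flux1 m al sg x) +
       C * energy m al sg x) * exp (C * x)) by ring.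
      apply Rmult_le_pos; [| left; apply exp_pos].
      rewrite flux1_flux, prof1_flux by lra. unfold energy.
      generalize (prof m al sg x) (flux m al sg x). intros f q.
      assert (Hm : 0 <= INR m / x <= INR m / de).
      { pose proof (INR_pos m). split.
        - apply Rmult_le_pos; [assumption |]. left. apply Rinv_0_lt_compat. lra.
        - apply Rmult_le_compat_l; [assumption |]. apply Rinv_le_contravar; lra. }
      assert (Hb := beta_mult_ge f). assert (Hb2 := beta_bound f).
      assert (Hq : - (2 * Rabs (cst m al) * (f ^ 2 + q ^ 2)) <= 2 * (q * - (cst m al * beta f))).
      { assert (Hqf : Rabs (q * (cst m al * beta f)) <= Rabs (cst m al) * (f ^ 2 + q ^ 2)).
        { rewrite !Rabs_mult.
          replace (Rabs q * (Rabs (cst m al) * Rabs (beta f))) with (Rabs (cst m al) * (Rabs q * Rabs (beta f))) by ring.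
          apply Rmult_le_compat_l; [apply Rabs_pos |].
          pose proof (pow2_abs f). pose proof (pow2_abs q).
          pose proof (Rabs_pos q). pose proof (Rabs_pos f).
          assert (Rabs q * Rabs (beta f) <= Rabs q * (2 * Rabs f)) by (apply Rmult_le_compat_l; lra).
          pose proof (pow2_ge_0 (Rabs q - Rabs f)). lra. }
        pose proof (Rle_abs (q * (cst m al * beta f))). lra. }
      assert (Hmq : INR m / x * (q * q) <= INR m / de * (f ^ 2 + q ^ 2)).
      { apply Rmult_le_compat; try lra; nra. }
      assert (Hxf : 0 <= x * (f * beta f)) by (apply Rmult_le_pos; nra).
      pose proof (pow2_ge_0 (f + q)). unfold C. lra. }
pose proof (exp_pos (C * de)). pose proof (exp_pos (C * s)).
assert (0 < energy m al sg de).
{ apply Hnear. rewrite Rminus_0_r, Rabs_pos_eq; lra. }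
assert (0 < energy m al sg de * exp (C * de)) by now apply Rmult_lt_0_compat.
apply (Rmult_lt_reg_r (exp (C * s))); [assumption |]. rewrite Rmult_0_l. lra.
Qed.

Lemma turn_rate_continuous m al sg s : sg <> 0 -> 0 <= s -> continuous (turn_rate m al sg) s.
Proof.
intros Hsg Hs. unfold turn_rate.
pose proof (prof_continuous m al sg). pose proof (prof1_continuous m al sg).
pose proof (flux_continuous m al sg). pose proof (flux1_continuous m al sg).
apply continuous_Rdiv.
- pose proof (energy_pos m al sg s Hsg Hs). lra.
- apply continuous_Rminus; apply continuous_Rmult; auto.
- apply energy_continuous.
Qed.

Lemma turn_rate_abs_continuous m al sg s :
  sg <> 0 -> continuous (fun r => turn_rate m al sg (Rabs r)) s.
Proof.
intros Hsg. apply (continuous_fun_comp Rabs (turn_rate m al sg)).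
- apply continuous_Rabs.
- apply turn_rate_continuous; [assumption | apply Rabs_pos].
Qed.

Lemma turn_0 m al sg : turn m al sg 0 = 0.
Proof. unfold turn. now rewrite RInt_point. Qed.

Lemma turn_derive_all m al sg s : sg <> 0 ->
  is_derive (turn m al sg) s (turn_rate m al sg (Rabs s)).
Proof.
intros Hsg. apply (is_derive_RInt_all (fun r => turn_rate m al sg (Rabs r))).
intros y. now apply turn_rate_abs_continuous.
Qed.

Lemma turn_derive m al sg s : sg <> 0 -> 0 <= s ->
  is_derive (turn m al sg) s (turn_rate m al sg s).
Proof.
intros Hsg Hs. rewrite <- (Rabs_pos_eq s Hs) at 2. now apply turn_derive_all.
Qed.

Lemma turn_continuous m al sg s : sg <> 0 -> continuous (turn m al sg) s.
Proof. intros Hsg. eapply continuous_of_derive. now apply turn_derive_all. Qed.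

(* The component of [(f, flux)] orthogonal to the direction of angle [th0 + turn]
   stays zero since its square divided by the energy is constant; hence the
   component along that direction never vanishes. *)
Lemma polar_form m al sg th0 s :
  sg ^ 2 = 1 -> cos th0 = sg -> 0 <= s ->
  exists X, 0 < X /\
    prof m al sg s = X * cos (th0 + turn m al sg s) /\
    flux m al sg s = X * sin (th0 + turn m al sg s).
Proof.
intros Hsg2 Hth Hs.
assert (Hsg : sg <> 0) by (intros ->; simpl in Hsg2; lra).
set (f := prof m al sg). set (q := flux m al sg). set (th := fun s => th0 + turn m al sg s).
set (X := fun s => f s * cos (th s) + q s * sin (th s)).
set (Y := fun s => q s * cos (th s) - f s * sin (th s)).
assert (Hthc : forall x, continuous th x).
{ intros x. apply continuous_Rplus; [apply continuous_const | now apply turn_continuous]. }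
assert (Hcos : forall x, continuous (fun s => cos (th s)) x).
{ intros x. apply (continuous_fun_comp th cos); [apply Hthc | apply continuous_cos]. }
assert (Hsin : forall x, continuous (fun s => sin (th s)) x).
{ intros x. apply (continuous_fun_comp th sin); [apply Hthc | apply continuous_sin]. }
assert (Hf : forall x, continuous f x) by apply prof_continuous.
assert (Hq : forall x, continuous q x) by apply flux_continuous.
assert (HXc : forall x, continuous X x).
{ intros x. unfold X. apply continuous_Rplus; apply continuous_Rmult; auto. }
assert (HYc : forall x, continuous Y x).
{ intros x. unfold Y. apply continuous_Rminus; apply continuous_Rmult; auto. }
assert (HE : forall r, 0 <= r -> 0 < energy m al sg r) by (intros; now apply energy_pos).
assert (HXY : forall r, X r ^ 2 + Y r ^ 2 = energy m al sg r).
{ intros r. unfold X, Y, energy. fold f q.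
  pose proof (sin2_cos2 (th r)) as Hsc. unfold Rsqr in Hsc.
  replace (f r ^ 2 + q r ^ 2) with ((f r ^ 2 + q r ^ 2) * (sin (th r) * sin (th r) + cos (th r) * cos (th r)))
    by (rewrite Hsc; ring). ring. }
assert (Hsin0 : sin th0 = 0).
{ pose proof (sin2_cos2 th0) as Hsc. unfold Rsqr in Hsc. rewrite Hth in Hsc. nra. }
assert (Hth_0 : th 0 = th0) by (unfold th; rewrite turn_0; ring).
assert (HY0 : Y 0 = 0).
{ unfold Y, f, q. rewrite flux_0, Hth_0, Hsin0. ring. }
assert (HX0 : X 0 = 1).
{ unfold X, f, q. rewrite flux_0, prof_0, Hth_0, Hth. lra. }
assert (HYd : forall r, 0 < r -> is_derive (fun s => Y s ^ 2 / energy m al sg s) r 0).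
{ intros r Hr. pose proof (HE r ltac:(lra)) as He.
  assert (HdY : is_derive Y r ((flux1 m al sg r * cos (th r) - prof1 m al sg r * sin (th r))
     - turn_rate m al sg r * X r)).
  { unfold Y, X. pose proof (prof_derive m al sg r Hr) as D1. fold f in D1.
    pose proof (flux_derive m al sg r Hr) as D2. fold q in D2.
    assert (D3 : is_derive th r (turn_rate m al sg r)).
    { unfold th. evar_last.
      - apply is_derive_Rplus; [apply is_derive_Rconst |].
        apply turn_derive; [assumption | lra].
      - eqR. ring. }
    evar_last.
    - apply is_derive_Rminus; apply is_derive_Rmult.
      + exact D2.
      + apply (is_derive_Rcomp th cos); [apply is_derive_cos | exact D3].
      + exact D1.
      + apply (is_derive_Rcomp th sin); [apply is_derive_sin | exact D3].
    - eqR. ring. }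
  evar_last.
  - apply (is_derive_div (fun s => Y s ^ 2) (energy m al sg)).
    + apply (is_derive_pow Y 2). exact HdY.
    + apply energy_derive. exact Hr.
    + lra.
  - assert (Hrot : q r = X r * sin (th r) + Y r * cos (th r) /\
                   f r = X r * cos (th r) - Y r * sin (th r)).
    { pose proof (sin2_cos2 (th r)) as Hsc. unfold Rsqr in Hsc. unfold X, Y. split.
      - transitivity (q r * (sin (th r) * sin (th r) + cos (th r) * cos (th r))); [rewrite Hsc |]; ring.
      - transitivity (f r * (sin (th r) * sin (th r) + cos (th r) * cos (th r))); [rewrite Hsc |]; ring. }
    pose proof (HXY r) as Hen. destruct Hrot as [Eq Ef].
    unfold turn_rate. fold f q. rewrite <- Hen in *. rewrite Eq, Ef.
    revert He. generalize (X r) (Y r). intros x y He.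
    eqR. simpl. field. lra. }
assert (HYz : forall r, 0 <= r -> Y r = 0).
{ intros r Hr.
  assert (E : Y r ^ 2 / energy m al sg r = Y 0 ^ 2 / energy m al sg 0).
  { apply (constant_of_derive (fun s => Y s ^ 2 / energy m al sg s) 0 r Hr).
    - intros x Hx. apply continuous_Rdiv; [| apply (continuous_Rpow Y 2), HYc | apply energy_continuous].
      specialize (HE x (proj1 Hx)). lra.
    - intros x Hx. apply HYd. lra. }
  rewrite HY0 in E. specialize (HE r Hr).
  assert (E2 : Y r ^ 2 = 0).
  { replace (Y r ^ 2) with (Y r ^ 2 / energy m al sg r * energy m al sg r) by (field; lra).
    rewrite E. unfold Rdiv. simpl. ring. }
  simpl in E2. nra. }
exists (X s). split.
- destruct (Rlt_le_dec 0 (X s)) as [|Hneg]; [assumption | exfalso].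
  destruct (intermediate_value X 0 s 0 Hs HXc) as (x & Hx & Ex); [rewrite HX0; lra |].
  specialize (HXY x). rewrite Ex, HYz in HXY by lra. specialize (HE x (proj1 Hx)). simpl in HXY. lra.
- pose proof (sin2_cos2 (th s)) as Hsc. unfold Rsqr in Hsc.
  pose proof (HYz s Hs) as Hz. unfold Y in Hz. unfold X.
  change (th0 + turn m al sg s) with (th s). split.
  + transitivity (f s * (sin (th s) * sin (th s) + cos (th s) * cos (th s)) +
      sin (th s) * (q s * cos (th s) - f s * sin (th s))); [rewrite Hsc, Hz |]; ring.
  + transitivity (q s * (sin (th s) * sin (th s) + cos (th s) * cos (th s)) -
      cos (th s) * (q s * cos (th s) - f s * sin (th s))); [rewrite Hsc, Hz |]; ring.
Qed.

(** * The angle equation and its comparison principle *)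

(** The Pruefer equation: the radius cancels since [beta (X r) = X beta r] for [X >= 0], so the
    angle evolves on its own. *)
Definition angle_rhs (m : nat) (al s th : R) : R :=
  - (INR m / s) * (sin th * cos th) - cst m al * (beta (cos th) * cos th)
  - sin th * sin th - s / 2 * (sin th * beta (cos th)).

Lemma turn_rate_angle m al sg th0 s :
  sg ^ 2 = 1 -> cos th0 = sg -> 0 < s ->
  turn_rate m al sg s = angle_rhs m al s (th0 + turn m al sg s).
Proof.
intros Hsg Hth Hs.
destruct (polar_form m al sg th0 s Hsg Hth ltac:(lra)) as (X & HX & Ef & Eq).
unfold turn_rate, angle_rhs, energy. rewrite prof1_flux, flux1_flux by assumption.
rewrite Ef, Eq. generalize (th0 + turn m al sg s). intros th.
rewrite beta_scale by lra.
pose proof (sin2_cos2 th) as Hsc. unfold Rsqr in Hsc.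
replace ((X * cos th) ^ 2 + (X * sin th) ^ 2) with (X ^ 2)
  by (transitivity (X ^ 2 * (sin th * sin th + cos th * cos th)); [rewrite Hsc |]; ring).
field. lra.
Qed.

Lemma angle_derive m al sg th0 s :
  sg ^ 2 = 1 -> cos th0 = sg -> 0 < s ->
  is_derive (fun s => th0 + turn m al sg s) s (angle_rhs m al s (th0 + turn m al sg s)).
Proof.
intros Hsg Hth Hs.
assert (sg <> 0) by (intros ->; simpl in Hsg; lra).
rewrite <- turn_rate_angle by assumption.
rewrite <- (Rplus_0_l (turn_rate m al sg s)).
apply is_derive_Rplus; [apply is_derive_Rconst | apply turn_derive; [assumption | lra]].
Qed.

Lemma sin_lipschitz a b : Rabs (sin a - sin b) <= Rabs (a - b).
Proof.
destruct (MVT_gen sin b a cos) as (x & _ & E).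
- intros x _. apply is_derive_sin.
- intros x _. apply continuity_sin.
- rewrite E, Rabs_mult. pose proof (COS_bound x). pose proof (Rabs_pos (a - b)).
  assert (Rabs (cos x) <= 1) by (apply Rabs_le; lra). nra.
Qed.

Lemma cos_lipschitz a b : Rabs (cos a - cos b) <= Rabs (a - b).
Proof.
rewrite !cos_sin. eapply Rle_trans; [apply sin_lipschitz |].
right. f_equal. ring.
Qed.

Lemma product_lipschitz a b a' b' A B e1 e2 :
  Rabs a <= A -> Rabs b' <= B -> Rabs (a - a') <= e1 -> Rabs (b - b') <= e2 ->
  Rabs (a * b - a' * b') <= A * e2 + B * e1.
Proof.
intros Ha Hb H1 H2.
replace (a * b - a' * b') with (a * (b - b') + b' * (a - a')) by ring.
eapply Rle_trans; [apply Rabs_triang |]. rewrite !Rabs_mult.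
apply Rplus_le_compat; apply Rmult_le_compat; try assumption; apply Rabs_pos.
Qed.

Lemma angle_rhs_lipschitz m al d M :
  0 < d -> exists L, 0 <= L /\ forall s x y, d <= s <= M ->
  Rabs (angle_rhs m al s x - angle_rhs m al s y) <= L * Rabs (x - y).
Proof.
intros Hd. pose proof (INR_pos m). pose proof (Rabs_pos (cst m al)).
assert (0 <= INR m / d) by (apply Rmult_le_pos; [assumption | left; now apply Rinv_0_lt_compat]).
exists (INR m / d * 2 + Rabs (cst m al) * 4 + 2 + Rabs M * 2). split.
{ pose proof (Rabs_pos M). lra. }
intros s x y Hs.
assert (Hsx : Rabs (sin x) <= 1) by (pose proof (SIN_bound x); apply Rabs_le; lra).
assert (Hsy : Rabs (sin y) <= 1) by (pose proof (SIN_bound y); apply Rabs_le; lra).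
assert (Hcx : Rabs (cos x) <= 1) by (pose proof (COS_bound x); apply Rabs_le; lra).
assert (Hcy : Rabs (cos y) <= 1) by (pose proof (COS_bound y); apply Rabs_le; lra).
assert (Hbx : Rabs (beta (cos x)) <= 2) by (pose proof (beta_bound (cos x)); lra).
assert (Hby : Rabs (beta (cos y)) <= 2) by (pose proof (beta_bound (cos y)); lra).
pose proof (sin_lipschitz x y) as Ls. pose proof (cos_lipschitz x y) as Lc.
assert (Lb : Rabs (beta (cos x) - beta (cos y)) <= 2 * Rabs (x - y)).
{ pose proof (beta_lipschitz (cos x) (cos y)). lra. }
pose proof (product_lipschitz _ _ _ _ 1 1 _ _ Hsx Hcy Ls Lc) as P1.
pose proof (product_lipschitz _ _ _ _ 2 1 _ _ Hbx Hcy Lb Lc) as P2.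
pose proof (product_lipschitz _ _ _ _ 1 1 _ _ Hsx Hsy Ls Ls) as P3.
pose proof (product_lipschitz _ _ _ _ 1 2 _ _ Hsx Hby Ls Lb) as P4.
set (e := Rabs (x - y)) in *. assert (He : 0 <= e) by apply Rabs_pos.
unfold angle_rhs.
replace (- (INR m / s) * (sin x * cos x) - cst m al * (beta (cos x) * cos x) - sin x * sin x -
 s / 2 * (sin x * beta (cos x)) -
 (- (INR m / s) * (sin y * cos y) - cst m al * (beta (cos y) * cos y) - sin y * sin y -
  s / 2 * (sin y * beta (cos y)))) with
 (- (INR m / s) * (sin x * cos x - sin y * cos y) +
  (- cst m al * (beta (cos x) * cos x - beta (cos y) * cos y) +
  (- (sin x * sin x - sin y * sin y) +
  (- (s / 2) * (sin x * beta (cos x) - sin y * beta (cos y)))))) by ring.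
assert (Hm : Rabs (INR m / s) <= INR m / d).
{ rewrite Rabs_pos_eq.
  - apply Rmult_le_compat_l; [assumption |]. apply Rinv_le_contravar; lra.
  - apply Rmult_le_pos; [assumption | left; apply Rinv_0_lt_compat; lra]. }
assert (HM : Rabs (s / 2) <= Rabs M / 2).
{ rewrite Rabs_pos_eq by lra. pose proof (Rle_abs M). lra. }
eapply Rle_trans; [apply Rabs_triang |].
replace ((INR m / d * 2 + Rabs (cst m al) * 4 + 2 + Rabs M * 2) * e) with
  (INR m / d * (1 * e + 1 * e) + (Rabs (cst m al) * (2 * e + 1 * (2 * e)) +
    ((1 * e + 1 * e) + Rabs M / 2 * (1 * (2 * e) + 2 * e))))
  by (generalize (INR m / d); intros; field).
apply Rplus_le_compat.
{ rewrite Rabs_mult, Rabs_Ropp. apply Rmult_le_compat; try assumption; apply Rabs_pos. }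
eapply Rle_trans; [apply Rabs_triang |]. apply Rplus_le_compat.
{ rewrite Rabs_mult, Rabs_Ropp. apply Rmult_le_compat; try assumption; try apply Rabs_pos. lra. }
eapply Rle_trans; [apply Rabs_triang |]. apply Rplus_le_compat.
{ now rewrite Rabs_Ropp. }
rewrite Rabs_mult, Rabs_Ropp. apply Rmult_le_compat; try assumption; apply Rabs_pos.
Qed.

(** Sub- and supersolutions of a Lipschitz equation stay strictly ordered: while the order lasts,
    [(th2 - th1) exp (L s)] is nondecreasing. The constant [L] depends on the end point [t], which
    continuous induction allows. *)
Lemma angle_comparison_from m al (th1 th2 d1 d2 : R -> R) a :
  0 < a ->
  (forall s, a <= s -> is_derive th1 s (d1 s) /\ d1 s <= angle_rhs m al s (th1 s)) ->
  (forall s, a <= s -> is_derive th2 s (d2 s) /\ angle_rhs m al s (th2 s) <= d2 s) ->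
  th1 a < th2 a -> forall s, a <= s -> th1 s < th2 s.
Proof.
intros Ha H1 H2 H s Hs.
apply Rminus_gt_0_lt.
assert (Hc : forall t, a <= t -> continuous (fun t => th2 t - th1 t) t).
{ intros t Ht. eapply continuous_of_derive. apply is_derive_Rminus; [apply H2 | apply H1]; assumption. }
apply (positive_persists (fun t => th2 t - th1 t) a Hc); [lra | | assumption].
intros t Ht Hpos.
destruct (angle_rhs_lipschitz m al a t Ha) as (L & HL & HLip).
assert (Hm : (th2 a - th1 a) * exp (L * a) <= (th2 t - th1 t) * exp (L * t)).
{ apply (nondecreasing_of_derive (fun s => (th2 s - th1 s) * exp (L * s))
   (fun s => (d2 s - d1 s) * exp (L * s) + (th2 s - th1 s) * (L * exp (L * s)))); [lra | |].
  - intros x Hx. apply continuous_Rmult; [apply Hc; lra |].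
    eapply continuous_of_derive. auto_derive; [trivial | reflexivity].
  - intros x Hx. split.
    + apply (is_derive_Rmult (fun s => th2 s - th1 s) (fun s => exp (L * s))).
      * apply is_derive_Rminus; [apply H2 | apply H1]; lra.
      * auto_derive; [trivial |]. eqR. ring.
    + replace ((d2 x - d1 x) * exp (L * x) + (th2 x - th1 x) * (L * exp (L * x))) with
        ((d2 x - d1 x + L * (th2 x - th1 x)) * exp (L * x)) by ring.
      apply Rmult_le_pos; [| left; apply exp_pos].
      specialize (Hpos x ltac:(lra)).
      destruct (H1 x ltac:(lra)) as [_ I1]. destruct (H2 x ltac:(lra)) as [_ I2].
      pose proof (HLip x (th1 x) (th2 x) ltac:(lra)) as I3.
      rewrite (Rabs_minus_sym (th1 x)), (Rabs_pos_eq (th2 x - th1 x)) in I3 by lra.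
      apply Rabs_le_between in I3. lra. }
pose proof (exp_pos (L * a)). pose proof (exp_pos (L * t)).
assert (0 < (th2 a - th1 a) * exp (L * a)) by (apply Rmult_lt_0_compat; lra).
apply (Rmult_lt_reg_r (exp (L * t))); [assumption |]. rewrite Rmult_0_l. lra.
Qed.

(** The equation is singular at the origin, so an order given at [a = 0] is first carried by
    continuity to a positive point, from which the differential comparison starts. *)
Lemma angle_comparison m al (th1 th2 d1 d2 : R -> R) a :
  0 <= a ->
  (forall s, 0 <= s -> continuous th1 s) -> (forall s, 0 <= s -> continuous th2 s) ->
  (forall s, 0 < s -> is_derive th1 s (d1 s) /\ d1 s <= angle_rhs m al s (th1 s)) ->
  (forall s, 0 < s -> is_derive th2 s (d2 s) /\ angle_rhs m al s (th2 s) <= d2 s) ->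
  th1 a < th2 a -> forall s, a <= s -> th1 s < th2 s.
Proof.
intros Ha C1 C2 H1 H2 H s Hs.
destruct (continuous_pos_near (fun t => th2 t - th1 t) a) as (d & Hd & Hnear).
{ apply continuous_Rminus; auto. }
{ lra. }
destruct (Rlt_le_dec s (a + d)) as [Hsd | Hsd].
{ apply Rminus_gt_0_lt. apply (Hnear s). apply Rabs_def1; lra. }
apply (angle_comparison_from m al th1 th2 d1 d2 (a + d / 2)); try lra.
- intros; apply H1; lra.
- intros; apply H2; lra.
- apply Rminus_gt_0_lt. apply (Hnear (a + d / 2)). apply Rabs_def1; lra.
Qed.

(** * Levels of the angle and sign changes *)

Lemma unit_sign sg : sg ^ 2 = 1 -> sg = 1 \/ sg = -1.
Proof.
intros H. assert (E : (sg - 1) * (sg + 1) = 0) by (simpl in H; lra).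
apply Rmult_integral in E. lra.
Qed.

Lemma unit_sign_neq0 sg : sg ^ 2 = 1 -> sg <> 0.
Proof. intros H ->. simpl in H. lra. Qed.

Lemma unit_sign_opp sg : sg ^ 2 = 1 -> (- sg) ^ 2 = 1.
Proof. intros H. rewrite <- H. ring. Qed.

Lemma unit_sign_pow sg j : sg ^ 2 = 1 -> ((-1) ^ j * sg) ^ 2 = 1.
Proof.
intros H. rewrite Rpow_mult_distr, H, <- pow_mult, Nat.mul_comm, pow_1_even. ring.
Qed.

Lemma initial_angle sg : sg ^ 2 = 1 -> exists th0, cos th0 = sg.
Proof.
intros H. destruct (unit_sign sg H) as [-> | ->].
- exists 0. apply cos_0.
- exists PI. apply cos_PI.
Qed.

Lemma sin_initial_angle sg th0 : sg ^ 2 = 1 -> cos th0 = sg -> sin th0 = 0.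
Proof.
intros Hsg Hth. pose proof (sin2_cos2 th0) as Hsc. unfold Rsqr in Hsc.
rewrite Hth in Hsc. nra.
Qed.

Lemma shifted_angle sg th0 j x :
  sg ^ 2 = 1 -> cos th0 = sg ->
  cos (th0 + (x - INR j * PI)) = (-1) ^ j * sg * cos x /\
  sin (th0 + (x - INR j * PI)) = (-1) ^ j * sg * sin x.
Proof.
intros Hsg Hth. pose proof (sin_initial_angle sg th0 Hsg Hth) as Hs.
induction j as [|j [IHc IHs]].
- simpl INR. replace (th0 + (x - 0 * PI)) with (th0 + x) by ring.
  rewrite cos_plus, sin_plus, Hs, Hth. simpl. split; ring.
- rewrite S_INR.
  replace (th0 + (x - (INR j + 1) * PI)) with (th0 + (x - INR j * PI) - PI) by ring.
  rewrite cos_minus, sin_minus, IHc, IHs, cos_PI, sin_PI. simpl. split; ring.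
Qed.

(* For [j >= 1] this is the angle at the [j]-th zero; [level 0 > 0] is never reached. *)
Definition level (j : nat) : R := PI / 2 - INR j * PI.

Lemma level_S j : level (S j) = level j - PI.
Proof. unfold level. rewrite S_INR. ring. Qed.

Lemma level_decreasing i j : (i <= j)%nat -> level j <= level i.
Proof.
intros H. unfold level. apply le_INR in H. pose proof PI_RGT_0. nra.
Qed.

Lemma strip_sign m al sg j s :
  sg ^ 2 = 1 -> 0 <= s -> level (S j) < turn m al sg s < level j ->
  0 < (-1) ^ j * sg * prof m al sg s.
Proof.
intros Hsg Hs Ht. destruct (initial_angle sg Hsg) as [th0 Hth].
destruct (polar_form m al sg th0 s Hsg Hth Hs) as (X & HX & Ef & _).
(* [x] is the angle brought back to [(- PI/2, PI/2)], where the cosine is positive; the shift by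
   [j PI] accounts for the sign [(-1)^j]. *)
set (x := turn m al sg s + INR j * PI).
replace (turn m al sg s) with (x - INR j * PI) in Ef by (unfold x; ring).
rewrite (proj1 (shifted_angle sg th0 j x Hsg Hth)) in Ef. rewrite Ef.
replace ((-1) ^ j * sg * (X * ((-1) ^ j * sg * cos x)))
  with (((-1) ^ j * sg) ^ 2 * (X * cos x)) by ring.
rewrite unit_sign_pow, Rmult_1_l by assumption.
apply Rmult_lt_0_compat; [assumption |]. rewrite level_S in Ht. unfold level in Ht.
apply cos_gt_0; unfold x; lra.
Qed.

Lemma strip_sign_weak m al sg j s :
  sg ^ 2 = 1 -> 0 <= s -> level (S j) <= turn m al sg s <= level j ->
  0 <= (-1) ^ j * sg * prof m al sg s.
Proof.
intros Hsg Hs Ht. destruct (initial_angle sg Hsg) as [th0 Hth].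
destruct (polar_form m al sg th0 s Hsg Hth Hs) as (X & HX & Ef & _).
set (x := turn m al sg s + INR j * PI).
replace (turn m al sg s) with (x - INR j * PI) in Ef by (unfold x; ring).
rewrite (proj1 (shifted_angle sg th0 j x Hsg Hth)) in Ef. rewrite Ef.
replace ((-1) ^ j * sg * (X * ((-1) ^ j * sg * cos x)))
  with (((-1) ^ j * sg) ^ 2 * (X * cos x)) by ring.
rewrite unit_sign_pow, Rmult_1_l by assumption.
apply Rmult_le_pos; [lra |]. rewrite level_S in Ht. unfold level in Ht.
apply cos_ge_0; unfold x; lra.
Qed.

(** Where the cosine vanishes only [- sin^2] survives, so the slope is the same for all [s] and all
    exponents. *)
Lemma angle_rhs_level m al sg th0 j s :
  sg ^ 2 = 1 -> cos th0 = sg -> angle_rhs m al s (th0 + level j) = -1.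
Proof.
intros Hsg Hth. unfold angle_rhs, level.
destruct (shifted_angle sg th0 j (PI / 2) Hsg Hth) as [-> ->].
rewrite cos_PI2, sin_PI2, Rmult_0_r, beta_nonneg by lra.
pose proof (unit_sign_pow sg j Hsg) as H. simpl in H. lra.
Qed.

Lemma angle_continuous m al sg th0 s :
  sg ^ 2 = 1 -> continuous (fun s => th0 + turn m al sg s) s.
Proof.
intros Hsg. apply continuous_Rplus; [apply continuous_const |].
apply turn_continuous. now apply unit_sign_neq0.
Qed.

(** The constant [th0 + level j] is a supersolution, its derivative 0 exceeding the slope -1
    prescribed there. *)
Lemma level_barrier m al sg j a s :
  sg ^ 2 = 1 -> 0 <= a <= s -> turn m al sg a < level j -> turn m al sg s < level j.
Proof.
intros Hsg Has Ha. destruct (initial_angle sg Hsg) as [th0 Hth].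
apply (Rplus_lt_reg_l th0).
apply (angle_comparison m al (fun s => th0 + turn m al sg s) (fun _ => th0 + level j)
  (fun s => angle_rhs m al s (th0 + turn m al sg s)) (fun _ => 0) a); try lra.
- intros x _. now apply angle_continuous.
- intros x _. apply continuous_const.
- intros x Hx. split; [exact (angle_derive m al sg th0 x Hsg Hth Hx) | lra].
- intros x Hx. split; [apply is_derive_Rconst |]. rewrite (angle_rhs_level m al sg th0 j x Hsg Hth). lra.
Qed.

Lemma turn_rate_level m al sg j s :
  sg ^ 2 = 1 -> 0 < s -> turn m al sg s = level j -> turn_rate m al sg s = -1.
Proof.
intros Hsg Hs E. destruct (initial_angle sg Hsg) as [th0 Hth].
rewrite (turn_rate_angle m al sg th0) by assumption. rewrite E.
exact (angle_rhs_level m al sg th0 j s Hsg Hth).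
Qed.

(* The angle crosses a level with slope [-1], hence passes below it. *)
Lemma below_level_after m al sg j s :
  sg ^ 2 = 1 -> 0 < s -> turn m al sg s <= level j ->
  forall d, 0 < d -> turn m al sg (s + d) < level j.
Proof.
intros Hsg Hs H d Hd. pose proof (unit_sign_neq0 sg Hsg) as Hn0.
destruct (Rle_lt_or_eq_dec _ _ H) as [Hlt | E].
{ apply (level_barrier m al sg j s); try assumption; lra. }
assert (Hneg : 0 < - turn_rate m al sg s) by (rewrite (turn_rate_level m al sg j); try assumption; lra).
destruct (continuous_pos_near (fun s => - turn_rate m al sg s) s) as (r & Hr & Hnear); [| assumption |].
{ apply continuous_Ropp. apply turn_rate_continuous; [assumption | lra]. }
set (t := Rmin d (r / 2)).
assert (Ht : 0 < t <= d /\ t < r).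
{ unfold t. pose proof (Rmin_l d (r / 2)). pose proof (Rmin_r d (r / 2)).
  repeat split; try lra. apply Rmin_glb_lt; lra. }
apply (level_barrier m al sg j (s + t)); try assumption; [lra |].
rewrite <- E. apply Ropp_lt_cancel.
apply (increasing_of_derive (fun s => - turn m al sg s) (fun s => - turn_rate m al sg s)); [lra | |].
- intros x _. apply continuous_Ropp. now apply turn_continuous.
- intros x Hx. split.
  + apply (is_derive_opp (turn m al sg)). apply turn_derive; [assumption | lra].
  + apply Hnear. apply Rabs_def1; lra.
Qed.

(** Encodes having at least [j] zeros. The strict inequality makes it an open condition in [al], and
    nothing is lost by it, since a level that is touched is passed at once. *)
Definition crosses (m : nat) (al sg : R) (j : nat) : Prop :=
  exists s, 0 <= s /\ turn m al sg s < level j.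

Lemma crosses_0 m al sg : crosses m al sg 0.
Proof.
exists 0. split; [lra |]. rewrite turn_0. unfold level. simpl. pose proof PI_RGT_0. lra.
Qed.

Lemma crosses_le m al sg i j : (i <= j)%nat -> crosses m al sg j -> crosses m al sg i.
Proof.
intros Hij (s & Hs & H). exists s. split; [assumption |].
pose proof (level_decreasing i j Hij). lra.
Qed.

Lemma not_crosses_above m al sg j s :
  sg ^ 2 = 1 -> ~ crosses m al sg j -> 0 < s -> level j < turn m al sg s.
Proof.
intros Hsg Hn Hs. destruct (Rlt_le_dec (level j) (turn m al sg s)) as [|Hle]; [assumption |].
exfalso. apply Hn. exists (s + 1). split; [lra |].
apply below_level_after; try assumption. lra.
Qed.

(** Each sign change costs a level: two consecutive samples with angles in the same closed strip
    would have values of weakly equal sign. *)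
Lemma changes_sign_crosses m al sg j :
  sg ^ 2 = 1 -> changes_sign_at_least (prof m al sg) j -> crosses m al sg j.
Proof.
intros Hsg (s & Hs0 & Hs).
assert (Hnonneg : forall i, (i <= j)%nat -> 0 <= s i).
{ induction i as [|i IH]; intros Hi; [assumption |].
  specialize (IH ltac:(lia)). destruct (Hs i ltac:(lia)). lra. }
assert (H : forall i, (i <= j)%nat -> turn m al sg (s i) < level i).
{ induction i as [|i IH]; intros Hi.
  - apply (level_barrier m al sg 0 0); [assumption | lra |].
    rewrite turn_0. unfold level. simpl. pose proof PI_RGT_0. lra.
  - specialize (IH ltac:(lia)). destruct (Hs i ltac:(lia)) as [Hlt Hneg].
    pose proof (Hnonneg i ltac:(lia)) as Hi0.
    destruct (Rlt_le_dec (turn m al sg (s (S i))) (level (S i))) as [|Hge]; [assumption | exfalso].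
    assert (Hge' : level (S i) <= turn m al sg (s i)).
    { destruct (Rle_lt_dec (level (S i)) (turn m al sg (s i))) as [|Hlt']; [assumption |].
      apply (level_barrier m al sg (S i) (s i) (s (S i))) in Hlt'; try assumption; lra. }
    assert (Hlt2 : turn m al sg (s (S i)) < level i).
    { apply (level_barrier m al sg i (s i)); try assumption; lra. }
    pose proof (strip_sign_weak m al sg i (s i) Hsg Hi0 ltac:(lra)) as P1.
    pose proof (strip_sign_weak m al sg i (s (S i)) Hsg ltac:(lra) ltac:(lra)) as P2.
    pose proof (Rmult_le_pos _ _ P1 P2) as P.
    replace ((-1) ^ i * sg * prof m al sg (s i) * ((-1) ^ i * sg * prof m al sg (s (S i))))
      with (((-1) ^ i * sg) ^ 2 * (prof m al sg (s i) * prof m al sg (s (S i)))) in P by ring.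
    rewrite unit_sign_pow in P by assumption. lra. }
exists (s j). split; [apply Hnonneg | apply H]; lia.
Qed.

Lemma crosses_changes_sign m al sg j :
  sg ^ 2 = 1 -> crosses m al sg j -> changes_sign_at_least (prof m al sg) j.
Proof.
intros Hsg (t & Ht & Hlt). pose proof PI_RGT_0 as HPI.
assert (Hex : forall i, exists s, (i <= j)%nat ->
   0 <= s /\ level (S i) < turn m al sg s < level i).
{ intros i. destruct (Compare_dec.le_lt_dec i j) as [Hi | Hi]; [| exists 0; lia].
  pose proof (level_decreasing i j Hi) as Hl. rewrite level_S.
  (* The sample for strip [i] is taken where the angle is at the middle of the strip, if that is
     reached by [t]; otherwise [t] itself lies in the upper half of the strip. *)
  destruct (Rle_lt_dec (turn m al sg t) (level i - PI / 2)) as [Hle | Hgt].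
  - destruct (intermediate_value (turn m al sg) 0 t (level i - PI / 2)) as (s & Hs & E).
    + assumption.
    + intros x. apply turn_continuous. now apply unit_sign_neq0.
    + right. split; [assumption |]. rewrite turn_0. unfold level.
      pose proof (pos_INR i). nra.
    + exists s. intros _. lra.
  - exists t. intros _. lra. }
set (s := fun i => proj1_sig (constructive_indefinite_description _ (Hex i))).
assert (Hs : forall i, (i <= j)%nat -> 0 <= s i /\ level (S i) < turn m al sg (s i) < level i).
{ intros i. unfold s. apply (proj2_sig (constructive_indefinite_description _ (Hex i))). }
exists s. split; [apply Hs; lia |]. intros i Hi.
destruct (Hs i ltac:(lia)) as [H0 H1]. destruct (Hs (S i) ltac:(lia)) as [H2 H3]. split.
- destruct (Rlt_le_dec (s i) (s (S i))) as [|Hle]; [assumption | exfalso].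
  pose proof (level_barrier m al sg (S i) (s (S i)) (s i) Hsg ltac:(lra) (proj2 H3)). lra.
- pose proof (strip_sign m al sg i (s i) Hsg H0 H1) as P1.
  pose proof (strip_sign m al sg (S i) (s (S i)) Hsg H2 H3) as P2.
  pose proof (Rmult_lt_0_compat _ _ P1 P2) as P.
  replace ((-1) ^ i * sg * prof m al sg (s i) * ((-1) ^ S i * sg * prof m al sg (s (S i))))
    with (- (((-1) ^ i * sg) ^ 2 * (prof m al sg (s i) * prof m al sg (s (S i))))) in P by (simpl; ring).
  rewrite unit_sign_pow in P by assumption. lra.
Qed.

Lemma changes_sign_exactly_crosses m al sg j :
  sg ^ 2 = 1 -> crosses m al sg j -> ~ crosses m al sg (S j) ->
  changes_sign_exactly (prof m al sg) j.
Proof.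
intros Hsg H1 H2. split.
- now apply crosses_changes_sign.
- intros H. apply H2. now apply changes_sign_crosses.
Qed.

(** * Monotonicity in the exponent and comparison of the two signs *)

(** The exponent enters only through [- cst m al] times [beta (cos th) cos th], and [beta r] always
    has the sign of [r]. *)
Lemma angle_rhs_antitone m al al' s th :
  al <= al' -> angle_rhs m al' s th <= angle_rhs m al s th.
Proof.
intros H. unfold angle_rhs, cst.
assert (0 <= beta (cos th) * cos th) by (pose proof (beta_mult_ge (cos th)); nra). nra.
Qed.

Lemma average_0 m g : average m g 0 = g 0 / INR (S m).
Proof.
unfold average.
assert (Hm : INR (S m) <> 0) by (apply not_0_INR; lia).
rewrite (is_RInt_unique _ 0 1 (1 ^ S m * (g 0 / INR (S m)) - 0 ^ S m * (g 0 / INR (S m)))).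
- rewrite pow1, pow_i by lia. ring.
- apply (is_RInt_derive (fun t => t ^ S m * (g 0 / INR (S m))) (fun t => t ^ m * g (0 * t))).
  + intros x _. evar_last.
    * apply is_derive_Rmult; [apply (is_derive_pow (fun t => t) (S m)), is_derive_Rid | apply is_derive_Rconst].
    * eqR. rewrite Rmult_0_l. change (Nat.pred (S m)) with m. field. exact Hm.
  + intros x _. apply continuous_Rmult; [solve_continuous |].
    apply (continuous_ext (fun _ => g 0)); [intros t; now rewrite Rmult_0_l | apply continuous_const].
Qed.

Lemma turn_rate_0 m al sg :
  sg <> 0 -> turn_rate m al sg 0 = - cst m al * (beta sg / sg) / INR (S m).
Proof.
intros Hsg. unfold turn_rate, energy, flux1, prof_avg.
rewrite flux_0, average_0, prof_0, S_INR. pose proof (INR_pos m). field.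
split; [assumption | lra].
Qed.

(** Comparison alone cannot start, since both angles begin at 0 and the right-hand sides are only
    weakly ordered. Strictness is generated at the origin, where the two derivatives
    [- cst (beta sg / sg) / (m + 1)] differ, and is then preserved. *)
Lemma turn_antitone m al al' sg s :
  sg ^ 2 = 1 -> al < al' -> 0 < s -> turn m al' sg s < turn m al sg s.
Proof.
intros Hsg Hal Hs. pose proof (unit_sign_neq0 sg Hsg) as Hn0.
set (g := fun s => turn_rate m al sg (Rabs s) - turn_rate m al' sg (Rabs s)).
assert (Hg : forall x, continuous g x).
{ intros x. apply continuous_Rminus; now apply turn_rate_abs_continuous. }
assert (Hg0 : 0 < g 0).
{ unfold g. rewrite Rabs_R0, !turn_rate_0 by assumption.
  assert (Hb : 1 <= beta sg / sg).
  { destruct (unit_sign sg Hsg) as [-> | ->]; [rewrite beta_nonneg | rewrite beta_nonpos]; lra. }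
  assert (Hm : 0 < / INR (S m)) by (apply Rinv_0_lt_compat, lt_0_INR; lia).
  replace (- cst m al * (beta sg / sg) / INR (S m) - - cst m al' * (beta sg / sg) / INR (S m))
    with ((cst m al' - cst m al) * ((beta sg / sg) * / INR (S m))) by (unfold Rdiv; ring).
  apply Rmult_lt_0_compat; [unfold cst; lra |]. apply Rmult_lt_0_compat; lra. }
destruct (continuous_pos_near g 0 (Hg 0) Hg0) as (d & Hd & Hnear).
assert (Hsmall : forall t, 0 < t < d -> turn m al' sg t < turn m al sg t).
{ intros t Ht. apply Rminus_gt_0_lt.
  replace 0 with (turn m al sg 0 - turn m al' sg 0) by (rewrite !turn_0; ring).
  apply (increasing_of_derive (fun s => turn m al sg s - turn m al' sg s) g); [lra | |].
  - intros x _. apply continuous_Rminus; now apply turn_continuous.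
  - intros x Hx. split.
    + apply is_derive_Rminus; now apply turn_derive_all.
    + apply Hnear. apply Rabs_def1; lra. }
destruct (Rlt_le_dec s d) as [Hsd | Hsd]; [apply Hsmall; lra |].
destruct (initial_angle sg Hsg) as [th0 Hth].
apply (Rplus_lt_reg_l th0).
apply (angle_comparison m al (fun s => th0 + turn m al' sg s) (fun s => th0 + turn m al sg s)
  (fun s => angle_rhs m al' s (th0 + turn m al' sg s))
  (fun s => angle_rhs m al s (th0 + turn m al sg s)) (d / 2)); try lra.
- intros x _. now apply angle_continuous.
- intros x _. now apply angle_continuous.
- intros x Hx. split; [exact (angle_derive m al' sg th0 x Hsg Hth Hx) | apply angle_rhs_antitone; lra].
- intros x Hx. split; [exact (angle_derive m al sg th0 x Hsg Hth Hx) | lra].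
- pose proof (Hsmall (d / 2) ltac:(lra)). lra.
Qed.

Lemma crosses_monotone m al al' sg j :
  sg ^ 2 = 1 -> al <= al' -> crosses m al sg j -> crosses m al' sg j.
Proof.
intros Hsg Hal (s & Hs & H).
destruct (Rle_lt_or_eq_dec al al' Hal) as [Hlt | <-]; [| now exists s].
destruct (Rle_lt_or_eq_dec 0 s Hs) as [Hs0 | <-].
- exists s. split; [assumption |]. pose proof (turn_antitone m al al' sg s Hsg Hlt Hs0). lra.
- exists 0. split; [lra |]. rewrite turn_0 in *. assumption.
Qed.

(* [th0 + turn sg] and [th0 - PI + turn (- sg)] solve the same angle equation. *)
Lemma turn_opposite m al sg s :
  sg ^ 2 = 1 -> 0 <= s -> turn m al (- sg) s - PI < turn m al sg s.
Proof.
intros Hsg Hs. pose proof (unit_sign_opp sg Hsg) as Hsg'.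
destruct (initial_angle sg Hsg) as [th0 Hth].
assert (Hth' : cos (th0 - PI) = - sg).
{ rewrite cos_minus, cos_PI, sin_PI, Hth. ring. }
apply (Rplus_lt_reg_l th0).
replace (th0 + (turn m al (- sg) s - PI)) with (th0 - PI + turn m al (- sg) s) by ring.
apply (angle_comparison m al (fun s => th0 - PI + turn m al (- sg) s) (fun s => th0 + turn m al sg s)
  (fun s => angle_rhs m al s (th0 - PI + turn m al (- sg) s))
  (fun s => angle_rhs m al s (th0 + turn m al sg s)) 0); try lra.
- intros x _. now apply angle_continuous.
- intros x _. now apply angle_continuous.
- intros x Hx. split; [exact (angle_derive m al (- sg) (th0 - PI) x Hsg' Hth' Hx) | lra].
- intros x Hx. split; [exact (angle_derive m al sg th0 x Hsg Hth Hx) | lra].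
- rewrite !turn_0. pose proof PI_RGT_0. lra.
Qed.

(** * Continuous dependence on the exponent *)

(** Continuity in [s] at one exponent plus a Lipschitz bound in the exponent, uniform on bounded
    sets of [s]. Joint continuity is what makes the integrand of [turn] vary uniformly on [[0, s]]
    when the exponent moves. *)
Lemma joint_continuity (G : R -> R -> R) s0 al0 :
  (forall x, continuous (G al0) x) ->
  (forall M, 0 <= M -> exists C, 0 <= C /\ forall al, Rabs (al - al0) <= 1 ->
     forall s, 0 <= s <= M -> Rabs (G al s - G al0 s) <= C * Rabs (al - al0)) ->
  continuity_2d_pt (fun s al => G al (Rabs s)) s0 al0.
Proof.
intros Hc Hlip [e He].
pose proof (Rabs_pos s0) as Hs0.
destruct (Hlip (Rabs s0 + 1) ltac:(lra)) as (C & HC & HG).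
assert (Hcc : continuous (fun s => G al0 (Rabs s)) s0).
{ apply (continuous_fun_comp Rabs (G al0)); [apply continuous_Rabs | apply Hc]. }
destruct (proj1 (continuous_eps _ _) Hcc (e / 2) ltac:(lra)) as (d & Hd & Hnear).
set (r := Rmin (Rmin d 1) (e / (2 * (C + 1)))).
assert (Hr : 0 < r).
{ unfold r. apply Rmin_glb_lt; [apply Rmin_glb_lt; lra |]. apply Rdiv_lt_0_compat; lra. }
assert (Hr1 : r <= d /\ r <= 1 /\ C * r <= e / 2).
{ pose proof (Rmin_l (Rmin d 1) (e / (2 * (C + 1)))) as H1.
  pose proof (Rmin_r (Rmin d 1) (e / (2 * (C + 1)))) as H2. fold r in H1, H2.
  pose proof (Rmin_l d 1). pose proof (Rmin_r d 1).
  repeat split; try lra.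
  apply Rle_trans with ((C + 1) * r); [lra |].
  apply Rle_trans with ((C + 1) * (e / (2 * (C + 1)))); [apply Rmult_le_compat_l; lra |].
  right. field. lra. }
exists (mkposreal r Hr). simpl. intros u v Hu Hv.
assert (Hu1 : Rabs u <= Rabs s0 + 1).
{ replace u with (s0 + (u - s0)) by ring. eapply Rle_trans; [apply Rabs_triang |]. lra. }
pose proof (HG v ltac:(lra) (Rabs u) (conj (Rabs_pos u) Hu1)) as H1.
pose proof (Hnear u ltac:(lra)) as H2.
assert (H3 : C * Rabs (v - al0) <= C * r) by (apply Rmult_le_compat_l; lra).
replace (G v (Rabs u) - G al0 (Rabs s0)) with
  ((G v (Rabs u) - G al0 (Rabs u)) + (G al0 (Rabs u) - G al0 (Rabs s0))) by ring.
eapply Rle_lt_trans; [apply Rabs_triang |]. lra.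
Qed.

Lemma prof_lipschitz_al m sg al0 M :
  0 <= M -> exists C, 0 <= C /\ forall al, Rabs (al - al0) <= 1 ->
  forall s, 0 <= s <= M -> Rabs (prof m al sg s - prof m al0 sg s) <= C * Rabs (al - al0).
Proof.
intros HM.
destruct (profile_sol_lipschitz_c m sg (Rabs (cst m al0) + 1) M HM) as (C & HC & H).
exists C. split; [assumption |]. intros al Hal s Hs.
assert (E : cst m al - cst m al0 = (al - al0) / 2) by (unfold cst; field).
assert (E2 : Rabs (cst m al - cst m al0) = Rabs (al - al0) / 2).
{ rewrite E. unfold Rdiv. rewrite Rabs_mult, (Rabs_pos_eq (/ 2)); lra. }
pose proof (Rabs_pos (al - al0)).
eapply Rle_trans; [apply H; [| | assumption] |].
- replace (cst m al) with (cst m al0 + (cst m al - cst m al0)) by ring.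
  eapply Rle_trans; [apply Rabs_triang |]. lra.
- lra.
- rewrite E2. nra.
Qed.

Lemma prof_avg_lipschitz_al m sg al0 M :
  0 <= M -> exists C, 0 <= C /\ forall al, Rabs (al - al0) <= 1 ->
  forall s, 0 <= s <= M -> Rabs (prof_avg m al sg s - prof_avg m al0 sg s) <= C * Rabs (al - al0).
Proof.
intros HM. destruct (prof_lipschitz_al m sg al0 M HM) as (C & HC & H).
exists (2 * C). split; [lra |]. intros al Hal s Hs. unfold prof_avg.
rewrite average_minus by apply prof_beta_continuous.
apply average_bound; [| lra |].
- intros x. apply continuous_Rminus; apply prof_beta_continuous.
- intros t Ht. eapply Rle_trans; [apply beta_lipschitz |].
  specialize (H al Hal t ltac:(lra)). lra.
Qed.

Lemma prof_joint m sg s al : continuity_2d_pt (fun s al => prof m al sg (Rabs s)) s al.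
Proof.
apply (joint_continuity (fun al => prof m al sg)); [apply prof_continuous |].
apply prof_lipschitz_al.
Qed.

Lemma prof_avg_joint m sg s al : continuity_2d_pt (fun s al => prof_avg m al sg (Rabs s)) s al.
Proof.
apply (joint_continuity (fun al => prof_avg m al sg)); [apply prof_avg_continuous |].
apply prof_avg_lipschitz_al.
Qed.

Lemma beta_joint (G : R -> R -> R) s al :
  continuity_2d_pt G s al -> continuity_2d_pt (fun s al => beta (G s al)) s al.
Proof.
intros H. apply (continuity_1d_2d_pt_comp beta G); [| exact H].
apply continuity_pt_filterlim, continuous_beta.
Qed.

Lemma fst_joint (g : R -> R) s al : continuous g s -> continuity_2d_pt (fun s al => g s) s al.
Proof.
intros H. apply (continuity_1d_2d_pt_comp g (fun s _ => s)); [| apply continuity_2d_pt_id1].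
apply continuity_pt_filterlim, H.
Qed.

Lemma snd_joint (g : R -> R) s al : continuous g al -> continuity_2d_pt (fun s al => g al) s al.
Proof.
intros H. apply (continuity_1d_2d_pt_comp g (fun _ al => al)); [| apply continuity_2d_pt_id2].
apply continuity_pt_filterlim, H.
Qed.

Lemma cst_joint m s al : continuity_2d_pt (fun s al => cst m al) s al.
Proof.
apply (snd_joint (cst m)). unfold cst, Rdiv. solve_continuous.
Qed.

Lemma flux_joint m sg s al : continuity_2d_pt (fun s al => flux m al sg (Rabs s)) s al.
Proof.
unfold flux. apply continuity_2d_pt_mult.
- apply continuity_2d_pt_opp, cst_joint.
- apply continuity_2d_pt_mult; [| apply prof_avg_joint].
  apply (fst_joint Rabs), continuous_Rabs.
Qed.

Lemma flux1_joint m sg s al : continuity_2d_pt (fun s al => flux1 m al sg (Rabs s)) s al.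
Proof.
unfold flux1. apply continuity_2d_pt_mult; [apply cst_joint |].
apply continuity_2d_pt_minus.
- apply continuity_2d_pt_mult; [apply continuity_2d_pt_const | apply prof_avg_joint].
- apply beta_joint, prof_joint.
Qed.

Lemma prof1_joint m sg s al : continuity_2d_pt (fun s al => prof1 m al sg (Rabs s)) s al.
Proof.
apply (continuity_2d_pt_ext (fun s al => Rabs s * (beta (prof m al sg (Rabs s)) * / 2) + flux m al sg (Rabs s))).
{ intros x y. rewrite prof1_flux. field. }
apply continuity_2d_pt_plus; [| apply flux_joint].
apply continuity_2d_pt_mult; [apply (fst_joint Rabs), continuous_Rabs |].
apply continuity_2d_pt_mult; [apply beta_joint, prof_joint | apply continuity_2d_pt_const].
Qed.

Lemma turn_rate_joint m sg s al :
  sg <> 0 -> continuity_2d_pt (fun s al => turn_rate m al sg (Rabs s)) s al.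
Proof.
intros Hsg. unfold turn_rate, Rdiv. apply continuity_2d_pt_mult.
- apply continuity_2d_pt_minus; apply continuity_2d_pt_mult.
  + apply prof_joint.
  + apply flux1_joint.
  + apply flux_joint.
  + apply prof1_joint.
- apply continuity_2d_pt_inv.
  + apply (continuity_2d_pt_ext (fun s al => prof m al sg (Rabs s) * prof m al sg (Rabs s) +
       flux m al sg (Rabs s) * flux m al sg (Rabs s))).
    { intros x y. unfold energy. ring. }
    apply continuity_2d_pt_plus; apply continuity_2d_pt_mult; apply prof_joint || apply flux_joint.
  + pose proof (energy_pos m al sg (Rabs s) Hsg (Rabs_pos s)). lra.
Qed.

Lemma section_continuous (G : R -> R -> R) s al :
  0 <= s -> continuity_2d_pt (fun s al => G al (Rabs s)) s al -> continuous (fun al => G al s) al.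
Proof.
intros Hs H. apply continuous_eps. intros e He.
destruct (H (mkposreal e He)) as [d Hd]. exists d. split; [apply cond_pos |].
intros y Hy. specialize (Hd s y). rewrite !(Rabs_pos_eq s) in Hd by assumption. apply Hd; [| exact Hy].
rewrite Rminus_diag, Rabs_R0. apply cond_pos.
Qed.

Lemma prof_continuous_al m sg s al : 0 <= s -> continuous (fun al => prof m al sg s) al.
Proof. intros Hs. apply (section_continuous (fun al => prof m al sg)); [assumption | apply prof_joint]. Qed.

Lemma prof1_continuous_al m sg s al : 0 <= s -> continuous (fun al => prof1 m al sg s) al.
Proof. intros Hs. apply (section_continuous (fun al => prof1 m al sg)); [assumption | apply prof1_joint]. Qed.

Lemma turn_continuous_al m sg s al :
  sg <> 0 -> 0 <= s -> continuous (fun al => turn m al sg s) al.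
Proof.
intros Hsg Hs. apply continuous_eps. intros e He.
assert (He' : 0 < e / (s + 1)) by (apply Rdiv_lt_0_compat; lra).
destruct (uniform_continuity_2d_1d (fun s al => turn_rate m al sg (Rabs s)) 0 s al) with (eps := mkposreal _ He')
  as [d Hd].
{ intros x _. now apply turn_rate_joint. }
exists d. split; [apply cond_pos |]. intros y Hy. unfold turn.
assert (Hint : forall al, ex_RInt (fun r => turn_rate m al sg (Rabs r)) 0 s).
{ intros a. apply ex_RInt_continuous_all. intros x. now apply turn_rate_abs_continuous. }
rewrite <- (RInt_minus (fun r => turn_rate m y sg (Rabs r)) (fun r => turn_rate m al sg (Rabs r))) by apply Hint.
apply Rle_lt_trans with ((s - 0) * (e / (s + 1))).
- apply abs_RInt_le_const; [assumption | |].
  + apply (ex_RInt_minus (fun r => turn_rate m y sg (Rabs r)) (fun r => turn_rate m al sg (Rabs r))); apply Hint.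
  + intros t Ht. left. apply Rabs_def2 in Hy. pose proof (cond_pos d) as Hdp.
    apply (Hd t al t y); try assumption; try lra.
    rewrite Rminus_diag, Rabs_R0. assumption.
- rewrite Rminus_0_r. apply (Rmult_lt_reg_r (s + 1)); [lra |].
  replace (s * (e / (s + 1)) * (s + 1)) with (s * e) by (field; lra). nra.
Qed.

Lemma crosses_open m al sg j :
  sg ^ 2 = 1 -> crosses m al sg j ->
  exists d, 0 < d /\ forall al', Rabs (al' - al) < d -> crosses m al' sg j.
Proof.
intros Hsg (s & Hs & H).
destruct (continuous_pos_near (fun a => level j - turn m a sg s) al) as (d & Hd & Hnear).
- apply continuous_Rminus; [apply continuous_const |].
  apply turn_continuous_al; [now apply unit_sign_neq0 | assumption].
- lra.
- exists d. split; [assumption |]. intros a Ha. exists s. split; [assumption |].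
  specialize (Hnear a Ha). simpl in Hnear. lra.
Qed.

(** * Behaviour at infinity *)

(* The slope of [beta] on the half-line of sign [e]: 1 for [e = 1], 2 for [e = -1]. *)
Definition beta_coef (e : R) : R := (3 - e) / 2.

Lemma beta_coef_bounds e : e ^ 2 = 1 -> 1 <= beta_coef e <= 2.
Proof. intros He. unfold beta_coef. destruct (unit_sign e He) as [-> | ->]; lra. Qed.

Lemma beta_coef_eq e x : e ^ 2 = 1 -> 0 <= e * x -> beta x = beta_coef e * x.
Proof.
intros He Hx. unfold beta_coef. destruct (unit_sign e He) as [-> | ->].
- rewrite beta_nonneg; lra.
- rewrite beta_nonpos; lra.
Qed.

Lemma locally_positive (g : R -> R) x :
  continuous g x -> 0 < g x -> locally x (fun y => 0 < g y).
Proof.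
intros Hg Hx. destruct (continuous_pos_near g x Hg Hx) as (d & Hd & H).
exists (mkposreal d Hd). intros y Hy. apply H. exact Hy.
Qed.

Definition prof2 (m : nat) (al sg e s : R) : R :=
  - (INR m / s - beta_coef e * s / 2) * prof1 m al sg s - beta_coef e * al / 2 * prof m al sg s.

Lemma prof1_derive m al sg e s :
  e ^ 2 = 1 -> 0 < s -> 0 < e * prof m al sg s ->
  is_derive (prof1 m al sg) s (prof2 m al sg e s).
Proof.
intros He Hs Hpos.
set (b := beta_coef e).
apply (is_derive_ext_loc (fun y => y * (b / 2 * prof m al sg y) + flux m al sg y)).
{ pose proof (prof_continuous m al sg) as Hc.
  generalize (locally_positive (fun y => e * prof m al sg y) s ltac:(solve_continuous) Hpos).
  apply filter_imp. intros y Hy. rewrite prof1_flux, (beta_coef_eq e) by (assumption || lra).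
  fold b. eqR. field. }
evar_last.
- apply is_derive_Rplus; [| now apply flux_derive].
  apply is_derive_Rmult; [apply is_derive_Rid |]. apply is_derive_Rscal. now apply prof_derive.
- eqR. unfold prof2. rewrite flux1_flux by assumption.
  pose proof (prof1_flux m al sg s) as E. rewrite (beta_coef_eq e) in * by (assumption || lra). fold b in E |- *.
  replace (flux m al sg s) with (prof1 m al sg s - s * (b * prof m al sg s) / 2) by lra.
  unfold cst. field. lra.
Qed.

(* The leading terms cancel when [f ~ s^alpha]; once the gap is positive at a
   large [s] it stays so, and then [f] keeps its sign. *)
Definition growth_gap (m : nat) (al sg e s : R) : R :=
  s ^ 2 * (e * prof1 m al sg s) - (al * s + 1) * (e * prof m al sg s).

(** Half of it exceeds [(al + 1) (m + al + 1) + al], the bound on the negative terms against which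
    [growth_gap_traps] plays the main term [x / 2]. *)
Definition far (m : nat) (al : R) : R := 2 * ((al + 1) * (INR m + al + 2)) + 1.

Lemma far_ge_1 m al : 0 <= al -> 1 <= far m al.
Proof. intros H. unfold far. pose proof (INR_pos m). nra. Qed.

Lemma far_monotone m al al' : 0 <= al <= al' -> far m al <= far m al'.
Proof. intros H. unfold far. pose proof (INR_pos m). nra. Qed.

Lemma growth_gap_continuous m al sg e s : continuous (growth_gap m al sg e) s.
Proof.
unfold growth_gap. pose proof (prof_continuous m al sg). pose proof (prof1_continuous m al sg).
apply continuous_Rminus; apply continuous_Rmult; try solve_continuous.
Qed.

Lemma growth_gap_traps m al sg e a :
  e ^ 2 = 1 -> 0 <= al -> far m al <= a ->
  0 < e * prof m al sg a -> 0 < growth_gap m al sg e a ->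
  forall s, a <= s -> 0 < e * prof m al sg s.
Proof.
intros He Hal Ha Hg Hv s Hs. pose proof (far_ge_1 m al Hal) as Hfar.
pose proof (prof_continuous m al sg) as Hpc.
set (g := fun s => e * prof m al sg s). set (v := growth_gap m al sg e).
assert (Hgc : forall x, continuous g x) by (intros x; unfold g; solve_continuous).
assert (Hvc : forall x, continuous v x) by apply growth_gap_continuous.
(* The two positivities must be propagated together, as each one's monotonicity uses the other; the
   minimum turns them into a single function. *)
assert (H : 0 < Rmin (g s) (v s)).
2: { eapply Rlt_le_trans; [apply H | apply Rmin_l]. }
apply (positive_persists (fun s => Rmin (g s) (v s)) a); [| now apply Rmin_glb_lt | | assumption].
{ intros x _. apply (continuous_ext (fun s => (g s + v s - Rabs (g s - v s)) * / 2)).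
  - intros y. unfold Rmin, Rabs. destruct Rle_dec; destruct Rcase_abs; lra.
  - solve_continuous. }
intros t Hat Hbefore.
assert (Hpos : forall x, a <= x < t -> 0 < g x /\ 0 < v x).
{ intros x Hx. specialize (Hbefore x Hx). simpl in Hbefore.
  pose proof (Rmin_l (g x) (v x)). pose proof (Rmin_r (g x) (v x)). lra. }
pose proof (INR_pos m) as Hm. pose proof (beta_coef_bounds e He) as Hb.
apply Rmin_glb_lt.
- apply Rlt_le_trans with (g a); [exact Hg |].
  apply (nondecreasing_of_derive g (fun s => e * prof1 m al sg s)); [lra | intros; apply Hgc |].
  intros x Hx. split.
  + unfold g. apply is_derive_Rscal, prof_derive. lra.
  + destruct (Hpos x ltac:(lra)) as [P1 P2]. unfold v, growth_gap in P2. fold (g x) in P2.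
    assert (0 <= (al * x + 1) * g x) by (apply Rmult_le_pos; [nra | lra]).
    assert (0 < x ^ 2) by (apply pow_lt; lra). nra.
- apply Rlt_le_trans with (v a); [exact Hv |].
  apply (nondecreasing_of_derive v (fun s => (2 * s * (e * prof1 m al sg s) + s ^ 2 * (e * prof2 m al sg e s))
     - (al * (e * prof m al sg s) + (al * s + 1) * (e * prof1 m al sg s)))); [lra | intros; apply Hvc |].
  intros x Hx. destruct (Hpos x ltac:(lra)) as [P1 P2]. split.
  + unfold v, growth_gap. evar_last.
    * apply is_derive_Rminus; apply is_derive_Rmult.
      -- apply (is_derive_pow (fun s => s) 2), is_derive_Rid.
      -- apply is_derive_Rscal, (prof1_derive m al sg e); try assumption; lra.
      -- apply is_derive_Rplus; [apply is_derive_Rscal, is_derive_Rid | apply is_derive_Rconst].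
      -- apply is_derive_Rscal, prof_derive. lra.
    * eqR. simpl. ring.
  + set (b := beta_coef e) in *. unfold prof2. fold b.
    (* Eliminating [f'] through the gap writes [v'] as a combination of [v] and [g] whose
       coefficients are nonnegative beyond [far]. In that of [g] the terms [b al x^2 / 2] cancel,
       and the growing term [b x / 2] comes from the summand 1 in [growth_gap]. *)
    assert (E : e * prof1 m al sg x = (v x + (al * x + 1) * g x) / x ^ 2).
    { unfold v, growth_gap. fold (g x). field. lra. }
    replace (2 * x * (e * prof1 m al sg x) +
      x ^ 2 * (e * (- (INR m / x - b * x / 2) * prof1 m al sg x - b * al / 2 * prof m al sg x)) -
      (al * (e * prof m al sg x) + (al * x + 1) * (e * prof1 m al sg x))) with
      (e * prof1 m al sg x * (2 * x - INR m * x + b * x ^ 3 / 2 - al * x - 1)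
       - (b * al * x ^ 2 / 2 + al) * g x) by (unfold g; field; lra).
    rewrite E.
    replace ((v x + (al * x + 1) * g x) / x ^ 2 * (2 * x - INR m * x + b * x ^ 3 / 2 - al * x - 1)
       - (b * al * x ^ 2 / 2 + al) * g x) with
      (v x * ((2 * x - INR m * x + b * x ^ 3 / 2 - al * x - 1) / x ^ 2)
       + g x * (b * x / 2 - (al * x + 1) * ((INR m + al - 2) * x + 1) / x ^ 2 - al)) by (field; lra).
    assert (Hx1 : 1 <= x) by lra.
    assert (Hxf : far m al <= x) by lra. unfold far in Hxf.
    assert (Hx2 : 0 < x ^ 2) by (apply pow_lt; lra).
    apply Rplus_le_le_0_compat; apply Rmult_le_pos; try lra.
    * apply Rmult_le_pos; [| left; now apply Rinv_0_lt_compat].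
      assert (INR m + al + 1 <= x / 2) by nra.
      assert (x * (x / 2) <= x ^ 3 / 2) by nra.
      assert (x ^ 3 <= b * x ^ 3) by nra. nra.
    * assert (Hq : (al * x + 1) * ((INR m + al - 2) * x + 1) / x ^ 2 <= (al + 1) * (INR m + al + 1)).
      { apply (Rmult_le_reg_r (x ^ 2)); [assumption |].
        unfold Rdiv. rewrite (Rmult_assoc _ (/ x ^ 2)), Rinv_l, Rmult_1_r by lra.
        apply Rle_trans with ((al * x + 1) * ((INR m + al + 1) * x)).
        - apply Rmult_le_compat_l; nra.
        - replace ((al + 1) * (INR m + al + 1) * x ^ 2) with (((al + 1) * x) * ((INR m + al + 1) * x)) by ring.
          apply Rmult_le_compat_r; nra. }
      nra.
Qed.

(* Without a positive gap, [s^-alpha f(s) exp (1/s)] is nonincreasing. *)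
Lemma growth_bounded_of_gap m al sg e a :
  e ^ 2 = 1 -> 0 < a ->
  (forall s, a <= s -> 0 < e * prof m al sg s) ->
  (forall s, a <= s -> growth_gap m al sg e s <= 0) ->
  profile_growth_bounded al (prof m al sg).
Proof.
intros He Ha Hpos Hgap.
set (h := fun s => exp (- al * ln s + / s) * (e * prof m al sg s)).
exists (h a), a. split; [assumption |]. intros s Hs.
assert (Hh : h s <= h a).
{ apply Ropp_le_cancel.
  assert (Hd : forall x, a <= x -> is_derive (fun s => - h s) x
    (- (exp (- al * ln x + / x) * (- al * / x - / x ^ 2) * (e * prof m al sg x)
       + exp (- al * ln x + / x) * (e * prof1 m al sg x)))).
  { intros x Hx. apply (is_derive_opp h). unfold h.
    apply (is_derive_Rmult (fun s => exp (- al * ln s + / s)) (fun s => e * prof m al sg s)).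
    - auto_derive; [lra |]. eqR. field. lra.
    - apply is_derive_Rscal, prof_derive. lra. }
  apply (nondecreasing_of_derive (fun s => - h s) (fun x =>
    - (exp (- al * ln x + / x) * (- al * / x - / x ^ 2) * (e * prof m al sg x)
       + exp (- al * ln x + / x) * (e * prof1 m al sg x)))); [assumption | |].
  - intros x Hx. eapply continuous_of_derive. apply Hd. lra.
  - intros x Hx. split; [apply Hd; lra |].
    specialize (Hgap x ltac:(lra)). unfold growth_gap in Hgap.
    replace (- (exp (- al * ln x + / x) * (- al * / x - / x ^ 2) * (e * prof m al sg x)
       + exp (- al * ln x + / x) * (e * prof1 m al sg x))) with
      (exp (- al * ln x + / x) * (/ x ^ 2 * - (x ^ 2 * (e * prof1 m al sg x) - (al * x + 1) * (e * prof m al sg x))))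
      by (field; lra).
    apply Rmult_le_pos; [left; apply exp_pos |]. apply Rmult_le_pos; [| lra].
    left. apply Rinv_0_lt_compat, pow_lt. lra. }
eapply Rle_trans; [| apply Hh]. unfold h, Rpower.
assert (Habs : Rabs (prof m al sg s) = e * prof m al sg s).
{ specialize (Hpos s Hs). destruct (unit_sign e He) as [-> | ->].
  - rewrite Rabs_pos_eq; lra.
  - rewrite Rabs_left; lra. }
rewrite Rabs_mult, Habs, (Rabs_pos_eq (exp _)) by (left; apply exp_pos).
apply Rmult_le_compat_r; [left; now apply Hpos |].
left. apply exp_increasing. assert (0 < / s) by (apply Rinv_0_lt_compat; lra). lra.
Qed.

(** * Wronskians on an interval of constant sign *)

(** The integrating factor [s^m exp (- b s^2 / 4)], which puts [F'' + (m/s - b s/2) F'] in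
    divergence form. *)
Definition sturm_weight (m : nat) (b s : R) : R := exp (INR m * ln s - b * s ^ 2 / 4).

Lemma sturm_weight_pos m b s : 0 < sturm_weight m b s.
Proof. apply exp_pos. Qed.

Lemma sturm_weight_derive m b s :
  0 < s -> is_derive (sturm_weight m b) s (sturm_weight m b s * (INR m / s - b * s / 2)).
Proof.
intros Hs. unfold sturm_weight.
apply (is_derive_Rcomp (fun s => INR m * ln s - b * s ^ 2 / 4) exp).
- apply is_derive_exp.
- auto_derive; [lra |]. eqR. field. lra.
Qed.

Definition wronskian (m : nat) (b : R) (F F1 G G1 : R -> R) (s : R) : R :=
  sturm_weight m b s * (F s * G1 s - F1 s * G s).

(** The second-order equation is asked only strictly past [a], because the interval may begin at a
    zero of a profile, where [f''] jumps; at [a] itself the continuity of [F1] is enough. *)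
Definition sturm_pair (m : nat) (b al : R) (F F1 F2 : R -> R) (a : R) : Prop :=
  (forall s, a <= s -> is_derive F s (F1 s) /\ continuous F1 s) /\
  (forall s, a < s -> 0 < F s -> is_derive F1 s (F2 s) /\
     F2 s + (INR m / s - b * s / 2) * F1 s + b * al / 2 * F s = 0).

(** Lagrange's identity: the derivative of the Wronskian is [- w b (al' - al) / 2] times [F G], with
    [w] the weight. *)
Lemma wronskian_nonincreasing m b al al' a t (F F1 F2 G G1 G2 : R -> R) :
  0 <= b -> al <= al' -> 0 < a <= t ->
  sturm_pair m b al F F1 F2 a -> sturm_pair m b al' G G1 G2 a ->
  (forall s, a < s < t -> 0 < F s /\ 0 < G s) ->
  wronskian m b F F1 G G1 t <= wronskian m b F F1 G G1 a.
Proof.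
intros Hb Hal Ha [HF HF2] [HG HG2] Hpos. apply Ropp_le_cancel.
apply (nondecreasing_of_derive (fun s => - wronskian m b F F1 G G1 s)
  (fun s => sturm_weight m b s * (b * (al' - al) / 2 * (F s * G s)))); [lra | |].
- intros x Hx. apply continuous_Ropp. unfold wronskian. apply continuous_Rmult.
  + eapply continuous_of_derive. apply sturm_weight_derive. lra.
  + destruct (HF x (proj1 Hx)) as [D1 C1]. destruct (HG x (proj1 Hx)) as [D2 C2].
    apply continuous_of_derive in D1, D2.
    apply continuous_Rminus; apply continuous_Rmult; assumption.
- intros x Hx. destruct (HF x ltac:(lra)) as [D1 _]. destruct (HG x ltac:(lra)) as [D2 _].
  destruct (Hpos x ltac:(lra)) as [P1 P2].
  destruct (HF2 x ltac:(lra) P1) as [D3 E1]. destruct (HG2 x ltac:(lra) P2) as [D4 E2]. split.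
  + evar_last.
    * apply (is_derive_opp (wronskian m b F F1 G G1)). unfold wronskian.
      apply is_derive_Rmult; [apply sturm_weight_derive; lra |].
      apply is_derive_Rminus; apply is_derive_Rmult; eassumption.
    * unfold opp; simpl. eqR.
      replace (F2 x) with (- (INR m / x - b * x / 2) * F1 x - b * al / 2 * F x) by lra.
      replace (G2 x) with (- (INR m / x - b * x / 2) * G1 x - b * al' / 2 * G x) by lra.
      field. lra.
  + apply Rmult_le_pos; [left; apply sturm_weight_pos |]. apply Rmult_le_pos; nra.
Qed.

(* A negative Wronskian makes [G / F] decrease at least linearly when [F = O(s^alpha)]. *)
Lemma wronskian_contradiction m b al al' M S a (F F1 F2 G G1 G2 : R -> R) :
  1 <= b -> 0 <= al <= al' -> 0 < a ->
  sturm_pair m b al F F1 F2 a -> sturm_pair m b al' G G1 G2 a ->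
  (forall s, a < s -> 0 < F s /\ 0 < G s) ->
  F a * G1 a - F1 a * G a < 0 ->
  (forall s, S <= s -> Rpower s (- al) * F s <= M) -> False.
Proof.
intros Hb Hal Ha HFp HGp Hpos HW HM.
pose proof (INR_pos m) as Hm.
set (w := sturm_weight m b). set (W := wronskian m b F F1 G G1).
assert (HD : forall s, a <= s -> is_derive F s (F1 s) /\ is_derive G s (G1 s)).
{ intros s Hs. split; [apply HFp | apply HGp]; assumption. }
assert (Hwpos : forall s, 0 < w s) by (intros; apply sturm_weight_pos).
assert (HWa : W a < 0).
{ unfold W, wronskian. fold w. specialize (Hwpos a). nra. }
assert (HWle : forall s, a <= s -> W s <= W a).
{ intros s Hs. apply (wronskian_nonincreasing m b al al' a s F F1 F2 G G1 G2); try assumption; try lra.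
  intros x Hx. apply Hpos. lra. }
(* Beyond [T] the growth bound on [F] is in force, and [ln s <= s] with [4 (m + 2 al) <= s] gives
   [(m + 2 al) ln s <= s^2 / 4]: the Gaussian factor of the weight outweighs [s^m F^2]. *)
set (T := Rmax (Rmax (a + 1) S) (Rmax 1 (4 * (INR m + 2 * al)))).
assert (HT : a + 1 <= T /\ S <= T /\ 1 <= T /\ 4 * (INR m + 2 * al) <= T).
{ unfold T. pose proof (Rmax_l (Rmax (a + 1) S) (Rmax 1 (4 * (INR m + 2 * al)))).
  pose proof (Rmax_r (Rmax (a + 1) S) (Rmax 1 (4 * (INR m + 2 * al)))).
  pose proof (Rmax_l (a + 1) S). pose proof (Rmax_r (a + 1) S).
  pose proof (Rmax_l 1 (4 * (INR m + 2 * al))). pose proof (Rmax_r 1 (4 * (INR m + 2 * al))).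
  lra. }
destruct HT as (HT1 & HT2 & HT3 & HT4).
assert (HMpos : 0 < M).
{ destruct (Hpos T ltac:(lra)) as [P _]. specialize (HM T HT2).
  assert (0 < Rpower T (- al)) by apply exp_pos. nra. }
assert (Hsmall : forall s, T <= s -> w s * F s ^ 2 <= M ^ 2).
{ intros s Hs. destruct (Hpos s ltac:(lra)) as [P _]. specialize (HM s ltac:(lra)).
  assert (HF : F s <= M * exp (al * ln s)).
  { unfold Rpower in HM.
    apply (Rmult_le_compat_r (exp (al * ln s))) in HM; [| left; apply exp_pos].
    replace (exp (- al * ln s) * F s * exp (al * ln s)) with (F s * (exp (- al * ln s) * exp (al * ln s))) in HM by ring.
    rewrite <- exp_plus in HM. replace (- al * ln s + al * ln s) with 0 in HM by ring.
    rewrite exp_0 in HM. lra. }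
  assert (HF2 : F s ^ 2 <= M ^ 2 * exp (2 * al * ln s)).
  { replace (M ^ 2 * exp (2 * al * ln s)) with ((M * exp (al * ln s)) ^ 2).
    - apply pow_incr. lra.
    - rewrite Rpow_mult_distr. simpl. rewrite !Rmult_1_r, <- exp_plus. f_equal. f_equal. ring. }
  apply Rle_trans with (w s * (M ^ 2 * exp (2 * al * ln s))).
  { apply Rmult_le_compat_l; [left; apply Hwpos | assumption]. }
  replace (w s * (M ^ 2 * exp (2 * al * ln s))) with (M ^ 2 * (w s * exp (2 * al * ln s))) by ring.
  rewrite <- (Rmult_1_r (M ^ 2)) at 2. apply Rmult_le_compat_l; [apply pow2_ge_0 |].
  unfold w, sturm_weight. rewrite <- exp_plus, <- exp_0.
  assert (Hln : ln s <= s).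
  { destruct (Rle_lt_dec s 1) as [H1 | H1].
    - replace s with 1 by lra. rewrite ln_1. lra.
    - rewrite <- (exp_ln s) at 2 by lra. pose proof (exp_ineq1_le (ln s)). lra. }
  assert (Hln0 : 0 <= ln s).
  { destruct (Rle_lt_or_eq_dec 1 s ltac:(lra)) as [H1 | <-]; [| rewrite ln_1; lra].
    rewrite <- ln_1. left. apply ln_increasing; lra. }
  assert (INR m * ln s - b * s ^ 2 / 4 + 2 * al * ln s <= 0).
  { assert ((INR m + 2 * al) * ln s <= s / 4 * s) by (apply Rmult_le_compat; lra). nra. }
  destruct (Rle_lt_or_eq_dec _ _ H) as [H1 | ->]; [| lra]. left. now apply exp_increasing. }
(* Since [(G / F)' = W / (w F^2)], with [W <= W a < 0] and [w F^2 <= M^2], the ratio decreases at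
   least at rate [k]. *)
set (k := - W a / M ^ 2).
assert (Hk : 0 < k) by (apply Rdiv_lt_0_compat; [lra | now apply pow_lt]).
assert (Hratio : forall s, T <= s -> G s / F s + k * s <= G T / F T + k * T).
{ intros s Hs. apply Ropp_le_cancel.
  assert (Hd : forall x, T <= x -> is_derive (fun s => - (G s / F s + k * s)) x
     (- ((G1 x * F x - G x * F1 x) / F x ^ 2 + k * 1))).
  { intros x Hx. apply (is_derive_opp (fun s => G s / F s + k * s)).
    destruct (HD x ltac:(lra)) as [D1 D2]. destruct (Hpos x ltac:(lra)) as [P _].
    apply is_derive_Rplus; [| apply is_derive_Rscal, is_derive_Rid].
    evar_last; [apply (is_derive_div G F); [exact D2 | exact D1 | lra] |]. eqR. reflexivity. }
  apply (nondecreasing_of_derive (fun s => - (G s / F s + k * s))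
    (fun x => - ((G1 x * F x - G x * F1 x) / F x ^ 2 + k * 1))); [assumption | |].
  - intros x Hx. eapply continuous_of_derive. apply Hd. lra.
  - intros x Hx. split; [apply Hd; lra |].
    destruct (Hpos x ltac:(lra)) as [P _]. specialize (HWle x ltac:(lra)). specialize (Hsmall x ltac:(lra)).
    specialize (Hwpos x). assert (HF2 : 0 < F x ^ 2) by now apply pow_lt.
    assert (HM2 : 0 < M ^ 2) by now apply pow_lt.
    replace ((G1 x * F x - G x * F1 x) / F x ^ 2) with (W x / (w x * F x ^ 2)) by (unfold W, wronskian; fold w; field; lra).
    assert (0 < w x * F x ^ 2) by now apply Rmult_lt_0_compat.
    assert (W x / (w x * F x ^ 2) <= - k); [| lra].
    apply Rle_trans with (W a / (w x * F x ^ 2)).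
    { apply Rmult_le_compat_r; [left; now apply Rinv_0_lt_compat | assumption]. }
    unfold k. unfold Rdiv. rewrite <- Ropp_mult_distr_l, Ropp_involutive.
    apply Rmult_le_compat_neg_l; [lra |]. now apply Rinv_le_contravar. }
(* By this point a decrease at rate [k] has used up the whole value of [G / F] at [T], so the ratio
   would be negative. *)
set (s := T + (G T / F T) / k + 1).
destruct (Hpos T ltac:(lra)) as [PF PG].
assert (0 < G T / F T) by now apply Rdiv_lt_0_compat.
assert (0 < G T / F T / k) by now apply Rdiv_lt_0_compat.
assert (Hs : T <= s) by (unfold s; lra).
specialize (Hratio s Hs). destruct (Hpos s ltac:(lra)) as [PFs PGs].
assert (0 < G s / F s) by now apply Rdiv_lt_0_compat.
assert (k * s = k * T + G T / F T + k) by (unfold s; field; lra). lra.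
Qed.

Lemma prof_sturm_pair m al sg e a :
  e ^ 2 = 1 -> 0 < a ->
  sturm_pair m (beta_coef e) al (fun s => e * prof m al sg s) (fun s => e * prof1 m al sg s)
    (fun s => e * prof2 m al sg e s) a.
Proof.
intros He Ha. split.
- intros s Hs. split.
  + apply is_derive_Rscal, prof_derive. lra.
  + pose proof (prof1_continuous m al sg). solve_continuous.
- intros s Hs Hp. split.
  + apply is_derive_Rscal, prof1_derive; try assumption; lra.
  + unfold prof2. field. lra.
Qed.

Lemma signed_bound (f : R -> R) e al M S :
  e ^ 2 = 1 -> (forall s, S <= s -> Rabs (Rpower s (- al) * f s) <= M) ->
  forall s, S <= s -> Rpower s (- al) * (e * f s) <= M.
Proof.
intros He H s Hs. eapply Rle_trans; [| apply (H s Hs)].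
destruct (unit_sign e He) as [-> | ->].
- rewrite Rmult_1_l. apply Rle_abs.
- rewrite <- Rabs_Ropp. replace (Rpower s (- al) * (-1 * f s)) with (- (Rpower s (- al) * f s)) by ring.
  apply Rle_abs.
Qed.

Lemma bounded_is_lowest m al al' sg sg' th0 th0' e a :
  sg ^ 2 = 1 -> sg' ^ 2 = 1 -> cos th0 = sg -> cos th0' = sg' ->
  e ^ 2 = 1 -> 0 <= al <= al' -> 0 < a ->
  (forall s, a <= s -> 0 < e * prof m al sg s /\ 0 < e * prof m al' sg' s) ->
  - PI < (th0' + turn m al' sg' a) - (th0 + turn m al sg a) < 0 ->
  ~ profile_growth_bounded al (prof m al sg).
Proof.
intros Hsg Hsg' Hth Hth' He Hal Ha Hpos Hang (M & S & HS & HM).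
set (b := beta_coef e). assert (Hb : 1 <= b <= 2) by now apply beta_coef_bounds.
apply (wronskian_contradiction m b al al' M S a
  (fun s => e * prof m al sg s) (fun s => e * prof1 m al sg s) (fun s => e * prof2 m al sg e s)
  (fun s => e * prof m al' sg' s) (fun s => e * prof1 m al' sg' s) (fun s => e * prof2 m al' sg' e s));
  try assumption; try lra; try (now apply prof_sturm_pair).
- intros s Hs. apply Hpos. lra.
- destruct (Hpos a ltac:(lra)) as [P1 P2].
  rewrite !prof1_flux, (beta_coef_eq e (prof m al sg a)), (beta_coef_eq e (prof m al' sg' a)) by (assumption || lra).
  destruct (polar_form m al sg th0 a Hsg Hth ltac:(lra)) as (X & HX & -> & ->).
  destruct (polar_form m al' sg' th0' a Hsg' Hth' ltac:(lra)) as (Y & HY & -> & ->).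
  set (u := th0 + turn m al sg a) in *. set (v := th0' + turn m al' sg' a) in *.
  match goal with |- ?x < 0 => replace x with (e ^ 2 * (X * Y * sin (v - u))) end.
  + rewrite He, Rmult_1_l.
    assert (sin (v - u) < 0) by (apply sin_lt_0_var; lra).
    assert (0 < X * Y) by now apply Rmult_lt_0_compat. nra.
  + rewrite sin_minus. field.
- now apply signed_bound.
Qed.

(** * Zeros at large distance and their stability in the exponent *)

Lemma prof_at_level m al sg j s :
  sg ^ 2 = 1 -> 0 <= s -> turn m al sg s = level j ->
  prof m al sg s = 0 /\ exists X, 0 < X /\ prof1 m al sg s = X * ((-1) ^ j * sg).
Proof.
intros Hsg Hs E. destruct (initial_angle sg Hsg) as [th0 Hth].
destruct (polar_form m al sg th0 s Hsg Hth Hs) as (X & HX & Ef & Eq).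
rewrite E in Ef, Eq. unfold level in Ef, Eq.
destruct (shifted_angle sg th0 j (PI / 2) Hsg Hth) as [Hc Hsn].
rewrite Hc, cos_PI2 in Ef. rewrite Hsn, sin_PI2 in Eq.
assert (Hf : prof m al sg s = 0) by lra.
split; [exact Hf |]. exists X. split; [assumption |].
rewrite prof1_flux, Hf, Eq, beta_nonneg by lra. field.
Qed.

Lemma level_reached m al sg j a s :
  sg ^ 2 = 1 -> a <= s -> turn m al sg s <= level j <= turn m al sg a ->
  exists z, a <= z <= s /\ turn m al sg z = level j.
Proof.
intros Hsg Has H. apply (intermediate_value (turn m al sg)); [assumption | | lra].
intros x. apply turn_continuous. now apply unit_sign_neq0.
Qed.

Lemma trapped_no_crossing m al sg i a :
  sg ^ 2 = 1 -> 0 <= al -> far m al <= a ->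
  level (S i) < turn m al sg a < level i ->
  0 < growth_gap m al sg ((-1) ^ i * sg) a -> ~ crosses m al sg (S i).
Proof.
intros Hsg Hal Ha Hlev Hgap (s & Hs & Hcross).
pose proof (far_ge_1 m al Hal) as Hfar.
assert (Has : a < s).
{ destruct (Rlt_le_dec a s) as [|Hle]; [assumption |].
  pose proof (level_barrier m al sg (S i) s a Hsg ltac:(lra) Hcross). lra. }
destruct (level_reached m al sg (S i) a s Hsg) as (z & Hz & Ez); [lra | lra |].
pose proof (growth_gap_traps m al sg ((-1) ^ i * sg) a (unit_sign_pow sg i Hsg) Hal Ha
  (strip_sign m al sg i a Hsg ltac:(lra) Hlev) Hgap z (proj1 Hz)) as Hpos.
destruct (prof_at_level m al sg (S i) z Hsg ltac:(lra) Ez) as [E _]. rewrite E in Hpos. lra.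
Qed.

(* Just after a zero the growth gap is positive, so a far zero is the last one. *)
Lemma one_more_crossing m al sg i a :
  sg ^ 2 = 1 -> 0 <= al -> far m al <= a -> level i < turn m al sg a -> ~ crosses m al sg (S i).
Proof.
intros Hsg Hal Ha Hlev Hcr. pose proof Hcr as (s & Hs & Hcross).
pose proof (far_ge_1 m al Hal) as Hfar. pose proof PI_RGT_0 as HPI.
assert (Hlow : level (S i) = level i - PI) by apply level_S.
assert (Has : a < s).
{ destruct (Rlt_le_dec a s) as [|Hle]; [assumption |].
  pose proof (level_barrier m al sg (S i) s a Hsg ltac:(lra) Hcross). lra. }
destruct (level_reached m al sg i a s Hsg) as (z & Hz & Ez); [lra | lra |].
destruct (prof_at_level m al sg i z Hsg ltac:(lra) Ez) as [E (X & HX & E1)].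
set (e := (-1) ^ i * sg) in *.
assert (He : e ^ 2 = 1) by now apply unit_sign_pow.
assert (Hgap : 0 < growth_gap m al sg e z).
{ unfold growth_gap. rewrite E, E1.
  replace (z ^ 2 * (e * (X * e)) - (al * z + 1) * (e * 0)) with (z ^ 2 * X * e ^ 2) by ring.
  rewrite He, Rmult_1_r. apply Rmult_lt_0_compat; [apply pow_lt; lra | assumption]. }
destruct (continuous_pos_near _ z (growth_gap_continuous m al sg e z) Hgap) as (d1 & Hd1 & N1).
destruct (continuous_pos_near (fun s => turn m al sg s - level (S i)) z) as (d2 & Hd2 & N2).
{ apply continuous_Rminus; [| apply continuous_const]. apply turn_continuous. now apply unit_sign_neq0. }
{ lra. }
set (d := Rmin d1 d2 / 2).
assert (Hd : 0 < d /\ d < d1 /\ d < d2).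
{ unfold d. pose proof (Rmin_l d1 d2). pose proof (Rmin_r d1 d2).
  assert (0 < Rmin d1 d2) by (apply Rmin_glb_lt; assumption). lra. }
apply (trapped_no_crossing m al sg i (z + d)); try assumption.
- lra.
- split.
  + specialize (N2 (z + d) ltac:(apply Rabs_def1; lra)). simpl in N2. lra.
  + apply below_level_after; try assumption; lra.
- apply N1. apply Rabs_def1; lra.
Qed.

(** The angle at [far] lies above some level, and at most one zero follows once that level is still
    ahead. *)
Lemma finite_crossings m al sg : sg ^ 2 = 1 -> 0 <= al -> exists j, ~ crosses m al sg j.
Proof.
intros Hsg Hal. pose proof PI_RGT_0 as HPI.
destruct (INR_unbounded ((PI / 2 - turn m al sg (far m al)) / PI)) as [i Hi].
exists (S i). apply (one_more_crossing m al sg i (far m al)); try assumption; [lra |].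
unfold level. apply (Rmult_lt_compat_r PI) in Hi; [| assumption].
unfold Rdiv in Hi at 1. rewrite Rmult_assoc, Rinv_l, Rmult_1_r in Hi by lra. lra.
Qed.

Lemma crossing_count m al sg j :
  ~ crosses m al sg (S j) -> exists i, (i <= j)%nat /\ crosses m al sg i /\ ~ crosses m al sg (S i).
Proof.
induction j as [|j IH]; intros H.
- exists 0%nat. split; [lia |]. split; [apply crosses_0 | assumption].
- destruct (classic (crosses m al sg (S j))) as [Hc | Hc].
  + exists (S j). split; [lia |]. now split.
  + destruct (IH Hc) as (i & Hi & H1). exists i. split; [lia | assumption].
Qed.

(** At the radius [a], which is far enough for every exponent up to [al + 1], the angle stays above
    [level (S j)] under a small change of exponent; that level may then be crossed beyond [a], but
    not the next one. *)
Lemma crossings_upper_semicontinuous m al sg j :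
  sg ^ 2 = 1 -> 0 <= al -> ~ crosses m al sg (S j) ->
  exists d, 0 < d /\ forall al', al <= al' < al + d -> ~ crosses m al' sg (S (S j)).
Proof.
intros Hsg Hal Hn. pose proof (unit_sign_neq0 sg Hsg) as Hn0.
set (a := far m (al + 1)). pose proof (far_ge_1 m (al + 1) ltac:(lra)) as Ha. fold a in Ha.
pose proof (not_crosses_above m al sg (S j) a Hsg Hn ltac:(lra)) as Hlev.
destruct (continuous_pos_near (fun x => turn m x sg a - level (S j)) al) as (d & Hd & Hnear).
{ apply continuous_Rminus; [| apply continuous_const]. apply turn_continuous_al; [assumption | lra]. }
{ lra. }
exists (Rmin d 1). split; [apply Rmin_glb_lt; lra |]. intros al' Hal'.
pose proof (Rmin_l d 1). pose proof (Rmin_r d 1).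
apply (one_more_crossing m al' sg (S j) a); try assumption; [lra | apply far_monotone; lra |].
specialize (Hnear al' ltac:(apply Rabs_def1; lra)). simpl in Hnear. lra.
Qed.

(** A profile that is not bounded has a positive gap at some far point, by [growth_bounded_of_gap].
    The gap and the strip at that single point are open conditions in the exponent, and together
    they exclude any further zero. *)
Lemma unbounded_crossings_stable m al sg j :
  sg ^ 2 = 1 -> 0 <= al -> ~ crosses m al sg (S j) ->
  ~ profile_growth_bounded al (prof m al sg) ->
  exists d, 0 < d /\ forall al', al <= al' < al + d -> ~ crosses m al' sg (S j).
Proof.
intros Hsg Hal Hn Hunb. pose proof (unit_sign_neq0 sg Hsg) as Hn0.
destruct (crossing_count m al sg j Hn) as (i & Hij & (a0 & Ha0 & Hlev0) & Hni).
set (a := Rmax a0 (far m (al + 1))).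
pose proof (far_ge_1 m (al + 1) ltac:(lra)) as Hfar.
pose proof (Rmax_l a0 (far m (al + 1))) as Hl. pose proof (Rmax_r a0 (far m (al + 1))) as Hr.
fold a in Hl, Hr.
assert (Hstrip : forall s, a <= s -> level (S i) < turn m al sg s < level i).
{ intros s Hs. split; [apply not_crosses_above; try assumption; lra |].
  apply (level_barrier m al sg i a0); try assumption; lra. }
set (e := (-1) ^ i * sg). assert (He : e ^ 2 = 1) by now apply unit_sign_pow.
destruct (classic (exists s, a <= s /\ 0 < growth_gap m al sg e s)) as [(s & Hs & Hgap) | Hno].
2: { exfalso. apply Hunb. apply (growth_bounded_of_gap m al sg e a); [assumption | lra | |].
     - intros s Hs. apply strip_sign; [assumption | lra |]. now apply Hstrip.
     - intros s Hs. apply Rnot_lt_le. intros H. apply Hno. now exists s. }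
destruct (continuous_pos_near (fun x => growth_gap m x sg e s) al) as (d1 & Hd1 & N1).
{ unfold growth_gap.
  pose proof (fun x => prof1_continuous_al m sg s x ltac:(lra)) as C1.
  pose proof (fun x => prof_continuous_al m sg s x ltac:(lra)) as C0.
  apply continuous_Rminus; apply continuous_Rmult; try apply continuous_const.
  - apply continuous_Rmult; [apply continuous_const | apply C1].
  - solve_continuous.
  - apply continuous_Rmult; [apply continuous_const | apply C0]. }
{ assumption. }
assert (Ct : continuous (fun x => turn m x sg s) al) by (apply turn_continuous_al; [assumption | lra]).
destruct (Hstrip s Hs) as [L1 L2].
destruct (continuous_pos_near (fun x => turn m x sg s - level (S i)) al) as (d2 & Hd2 & N2);
  [apply continuous_Rminus; [exact Ct | apply continuous_const] | lra |].
destruct (continuous_pos_near (fun x => level i - turn m x sg s) al) as (d3 & Hd3 & N3);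
  [apply continuous_Rminus; [apply continuous_const | exact Ct] | lra |].
set (d := Rmin (Rmin d1 d2) (Rmin d3 1)).
assert (Hd : 0 < d /\ d <= d1 /\ d <= d2 /\ d <= d3 /\ d <= 1).
{ unfold d. pose proof (Rmin_l (Rmin d1 d2) (Rmin d3 1)). pose proof (Rmin_r (Rmin d1 d2) (Rmin d3 1)).
  pose proof (Rmin_l d1 d2). pose proof (Rmin_r d1 d2). pose proof (Rmin_l d3 1). pose proof (Rmin_r d3 1).
  split; [| lra]. repeat apply Rmin_glb_lt; lra. }
exists d. split; [lra |]. intros al' Hal' Hc.
assert (Hnear : Rabs (al' - al) < d) by (apply Rabs_def1; lra).
specialize (N1 al' ltac:(lra)). specialize (N2 al' ltac:(lra)). specialize (N3 al' ltac:(lra)).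
simpl in N1, N2, N3.
apply (trapped_no_crossing m al' sg i s); try assumption; try lra.
- pose proof (far_monotone m al' (al + 1) ltac:(lra)). lra.
- apply (crosses_le m al' sg (S i) (S j)); [lia | assumption].
Qed.

(** Otherwise both angles end in strip [j], the one for [al'] strictly lower but by less than the
    width PI, against [bounded_is_lowest]. *)
Lemma bounded_gains_crossing m al al' sg j :
  sg ^ 2 = 1 -> 0 <= al < al' -> profile_growth_bounded al (prof m al sg) ->
  crosses m al sg j -> crosses m al' sg (S j).
Proof.
intros Hsg Hal Hb (a0 & Ha0 & Hlev0).
destruct (classic (crosses m al' sg (S j))) as [|Hn']; [assumption | exfalso].
assert (Hn : ~ crosses m al sg (S j)).
{ intros H. apply Hn'. apply (crosses_monotone m al al'); try assumption; lra. }
destruct (initial_angle sg Hsg) as [th0 Hth].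
set (a := a0 + 1).
assert (Hstrip : forall s, a <= s -> level (S j) < turn m al' sg s < turn m al sg s /\ turn m al sg s < level j).
{ intros s Hs. unfold a in Hs. repeat split.
  - apply not_crosses_above; try assumption; lra.
  - apply turn_antitone; try assumption; lra.
  - apply (level_barrier m al sg j a0); try assumption; lra. }
apply (bounded_is_lowest m al al' sg sg th0 th0 ((-1) ^ j * sg) a); try assumption.
- now apply unit_sign_pow.
- lra.
- unfold a; lra.
- intros s Hs. destruct (Hstrip s Hs). unfold a in Hs.
  split; apply strip_sign; try assumption; lra.
- destruct (Hstrip a ltac:(lra)) as [H1 H2]. rewrite level_S in H1. lra.
Qed.

(** Raised by PI, the angle of the [- sg] profile ends in the same strip as that of the [sg] profile
    and lies above it, so it cannot belong to a bounded solution. This rules out equality in the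
    interlacing. *)
Lemma opposite_not_both_bounded m al sg j :
  sg ^ 2 = 1 -> 0 <= al -> profile_growth_bounded al (prof m al (- sg)) ->
  crosses m al (- sg) (S j) -> ~ crosses m al (- sg) (S (S j)) ->
  crosses m al sg j -> ~ crosses m al sg (S j) -> False.
Proof.
intros Hsg Hal Hb (a1 & Ha1 & Hlev1) Hn1 (a2 & Ha2 & Hlev2) Hn2.
pose proof (unit_sign_opp sg Hsg) as Hsg'.
destruct (initial_angle sg Hsg) as [th0 Hth].
assert (Hth' : cos (th0 + PI) = - sg) by (rewrite cos_plus, cos_PI, sin_PI, Hth; ring).
set (a := a1 + a2 + 1).
assert (Hs1 : forall s, a <= s -> level (S (S j)) < turn m al (- sg) s < level (S j)).
{ intros s Hs. unfold a in Hs. split; [apply not_crosses_above; try assumption; lra |].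
  apply (level_barrier m al (- sg) (S j) a1); try assumption; lra. }
assert (Hs2 : forall s, a <= s -> level (S j) < turn m al sg s < level j).
{ intros s Hs. unfold a in Hs. split; [apply not_crosses_above; try assumption; lra |].
  apply (level_barrier m al sg j a2); try assumption; lra. }
apply (bounded_is_lowest m al al (- sg) sg (th0 + PI) th0 ((-1) ^ j * sg) a); try assumption.
- now apply unit_sign_pow.
- lra.
- unfold a; lra.
- intros s Hs. split.
  + replace ((-1) ^ j * sg) with ((-1) ^ S j * - sg) by (simpl; ring).
    apply strip_sign; [assumption | unfold a in Hs; lra | now apply Hs1].
  + apply strip_sign; [assumption | unfold a in Hs; lra | now apply Hs2].
- destruct (Hs1 a ltac:(lra)) as [H1 H2]. destruct (Hs2 a ltac:(lra)) as [H3 H4].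
  pose proof (turn_opposite m al (- sg) a Hsg' ltac:(unfold a; lra)) as H5.
  rewrite Ropp_involutive in H5. rewrite !level_S in *. lra.
Qed.

Lemma opposite_crossings m al sg j :
  sg ^ 2 = 1 -> ~ crosses m al sg j -> ~ crosses m al (- sg) (S j).
Proof.
intros Hsg Hn (s & Hs & H). apply Hn. exists s. split; [assumption |].
pose proof (turn_opposite m al (- sg) s (unit_sign_opp sg Hsg) Hs) as H1.
rewrite Ropp_involutive in H1. rewrite level_S in H. lra.
Qed.

(** * Oscillation for large exponents *)

(** Riccati: [r = flux / f] satisfies [r' = - k r - b cst - r^2] with [0 <= k <= m + 2] on [[1, 2]],
    and the hypothesis on [cst] yields [r' <= - (K^2 + r^2) / 2]. So [atan (r / K)] decreases at
    rate at least [K / 2], while its total change is less than PI. *)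
Lemma short_strip m al sg e K a L :
  e ^ 2 = 1 -> 0 < K -> ((INR m + 2) ^ 2 + K ^ 2) / 2 <= cst m al ->
  1 <= a -> 0 < L -> a + L <= 2 -> (forall s, a <= s <= a + L -> 0 < e * prof m al sg s) ->
  K * L < 2 * PI.
Proof.
intros He HK Hc Ha HL HaL Hpos.
pose proof (INR_pos m) as Hm. pose proof (beta_coef_bounds e He) as Hb. set (b := beta_coef e) in *.
set (r := fun s => flux m al sg s / prof m al sg s).
assert (Hne : forall s, a <= s <= a + L -> prof m al sg s <> 0).
{ intros s Hs E. specialize (Hpos s Hs). rewrite E in Hpos. lra. }
set (dr := fun s => (flux1 m al sg s * prof m al sg s - flux m al sg s * prof1 m al sg s) / prof m al sg s ^ 2).
assert (Hr : forall s, a <= s <= a + L -> is_derive r s (dr s)).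
{ intros s Hs. apply (is_derive_div (flux m al sg) (prof m al sg)).
  - apply flux_derive. lra.
  - apply prof_derive. lra.
  - now apply Hne. }
assert (Hdr : forall s, a <= s <= a + L -> dr s <= - (K ^ 2 + r s ^ 2) / 2).
{ intros s Hs. unfold dr.
  replace ((flux1 m al sg s * prof m al sg s - flux m al sg s * prof1 m al sg s) / prof m al sg s ^ 2)
    with (- (INR m / s + s * b / 2) * r s - cst m al * b - r s ^ 2).
  2: { rewrite flux1_flux, prof1_flux, (beta_coef_eq e) by (assumption || (try apply Rlt_le; try apply Hpos; lra)).
       fold b. unfold r. field. split; [lra | now apply Hne]. }
  assert (H1 : 0 <= INR m / s + s * b / 2 <= INR m + 2).
  { assert (0 <= INR m / s <= INR m).
    { split; [apply Rmult_le_pos; [assumption | left; apply Rinv_0_lt_compat; lra] |].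
      apply (Rmult_le_reg_r s); [lra |]. unfold Rdiv. rewrite Rmult_assoc, Rinv_l, Rmult_1_r by lra. nra. }
    nra. }
  set (k := INR m / s + s * b / 2) in *. assert (k ^ 2 <= (INR m + 2) ^ 2) by (apply pow_incr; lra).
  assert (cst m al <= cst m al * b).
  { assert (0 <= cst m al) by (pose proof (pow2_ge_0 (INR m + 2)); pose proof (pow2_ge_0 K); lra). nra. }
  pose proof (pow2_ge_0 (k + r s)). lra. }
destruct (derive_mean_value (fun s => atan (r s / K)) (fun s => / (1 + (r s / K) ^ 2) * (dr s / K)) a (a + L)) as (x & Hx & E).
- lra.
- intros x Hx. apply (continuous_fun_comp (fun s => r s / K) atan).
  + apply continuous_Rmult; [| apply continuous_const]. eapply continuous_of_derive. now apply Hr.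
  + eapply continuous_of_derive. apply is_derive_atan.
- intros x Hx. apply (is_derive_Rcomp (fun s => r s / K) atan).
  + evar_last; [apply is_derive_atan |]. unfold Rsqr. eqR. f_equal. simpl. ring.
  + evar_last; [apply is_derive_Rmult; [apply Hr; lra | apply is_derive_Rconst] |]. eqR. unfold Rdiv. ring.
- specialize (Hdr x ltac:(lra)).
  pose proof (atan_bound (r a / K)). pose proof (atan_bound (r (a + L) / K)).
  assert (Hder : / (1 + (r x / K) ^ 2) * (dr x / K) <= - K / 2).
  { replace (/ (1 + (r x / K) ^ 2) * (dr x / K)) with (K * (dr x / (K ^ 2 + r x ^ 2))).
    2: { pose proof (pow2_ge_0 (r x)). assert (0 < K ^ 2) by now apply pow_lt. field. repeat split; nra. }
    replace (- K / 2) with (K * (-1 / 2)) by field. apply Rmult_le_compat_l; [lra |].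
    assert (Hden : 0 < K ^ 2 + r x ^ 2) by (pose proof (pow2_ge_0 (r x)); assert (0 < K ^ 2) by (now apply pow_lt); lra).
    apply (Rmult_le_reg_r (K ^ 2 + r x ^ 2)); [assumption |].
    unfold Rdiv at 1. rewrite Rmult_assoc, Rinv_l, Rmult_1_r by lra. lra. }
  replace (a + L - a) with L in E by ring. nra.
Qed.

Lemma many_crossings m sg j : sg ^ 2 = 1 -> exists al, 0 <= al /\ crosses m al sg j.
Proof.
intros Hsg. pose proof (INR_pos m) as Hm. pose proof PI_RGT_0 as HPI.
pose proof (pos_INR j) as Hj.
(* [[1, 2]] holds [j + 1] steps of length [2 L]; [K] is then chosen so that [K L = 2 PI], which
   [short_strip] forbids. *)
set (L := / (2 * (INR j + 1))).
assert (HL : 0 < L) by (apply Rinv_0_lt_compat; lra).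
set (K := 2 * PI / L). assert (HK : 0 < K) by (apply Rdiv_lt_0_compat; lra).
set (al := (INR m + 2) ^ 2 + K ^ 2).
assert (Hal : 0 <= al) by (unfold al; pose proof (pow2_ge_0 (INR m + 2)); pose proof (pow2_ge_0 K); lra).
assert (Hc : ((INR m + 2) ^ 2 + K ^ 2) / 2 <= cst m al) by (unfold cst, al; lra).
exists al. split; [assumption |].
(* Only the first half of a step is fed to [short_strip]. The second half leaves room behind every
   [s <= a + L], so that a level merely touched there is strictly passed by [a + 2 L]. *)
assert (Hstep : forall i a, 1 <= a -> a + 2 * L <= 2 -> turn m al sg a < level i ->
   turn m al sg (a + 2 * L) < level (S i)).
{ intros i a Ha HaL Hlev.
  destruct (Rlt_le_dec (turn m al sg (a + 2 * L)) (level (S i))) as [|Hge]; [assumption | exfalso].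
  assert (K * L < 2 * PI).
  { apply (short_strip m al sg ((-1) ^ i * sg) K a L); try assumption; [now apply unit_sign_pow | lra |].
    intros s Hs. apply strip_sign; [assumption | lra |]. split.
    - destruct (Rlt_le_dec (level (S i)) (turn m al sg s)) as [|Hle]; [assumption | exfalso].
      pose proof (below_level_after m al sg (S i) s Hsg ltac:(lra) Hle (a + 2 * L - s) ltac:(lra)) as Hb.
      replace (s + (a + 2 * L - s)) with (a + 2 * L) in Hb by ring. lra.
    - apply (level_barrier m al sg i a); try assumption; lra. }
  assert (K * L = 2 * PI) by (unfold K; field; lra). lra. }
assert (HLj : 2 * L * (INR j + 1) = 1) by (unfold L; field; lra).
assert (H : forall i, (i <= j)%nat -> turn m al sg (1 + 2 * L * INR i) < level i).
{ induction i as [|i IH]; intros Hi.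
  - apply (level_barrier m al sg 0 0); [assumption | simpl; lra |].
    rewrite turn_0. unfold level. simpl. lra.
  - specialize (IH ltac:(lia)). pose proof (pos_INR i) as Hi0.
    assert (Hij : INR i + 1 <= INR j) by (rewrite <- S_INR; apply le_INR; lia).
    replace (1 + 2 * L * INR (S i)) with (1 + 2 * L * INR i + 2 * L) by (rewrite S_INR; ring).
    apply Hstep; try assumption; nra. }
exists (1 + 2 * L * INR j). split; [nra | now apply H].
Qed.

(** * The eigenvalues *)

Lemma average_const m k s : average m (fun _ => k) s = k / INR (S m).
Proof. exact (average_0 m (fun _ => k)). Qed.

Lemma prof_exponent_0 m sg s : 0 <= s -> prof m 0 sg s = sg.
Proof.
intros Hs. symmetry. unfold prof.
apply (profile_sol_unique m (cst m 0) sg (fun _ => sg) s); [intros; apply continuous_const | | lra].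
intros t Ht. rewrite (RInt_ext _ (fun _ => 0)).
- rewrite RInt_const. unfold scal; simpl; unfold mult; simpl. eqR. ring.
- intros x _. unfold slope. rewrite average_const. unfold cst. rewrite S_INR.
  pose proof (INR_pos m). eqR. field. lra.
Qed.

Lemma no_crossing_exponent_0 m sg : sg ^ 2 = 1 -> ~ crosses m 0 sg 1.
Proof.
intros Hsg (s & Hs & Hlev). pose proof PI_RGT_0 as HPI.
destruct (level_reached m 0 sg 1 0 s Hsg Hs) as (z & Hz & Ez).
{ rewrite turn_0. unfold level in *. simpl in *. lra. }
destruct (prof_at_level m 0 sg 1 z Hsg ltac:(lra) Ez) as [E _].
rewrite prof_exponent_0 in E by lra. apply (unit_sign_neq0 sg Hsg E).
Qed.

Lemma bounded_exponent_0 m sg : sg ^ 2 = 1 -> profile_growth_bounded 0 (prof m 0 sg).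
Proof.
intros Hsg. exists 1, 1. split; [lra |]. intros s Hs.
rewrite prof_exponent_0, Ropp_0, Rpower_O, Rmult_1_l by lra.
destruct (unit_sign sg Hsg) as [-> | ->].
- rewrite Rabs_R1. lra.
- rewrite Rabs_left; lra.
Qed.

Definition eigen (m : nat) (sg : R) (k : nat) (al : R) : Prop :=
  0 <= al /\ profile_growth_bounded al (prof m al sg) /\
  crosses m al sg k /\ ~ crosses m al sg (S k).

Lemma eigen_0 m sg : sg ^ 2 = 1 -> eigen m sg 0 0.
Proof.
intros Hsg. split; [lra |]. split; [now apply bounded_exponent_0 |].
split; [apply crosses_0 | now apply no_crossing_exponent_0].
Qed.

(* The supremum of the exponents whose profile has at most [k] zeros. *)
Lemma eigen_exists m sg k : sg ^ 2 = 1 -> exists al, eigen m sg k al.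
Proof.
intros Hsg.
set (P := fun al => 0 <= al /\ ~ crosses m al sg (S k)).
assert (HP0 : P 0).
{ split; [lra |]. intros H. apply (no_crossing_exponent_0 m sg Hsg).
  apply (crosses_le m 0 sg 1 (S k)); [lia | assumption]. }
destruct (many_crossings m sg (S k) Hsg) as (B & HB & HcB).
assert (HPdown : forall al al', P al' -> 0 <= al <= al' -> P al).
{ intros al al' [_ H] Hal. split; [lra |]. intros Hc. apply H.
  apply (crosses_monotone m al al'); try assumption; lra. }
destruct (completeness P) as [a [Hub Hlub]].
- exists B. intros al HPal. apply Rnot_lt_le. intros Hlt. apply (proj2 (HPdown B al HPal ltac:(lra)) HcB).
- now exists 0.
- assert (Ha : 0 <= a) by now apply Hub.
  (* Crossing is open in the exponent, so the supremum itself belongs to [P]. *)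
  assert (Hn : ~ crosses m a sg (S k)).
  { intros Hc. destruct (crosses_open m a sg (S k) Hsg Hc) as (d & Hd & Hnear).
    assert (a <= a - d / 2); [| lra].
    apply Hlub. intros al HPal. apply Rnot_lt_le. intros Hlt.
    pose proof (Hub al HPal). apply (proj2 HPal). apply Hnear. apply Rabs_def1; lra. }
  (* Every right neighbourhood of [a] contains exponents with more than [k] zeros. Were [a] not
     bounded, or its number of zeros below [k], one of the two stability lemmas would contradict
     this. *)
  assert (Habove : forall d, 0 < d -> ~ (forall al', a <= al' < a + d -> ~ crosses m al' sg (S k))).
  { intros d Hd Hall. assert (a + d / 2 <= a); [| lra]. apply Hub. split; [lra |]. apply Hall. lra. }
  exists a. split; [assumption |]. split; [| split; [| assumption]].
  + apply NNPP. intros Hunb.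
    destruct (unbounded_crossings_stable m a sg k Hsg Ha Hn Hunb) as (d & Hd & Hall).
    now apply (Habove d Hd).
  + apply NNPP. intros Hnk. destruct k as [|k].
    * apply Hnk, crosses_0.
    * destruct (crossings_upper_semicontinuous m a sg k Hsg Ha Hnk) as (d & Hd & Hall).
      now apply (Habove d Hd).
Qed.

Lemma eigen_increasing m sg k k' al al' :
  sg ^ 2 = 1 -> eigen m sg k al -> eigen m sg k' al' -> (k < k')%nat -> al < al'.
Proof.
intros Hsg (H0 & _ & _ & Hn) (H0' & _ & Hc & _) Hk.
destruct (Rlt_le_dec al al') as [|Hle]; [assumption | exfalso].
apply Hn. apply (crosses_le m al sg (S k) k'); [lia |].
now apply (crosses_monotone m al' al).
Qed.

Lemma eigen_unique m sg k al al' : sg ^ 2 = 1 -> eigen m sg k al -> eigen m sg k al' -> al = al'.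
Proof.
assert (H : forall al al', sg ^ 2 = 1 -> eigen m sg k al -> eigen m sg k al' -> ~ al < al').
{ intros a a' Hsg (H0 & Hb & Hc & _) (H0' & _ & _ & Hn') Hlt. apply Hn'.
  apply (bounded_gains_crossing m a a'); try assumption. lra. }
intros Hsg E1 E2. pose proof (H al al' Hsg E1 E2). pose proof (H al' al Hsg E2 E1). lra.
Qed.

Lemma eigen_positive m sg k al : sg ^ 2 = 1 -> eigen m sg k al -> (1 <= k)%nat -> 0 < al.
Proof.
intros Hsg E Hk. apply (eigen_increasing m sg 0 k); try assumption. now apply eigen_0.
Qed.

Lemma eigen_of_bounded m sg al :
  sg ^ 2 = 1 -> 0 < al -> profile_growth_bounded al (prof m al sg) ->
  exists k, (1 <= k)%nat /\ eigen m sg k al.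
Proof.
intros Hsg Hal Hb. destruct (finite_crossings m al sg Hsg ltac:(lra)) as [j Hj].
destruct (crossing_count m al sg j) as (i & _ & Hc & Hn).
{ intros H. apply Hj. apply (crosses_le m al sg j (S j)); [lia | assumption]. }
assert (E : eigen m sg i al) by (repeat split; try assumption; lra).
(* Index 0 belongs to the exponent 0 alone, and [al] is positive. *)
exists i. split; [| assumption]. destruct i; [| lia].
pose proof (eigen_unique m sg 0 al 0 Hsg E (eigen_0 m sg Hsg)). lra.
Qed.

Lemma eigen_unbounded m sg B : sg ^ 2 = 1 -> exists k, (1 <= k)%nat /\ forall al, eigen m sg k al -> B < al.
Proof.
intros Hsg. set (B' := Rmax B 0). pose proof (Rmax_l B 0) as H1. pose proof (Rmax_r B 0) as H2. fold B' in H1, H2.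
destruct (finite_crossings m B' sg Hsg H2) as [j Hj].
exists (S j). split; [lia |]. intros al (H0 & _ & Hc & _).
destruct (Rlt_le_dec B' al) as [|Hle]; [lra | exfalso].
apply Hj. apply (crosses_le m B' sg j (S j)); [lia |].
now apply (crosses_monotone m al B').
Qed.

(** At [al] the [- sg] profile has at most [k + 1] zeros, but if [al' < al] it would have gained one
    beyond its [k + 1] zeros at [al']; the case [al' = al] is [opposite_not_both_bounded]. *)
Lemma eigen_interlace m sg k al al' :
  sg ^ 2 = 1 -> eigen m sg k al -> eigen m (- sg) (S k) al' -> al < al'.
Proof.
intros Hsg (H0 & Hb & Hc & Hn) (H0' & Hb' & Hc' & Hn').
pose proof (unit_sign_opp sg Hsg) as Hsg'.
pose proof (opposite_crossings m al sg (S k) Hsg Hn) as Hno.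
destruct (Rlt_le_dec al al') as [|Hle]; [assumption | exfalso].
destruct (Rle_lt_or_eq_dec al' al Hle) as [Hlt | ->].
- apply Hno. apply (bounded_gains_crossing m al' al); try assumption. lra.
- now apply (opposite_not_both_bounded m al sg k).
Qed.

(** * The exponent 2 *)

Lemma average_quadratic m k1 k2 s :
  average m (fun t => k1 + k2 * t ^ 2) s = k1 / (INR m + 1) + k2 * s ^ 2 / (INR m + 3).
Proof.
pose proof (INR_pos m) as Hm. unfold average.
set (P := fun t : R => k1 / (INR m + 1) * t ^ S m + k2 * s ^ 2 / (INR m + 3) * t ^ S (S (S m))).
rewrite (is_RInt_unique _ 0 1 (P 1 - P 0)).
- unfold P. rewrite !pow1, !pow_i by lia. eqR. ring.
- apply (is_RInt_derive P (fun t => t ^ m * (k1 + k2 * (s * t) ^ 2))).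
  + intros x _. unfold P. evar_last.
    * apply is_derive_Rplus; apply is_derive_Rscal.
      -- apply (is_derive_pow (fun t => t) (S m)), is_derive_Rid.
      -- apply (is_derive_pow (fun t => t) (S (S (S m)))), is_derive_Rid.
    * eqR. rewrite !S_INR. simpl. field. lra.
  + intros x _. solve_continuous.
Qed.

Definition first_zero (m : nat) (sg : R) : R := sqrt (2 * (INR m + 1) / beta_coef sg).

Lemma first_zero_sq m sg : sg ^ 2 = 1 ->
  0 < first_zero m sg /\ first_zero m sg ^ 2 = 2 * (INR m + 1) / beta_coef sg.
Proof.
intros Hsg. pose proof (beta_coef_bounds sg Hsg). pose proof (INR_pos m).
assert (0 < 2 * (INR m + 1) / beta_coef sg) by (apply Rdiv_lt_0_compat; lra).
unfold first_zero. split; [now apply sqrt_lt_R0 |]. rewrite pow2_sqrt; lra.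
Qed.

Lemma prof_exponent_2 m sg s :
  sg ^ 2 = 1 -> 0 <= s <= first_zero m sg ->
  prof m 2 sg s = sg * (1 - beta_coef sg * s ^ 2 / (2 * (INR m + 1))).
Proof.
intros Hsg Hs. pose proof (beta_coef_bounds sg Hsg) as Hb. pose proof (INR_pos m) as Hm.
destruct (first_zero_sq m sg Hsg) as [Hz Hz2]. set (b := beta_coef sg) in *. set (z := first_zero m sg) in *.
symmetry. unfold prof.
set (g := fun s => sg * (1 - b * s ^ 2 / (2 * (INR m + 1)))).
assert (Hg : forall x, continuous g x) by (intros x; unfold g, Rdiv; solve_continuous).
apply (profile_sol_unique m (cst m 2) sg g z Hg); [| assumption].
intros t Ht.
assert (Hsign : forall x, 0 <= x <= z -> beta (g x) = b * g x).
{ intros x Hx. apply (beta_coef_eq sg); [assumption |]. unfold g.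
  replace (sg * (sg * (1 - b * x ^ 2 / (2 * (INR m + 1))))) with (sg ^ 2 * (1 - b * x ^ 2 / (2 * (INR m + 1)))) by ring.
  rewrite Hsg, Rmult_1_l.
  assert (x ^ 2 <= z ^ 2) by (apply pow_incr; lra).
  replace (1 - b * x ^ 2 / (2 * (INR m + 1))) with (b / (2 * (INR m + 1)) * (z ^ 2 - x ^ 2)) by (rewrite Hz2; field; lra).
  apply Rmult_le_pos; [left; apply Rdiv_lt_0_compat; lra | lra]. }
rewrite (RInt_ext _ (fun x => - (sg * b / (INR m + 1)) * x)).
- rewrite (is_RInt_unique _ 0 t (- (sg * b / (INR m + 1)) * t ^ 2 / 2 - - (sg * b / (INR m + 1)) * 0 ^ 2 / 2)).
  + unfold g. eqR. field. lra.
  + apply (is_RInt_derive (fun t => - (sg * b / (INR m + 1)) * t ^ 2 / 2) (fun x => - (sg * b / (INR m + 1)) * x)).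
    * intros x _. auto_derive; [trivial |]. eqR. field. lra.
    * intros x _. solve_continuous.
- intros x Hx. rewrite Rmin_left, Rmax_right in Hx by lra. eqR. unfold slope.
  rewrite (Hsign x) by lra.
  replace (average m (fun t => beta (g t)) x) with
    (average m (fun t => b * sg + - (b * sg * b / (2 * (INR m + 1))) * t ^ 2) x).
  + rewrite average_quadratic. unfold g, cst. field. lra.
  + unfold average. apply RInt_ext. intros y Hy. rewrite Rmin_left, Rmax_right in Hy by lra.
    rewrite (Hsign (x * y)) by nra. unfold g. eqR. field. lra.
Qed.

Lemma turn_first_zero m sg : sg ^ 2 = 1 -> turn m 2 sg (first_zero m sg) = level 1.
Proof.
intros Hsg. pose proof (beta_coef_bounds sg Hsg) as Hb. pose proof (INR_pos m) as Hm. pose proof PI_RGT_0 as HPI.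
destruct (first_zero_sq m sg Hsg) as [Hz Hz2].
pose proof (fun s => prof_exponent_2 m sg s Hsg) as Hp.
set (b := beta_coef sg) in *. set (z := first_zero m sg) in *.
assert (Hpz : prof m 2 sg z = 0).
{ rewrite Hp, Hz2 by lra. field. lra. }
assert (Hl0 : turn m 2 sg z < level 0).
{ apply (level_barrier m 2 sg 0 0); [assumption | lra |]. rewrite turn_0. unfold level. simpl. lra. }
destruct (Rtotal_order (turn m 2 sg z) (level 1)) as [Hlt | [E | Hgt]]; [exfalso | exact E | exfalso].
- destruct (level_reached m 2 sg 1 0 z Hsg) as (x & Hx & Ex); [lra | |].
  { rewrite turn_0. unfold level in *. simpl in *. lra. }
  destruct (prof_at_level m 2 sg 1 x Hsg ltac:(lra) Ex) as [E _].
  destruct (Rle_lt_or_eq_dec x z (proj2 Hx)) as [Hxz | ->]; [| lra].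
  rewrite Hp in E by lra. apply Rmult_integral in E.
  destruct E as [E | E]; [now apply (unit_sign_neq0 sg) |].
  assert (x ^ 2 < z ^ 2) by nra.
  replace (1 - b * x ^ 2 / (2 * (INR m + 1))) with (b / (2 * (INR m + 1)) * (z ^ 2 - x ^ 2)) in E by (rewrite Hz2; field; lra).
  assert (0 < b / (2 * (INR m + 1))) by (apply Rdiv_lt_0_compat; lra). nra.
- pose proof (strip_sign m 2 sg 0 z Hsg ltac:(lra) (conj Hgt Hl0)) as H. rewrite Hpz in H. lra.
Qed.

(** The opposite of the explicit solution for exponent 2. It solves the linear equation of slope [b]
    on the whole half-line and is positive past its zero, which makes it a comparison function
    beyond the first zero of the actual profile. *)
Definition quadratic (m : nat) (b s : R) : R := b * s ^ 2 / (2 * (INR m + 1)) - 1.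

Lemma quadratic_sturm_pair m b a :
  0 < a -> sturm_pair m b 2 (quadratic m b) (fun s => b * s / (INR m + 1)) (fun _ => b / (INR m + 1)) a.
Proof.
intros Ha. pose proof (INR_pos m) as Hm. split.
- intros s Hs. split.
  + unfold quadratic. auto_derive; [trivial |]. eqR. field. lra.
  + unfold Rdiv. solve_continuous.
- intros s Hs _. split.
  + auto_derive; [trivial |]. eqR. field. lra.
  + unfold quadratic. field. lra.
Qed.

Lemma quadratic_positive m e s : e ^ 2 = 1 -> first_zero m e < s -> 0 < quadratic m (beta_coef e) s.
Proof.
intros He Hs. pose proof (beta_coef_bounds e He) as Hb. pose proof (INR_pos m) as Hm.
destruct (first_zero_sq m e He) as [Hz Hz2]. unfold quadratic.
replace (beta_coef e * s ^ 2 / (2 * (INR m + 1)) - 1) with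
  (beta_coef e / (2 * (INR m + 1)) * (s ^ 2 - first_zero m e ^ 2)) by (rewrite Hz2; field; lra).
apply Rmult_lt_0_compat; [apply Rdiv_lt_0_compat; lra |]. nra.
Qed.

Lemma first_zero_order m : first_zero m (-1) < first_zero m 1.
Proof.
pose proof (INR_pos m) as Hm. unfold first_zero, beta_coef. apply sqrt_lt_1_alt. split.
- left. apply Rdiv_lt_0_compat; lra.
- replace ((3 - -1) / 2) with 2 by field. replace ((3 - 1) / 2) with 1 by field. lra.
Qed.

(** At exponent 2 the profile is negative just past [z = sqrt (2 N)], so its opposite is compared
    with the quadratic of slope 2, whose zero [sqrt N] comes earlier. Their Wronskian is negative at
    [z]; this forbids a second zero and also growth [O(s^2)]. The first fact excludes [al < 2],
    since a zero would have been gained, and the second excludes [al = 2]. *)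
Lemma eigen_1_positive_sign m al : eigen m 1 1 al -> 2 < al.
Proof.
intros (H0 & Hb & Hc & Hn). pose proof (INR_pos m) as Hm.
assert (Hsg : 1 ^ 2 = 1) by ring. assert (He : (-1) ^ 2 = 1) by ring.
set (z := first_zero m 1). destruct (first_zero_sq m 1 Hsg) as [Hz _]. fold z in Hz.
pose proof (first_zero_order m) as Hord. fold z in Hord.
pose proof (turn_first_zero m 1 Hsg) as Ht. fold z in Ht.
destruct (prof_at_level m 2 1 1 z Hsg ltac:(lra) Ht) as [Ep (X & HX & Ep1)].
assert (Hlt : forall s, z < s -> turn m 2 1 s < level 1).
{ intros s Hs. replace s with (z + (s - z)) by ring. apply below_level_after; try assumption; lra. }
set (b := beta_coef (-1)). assert (Hb1 : 1 <= b <= 2) by now apply beta_coef_bounds.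
set (Q1 := fun s => b * s / (INR m + 1)).
assert (Hq : forall s, z <= s -> 0 < quadratic m b s) by (intros; apply quadratic_positive; [assumption | lra]).
assert (HW : -1 * prof m 2 1 z * Q1 z - -1 * prof1 m 2 1 z * quadratic m b z < 0).
{ rewrite Ep, Ep1. specialize (Hq z ltac:(lra)). nra. }
assert (Hno : ~ crosses m 2 1 2).
{ intros (s & Hs & Hcr). rewrite level_S in Hcr. pose proof PI_RGT_0 as HPI.
  assert (Hzs : z < s).
  { destruct (Rlt_le_dec z s) as [|Hle]; [assumption |].
    pose proof (level_barrier m 2 1 1 s z Hsg ltac:(lra) ltac:(lra)). lra. }
  destruct (level_reached m 2 1 2 z s Hsg) as (t & Hzt & Et); [lra | rewrite level_S; lra |].
  destruct (prof_at_level m 2 1 2 t Hsg ltac:(lra) Et) as [Et0 (Y & HY & Et1)].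
  assert (Hztlt : z < t).
  { destruct (Rle_lt_or_eq_dec z t ltac:(lra)) as [|E]; [assumption |]. subst t. rewrite level_S in Et. lra. }
  pose proof (wronskian_nonincreasing m b 2 2 z t
    (fun s => -1 * prof m 2 1 s) (fun s => -1 * prof1 m 2 1 s) (fun s => -1 * prof2 m 2 1 (-1) s)
    (quadratic m b) Q1 (fun _ => b / (INR m + 1))) as Hw.
  assert (wronskian m b (fun s => -1 * prof m 2 1 s) (fun s => -1 * prof1 m 2 1 s) (quadratic m b) Q1 t <=
          wronskian m b (fun s => -1 * prof m 2 1 s) (fun s => -1 * prof1 m 2 1 s) (quadratic m b) Q1 z).
  { apply Hw; try lra.
    - now apply prof_sturm_pair.
    - now apply quadratic_sturm_pair.
    - intros x Hx. split; [| apply Hq; lra].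
      replace (-1) with ((-1) ^ 1 * 1) by ring. apply strip_sign; [assumption | lra |]. split; [| apply Hlt; lra].
      destruct (Rlt_le_dec (level 2) (turn m 2 1 x)) as [|Hle]; [assumption | exfalso].
      pose proof (below_level_after m 2 1 2 x Hsg ltac:(lra) Hle (t - x) ltac:(lra)) as Hbel.
      replace (x + (t - x)) with t in Hbel by ring. lra. }
  clear Hw. unfold wronskian in H. cbv beta in H.
  pose proof (sturm_weight_pos m b z). pose proof (sturm_weight_pos m b t).
  assert (0 < -1 * prof m 2 1 t * Q1 t - -1 * prof1 m 2 1 t * quadratic m b t).
  { rewrite Et0, Et1. specialize (Hq t ltac:(lra)). simpl. nra. }
  assert (0 < sturm_weight m b t * (-1 * prof m 2 1 t * Q1 t - -1 * prof1 m 2 1 t * quadratic m b t))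
    by now apply Rmult_lt_0_compat.
  nra. }
destruct (Rlt_le_dec 2 al) as [|Hle]; [assumption | exfalso].
destruct (Rle_lt_or_eq_dec al 2 Hle) as [Hlt2 | ->].
- apply Hno. apply (bounded_gains_crossing m al 2); try assumption. lra.
- destruct Hb as (M & S & HS & HM).
  apply (wronskian_contradiction m b 2 2 M S z
    (fun s => -1 * prof m 2 1 s) (fun s => -1 * prof1 m 2 1 s) (fun s => -1 * prof2 m 2 1 (-1) s)
    (quadratic m b) Q1 (fun _ => b / (INR m + 1))); try lra.
  + now apply prof_sturm_pair.
  + now apply quadratic_sturm_pair.
  + intros s Hs. split; [| apply Hq; lra].
    replace (-1) with ((-1) ^ 1 * 1) by ring. apply strip_sign; [assumption | lra |]. split; [| now apply Hlt].
    apply not_crosses_above; try assumption. lra.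
  + now apply signed_bound.
Qed.

(** If [al >= 2], monotonicity leaves the profile of exponent 2 with one zero, at [sqrt N], and
    positive afterwards. The function that is [O(s^2)] is now the quadratic of slope 1; at its zero
    [sqrt (2 N)] the profile is already positive, so the Wronskian is negative and the profile could
    not stay positive. *)
Lemma eigen_1_negative_sign m al : eigen m (-1) 1 al -> al < 2.
Proof.
intros (H0 & Hb & Hc & Hn). pose proof (INR_pos m) as Hm.
assert (Hsg : (-1) ^ 2 = 1) by ring. assert (He : 1 ^ 2 = 1) by ring.
set (z := first_zero m (-1)). destruct (first_zero_sq m (-1) Hsg) as [Hz _]. fold z in Hz.
set (a := first_zero m 1). destruct (first_zero_sq m 1 He) as [Ha Ha2]. fold a in Ha, Ha2.
pose proof (first_zero_order m) as Hord. fold z a in Hord.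
pose proof (turn_first_zero m (-1) Hsg) as Ht. fold z in Ht.
destruct (Rlt_le_dec al 2) as [|Hle]; [assumption | exfalso].
assert (Hn2 : ~ crosses m 2 (-1) 2).
{ intros H. apply Hn. now apply (crosses_monotone m 2 al). }
set (b := beta_coef 1). assert (Hb1 : b = 1) by (unfold b, beta_coef; field).
assert (Hpos : forall s, z < s -> 0 < 1 * prof m 2 (-1) s).
{ intros s Hs. replace 1 with ((-1) ^ 1 * -1) at 1 by ring. apply strip_sign; [assumption | lra |]. split.
  - apply not_crosses_above; try assumption. lra.
  - replace s with (z + (s - z)) by ring. apply below_level_after; try assumption; lra. }
apply (wronskian_contradiction m b 2 2 1 1 a
  (quadratic m b) (fun s => b * s / (INR m + 1)) (fun _ => b / (INR m + 1))
  (fun s => 1 * prof m 2 (-1) s) (fun s => 1 * prof1 m 2 (-1) s) (fun s => 1 * prof2 m 2 (-1) 1 s)); try lra.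
- now apply quadratic_sturm_pair.
- now apply prof_sturm_pair.
- intros s Hs. split; [now apply quadratic_positive | apply Hpos; lra].
- assert (E : quadratic m b a = 0).
  { unfold quadratic. rewrite Ha2. fold b. rewrite Hb1. field. lra. }
  rewrite E. specialize (Hpos a Hord).
  assert (0 < b * a / (INR m + 1)) by (rewrite Hb1; apply Rdiv_lt_0_compat; lra). nra.
- intros s Hs. rewrite Rpower_Ropp. replace 2 with (INR 2) by (simpl; ring).
  rewrite Rpower_pow by lra. unfold quadratic. rewrite Hb1.
  assert (Hs2 : 0 < s ^ 2) by (apply pow_lt; lra).
  apply (Rmult_le_reg_l (s ^ 2)); [assumption |]. rewrite <- Rmult_assoc, Rinv_r, Rmult_1_l by lra.
  assert (/ (2 * (INR m + 1)) <= 1).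
  { rewrite <- Rinv_1. apply Rinv_le_contravar; lra. }
  unfold Rdiv. nra.
Qed.

(** * Profiles *)

Lemma is_derive_of_D_in (f f1 : R -> R) s :
  0 < s -> D_in f f1 (fun y => 0 <= y) s -> is_derive f s (f1 s).
Proof.
intros Hs H. apply is_derive_Reals. intros eps Heps.
destruct (H eps Heps) as (d & Hd & Hlim).
assert (Hr : 0 < Rmin d s) by (apply Rmin_glb_lt; lra).
exists (mkposreal _ Hr). simpl. intros h Hh0 Hh.
pose proof (Rmin_l d s). pose proof (Rmin_r d s).
assert (Hhd := Hh). apply Rabs_def2 in Hhd.
specialize (Hlim (s + h)). simpl in Hlim. unfold R_dist in Hlim.
replace (s + h - s) with h in Hlim by ring. apply Hlim. split; [| lra].
split; [lra | lra].
Qed.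

Lemma D_in_of_is_derive (f f1 g : R -> R) s :
  0 <= s -> (forall y, 0 <= y -> f y = g y) -> is_derive g s (f1 s) ->
  D_in f f1 (fun y => 0 <= y) s.
Proof.
intros Hs Hfg H. apply is_derive_Reals in H. intros eps Heps.
destruct (H eps Heps) as [d Hd]. exists d. split; [apply cond_pos |].
intros x [[Hx Hne] Hdist]. simpl in *. unfold R_dist in *.
specialize (Hd (x - s) ltac:(lra) Hdist).
replace (s + (x - s)) with x in Hd by ring. now rewrite !Hfg.
Qed.

Lemma continuous_abs_of_D_in (f f1 : R -> R) :
  (forall s, 0 <= s -> D_in f f1 (fun y => 0 <= y) s) ->
  forall x, continuous (fun s => f (Rabs s)) x.
Proof.
intros H x. apply continuous_eps. intros e He.
pose proof (cont_deriv f f1 _ (Rabs x) (H (Rabs x) (Rabs_pos x))) as Hc.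
destruct (Hc e He) as (d & Hd & Hlim). exists d. split; [assumption |].
intros y Hy. destruct (Req_dec (Rabs y) (Rabs x)) as [-> | Hne].
- rewrite Rminus_diag, Rabs_R0. assumption.
- apply (Hlim (Rabs y)). split.
  + split; [apply Rabs_pos | auto].
  + simpl. unfold R_dist. eapply Rle_lt_trans; [apply Rabs_triang_inv2 | exact Hy].
Qed.

Lemma derive_nonzero_isolated (f : R -> R) s l :
  is_derive f s l -> l <> 0 -> f s = 0 ->
  exists d, 0 < d /\ forall y : R, y <> s -> Rabs (y - s) < d -> f y <> 0.
Proof.
intros H Hl Hf. apply is_derive_Reals in H.
destruct (H (Rabs l) (Rabs_pos_lt l Hl)) as [d Hd]. exists d. split; [apply cond_pos |].
intros y Hy Hys E. specialize (Hd (y - s) ltac:(lra) Hys).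
replace (s + (y - s)) with y in Hd by ring. rewrite E, Hf in Hd.
replace ((0 - 0) / (y - s) - l) with (- l) in Hd by (field; lra).
rewrite Rabs_Ropp in Hd. lra.
Qed.

Lemma derive_zero_isolated (H : R -> R) s d :
  0 < d -> (forall x, continuous H x) ->
  (forall y : R, y <> s -> Rabs (y - s) < d -> is_derive H y 0) -> is_derive H s 0.
Proof.
intros Hd Hc Hder.
apply (is_derive_ext_loc (fun _ => H s)); [| apply is_derive_Rconst].
exists (mkposreal d Hd). intros y Hy. assert (Hys : Rabs (y - s) < d) by exact Hy.
apply Rabs_def2 in Hys. destruct (Rle_lt_dec y s).
- apply (constant_of_derive H y s); [assumption | intros; apply Hc |].
  intros x Hx. apply Hder; [lra | apply Rabs_def1; lra].
- symmetry. apply (constant_of_derive H s y); [lra | intros; apply Hc |].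
  intros x Hx. apply Hder; [lra | apply Rabs_def1; lra].
Qed.

Lemma slope_ext m c f g s :
  (forall x, continuous f x) -> (forall x, continuous g x) -> 0 <= s ->
  (forall t, 0 <= t <= s -> f t = g t) -> slope m c f s = slope m c g s.
Proof.
intros Hf Hg Hs H. apply Rminus_diag_uniq, Rabs_eq_0.
apply Rle_antisym; [| apply Rabs_pos].
replace 0 with (s * (1 + 2 * Rabs c) * 0) by ring.
apply slope_diff_bound; try assumption.
intros t Ht. rewrite H, Rminus_diag, Rabs_R0 by assumption. lra.
Qed.

Definition profile_equation (m : nat) (al : R) (f f1 f2 : R -> R) : Prop :=
  forall e s, e ^ 2 = 1 -> 0 < s -> 0 < e * f s ->
    is_derive f1 s (f2 s) /\
    f2 s + (INR m / s - beta_coef e * s / 2) * f1 s + beta_coef e * al / 2 * f s = 0.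

(* As long as [f] and [f'] do not vanish together, the zeros of [f] are isolated,
   and the integrated equation extends across them by continuity. *)
Lemma profile_integrates m al (f f1 f2 : R -> R) M :
  (forall x, continuous f x) -> (forall x, continuous f1 x) ->
  (forall s, 0 < s -> is_derive f s (f1 s)) -> f1 0 = 0 ->
  profile_equation m al f f1 f2 ->
  (forall s, 0 <= s < M -> f s <> 0 \/ f1 s <> 0) ->
  forall s, 0 <= s <= M -> f s = prof m al (f 0) s /\ f1 s = prof1 m al (f 0) s.
Proof.
intros Cf Cf1 Hd Hf10 Heq Hnd.
set (c := cst m al).
assert (Cb : forall x, continuous (fun t => beta (f t)) x) by (intros; now apply continuous_beta_comp).
(* Off the zeros of [f], the profile equation times [s^m] says that [H] has derivative 0. [H]
   involves no [f''] and is continuous, hence can be followed across isolated zeros. *)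
set (H := fun s => s ^ m * f1 s - s ^ S m * (beta (f s) / 2) + c * RInt (fun t => t ^ m * beta (f t)) 0 s).
assert (Ci : forall x, continuous (fun t => t ^ m * beta (f t)) x).
{ intros x. apply continuous_Rmult; [solve_continuous | apply Cb]. }
assert (CH : forall x, continuous H x).
{ intros x. unfold H. apply continuous_Rplus; [apply continuous_Rminus |]; apply continuous_Rmult.
  - solve_continuous.
  - apply Cf1.
  - solve_continuous.
  - apply (continuous_Rmult (fun s => beta (f s)) (fun _ => / 2)); [apply Cb | apply continuous_const].
  - apply continuous_const.
  - apply (continuous_of_derive (fun s => RInt (fun t => t ^ m * beta (f t)) 0 s) x (x ^ m * beta (f x))).
    now apply (is_derive_RInt_all (fun t => t ^ m * beta (f t))). }
assert (Hreg : forall s, 0 < s -> f s <> 0 -> is_derive H s 0).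
{ intros s Hs Hne.
  assert (Hsgn : exists e, e ^ 2 = 1 /\ 0 < e * f s).
  { destruct (Rlt_le_dec 0 (f s)); [exists 1 | exists (-1)]; lra. }
  destruct Hsgn as (e & He & Hpos). destruct (Heq e s He Hs Hpos) as [D2 E].
  set (b := beta_coef e) in *.
  assert (Dpow : forall k, is_derive (fun s : R => s ^ k) s (INR k * s ^ k / s)).
  { intros k. evar_last; [apply (is_derive_pow (fun s => s) k), is_derive_Rid |]. eqR.
    destruct k as [|k]; [simpl; field; lra |]. change (Nat.pred (S k)) with k. simpl pow. field. lra. }
  assert (Dbeta : is_derive (fun s => beta (f s) / 2) s (b / 2 * f1 s)).
  { apply (is_derive_ext_loc (fun y => b / 2 * f y)).
    - generalize (locally_positive (fun y => e * f y) s ltac:(solve_continuous) Hpos).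
      apply filter_imp. intros y Hy. rewrite (beta_coef_eq e) by (assumption || lra). fold b. eqR. field.
    - apply is_derive_Rscal. now apply Hd. }
  unfold H. evar_last.
  - apply is_derive_Rplus; [apply is_derive_Rminus; apply is_derive_Rmult; [apply Dpow | exact D2 | apply Dpow | exact Dbeta] |].
    apply is_derive_Rscal. now apply (is_derive_RInt_all (fun t => t ^ m * beta (f t))).
  - eqR. rewrite (beta_coef_eq e) by (assumption || lra). fold b.
    replace (f2 s) with (- (INR m / s - b * s / 2) * f1 s - b * al / 2 * f s) by lra.
    unfold c, cst. rewrite S_INR. simpl pow. field. lra. }
assert (HH : forall s, 0 < s < M -> is_derive H s 0).
{ intros s Hs. destruct (Req_dec (f s) 0) as [E | Hne]; [| apply Hreg; [lra | assumption]].
  destruct (Hnd s ltac:(lra)) as [Hne | Hne]; [contradiction |].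
  destruct (derive_nonzero_isolated f s (f1 s) (Hd s ltac:(lra)) Hne E) as (d & Hdpos & Hiso).
  apply (derive_zero_isolated H s (Rmin d s)); [apply Rmin_glb_lt; lra | assumption |].
  intros y Hy Hys. pose proof (Rmin_l d s). pose proof (Rmin_r d s).
  apply Hreg; [apply Rabs_def2 in Hys; lra | apply Hiso; [assumption | lra]]. }
assert (H0 : H 0 = 0).
{ unfold H. rewrite RInt_point, Hf10. unfold zero; simpl. ring. }
assert (Hf1 : forall s, 0 <= s <= M -> f1 s = slope m c f s).
{ intros s Hs. unfold slope. destruct (Rle_lt_or_eq_dec 0 s (proj1 Hs)) as [Hpos | <-]; [| rewrite Hf10; ring].
  assert (E : H s = 0).
  { rewrite <- H0. apply (constant_of_derive H 0 s); [lra | intros; apply CH |]. intros x Hx. apply HH. lra. }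
  unfold H in E. rewrite <- average_primitive in E by exact Cb.
  assert (Hp : s ^ m <> 0) by (apply pow_nonzero; lra).
  apply (Rmult_eq_reg_l (s ^ m)); [| assumption]. simpl pow in E. lra. }
assert (Cs : forall x, continuous (slope m c f) x) by (intros; now apply slope_continuous).
assert (Hfp : forall s, 0 <= s <= M -> f s = prof m al (f 0) s).
{ apply (profile_sol_unique m c (f 0) f M Cf). intros s Hs.
  assert (E : f s - RInt (slope m c f) 0 s = f 0 - RInt (slope m c f) 0 0).
  { apply (constant_of_derive (fun s => f s - RInt (slope m c f) 0 s) 0 s); [lra | |].
    - intros x _. apply continuous_Rminus; [apply Cf |]. eapply continuous_of_derive. now apply (is_derive_RInt_all (slope m c f)).
    - intros x Hx. rewrite <- (Rminus_diag (f1 x)). rewrite (Hf1 x) at 2 by lra.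
      apply is_derive_Rminus; [apply Hd; lra | now apply is_derive_RInt_all]. }
  rewrite RInt_point in E. unfold zero in E; simpl in E. lra. }
intros s Hs. split; [now apply Hfp |].
rewrite Hf1 by assumption. apply slope_ext; [assumption | apply prof_continuous | lra |].
intros t Ht. apply Hfp. lra.
Qed.

Lemma prof_nondegenerate m al sg s :
  sg <> 0 -> 0 <= s -> prof m al sg s <> 0 \/ prof1 m al sg s <> 0.
Proof.
intros Hsg Hs. pose proof (energy_pos m al sg s Hsg Hs) as He. unfold energy in He.
destruct (Req_dec (prof m al sg s) 0) as [E | ]; [| now left]. right.
rewrite prof1_flux, E, beta_nonneg by lra. intros E1. rewrite E in He.
assert (flux m al sg s = 0) by lra. rewrite H in He. lra.
Qed.

(** [profile_integrates] presupposes that [f] and [f'] do not vanish together, which is known only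
    for [prof]. Continuous induction closes the circle: nondegeneracy on [[0, t)] gives agreement
    with [prof] up to and including [t], and there [energy_pos] applies. *)
Lemma profile_is_prof m al f :
  is_profile (S m) al f -> forall s, 0 <= s -> f s = prof m al (f 0) s.
Proof.
intros (f1 & f2 & [HD HL] & Hf0 & Hf10 & Hneg & Hpos).
assert (Cf := continuous_abs_of_D_in f f1 HD).
assert (Cf1 : forall x, continuous (fun s => f1 (Rabs s)) x).
{ intros x. apply continuous_eps. intros e He.
  destruct (HL (Rabs x + 1)) as [L HLip]; [pose proof (Rabs_pos x); lra |].
  set (L' := Rabs L + 1). assert (HL' : 0 < L') by (unfold L'; pose proof (Rabs_pos L); lra).
  exists (Rmin 1 (e / L')). split; [apply Rmin_glb_lt; [lra | now apply Rdiv_lt_0_compat] |].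
  intros y Hy. pose proof (Rmin_l 1 (e / L')). pose proof (Rmin_r 1 (e / L')).
  assert (Hyx : Rabs y <= Rabs x + 1).
  { replace y with (x + (y - x)) by ring. eapply Rle_trans; [apply Rabs_triang |]. lra. }
  pose proof (Rabs_pos x). pose proof (Rabs_pos y).
  eapply Rle_lt_trans; [apply HLip; lra |].
  pose proof (Rle_abs L). pose proof (Rabs_triang_inv2 y x) as Htri.
  pose proof (Rabs_pos (Rabs y - Rabs x)).
  apply Rle_lt_trans with (L' * Rabs (y - x)).
  { apply Rle_trans with (L' * Rabs (Rabs y - Rabs x)).
    - apply Rmult_le_compat_r; [assumption | unfold L'; lra].
    - apply Rmult_le_compat_l; [lra | exact Htri]. }
  apply Rlt_le_trans with (L' * (e / L')); [apply Rmult_lt_compat_l; lra |].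
  right. field. lra. }
(* The values of [f] at negative arguments are arbitrary; the even extension is continuous on the
   whole line, as the integral lemmas require. *)
set (g := fun s => f (Rabs s)) in *. set (g1 := fun s => f1 (Rabs s)) in *.
assert (Hg0 : g 0 = f 0) by (unfold g; now rewrite Rabs_R0).
assert (Habs : forall s, 0 < s -> locally s (fun y => Rabs y = y)).
{ intros s Hs. generalize (positive_near s Hs). apply filter_imp. intros y Hy. apply Rabs_pos_eq. lra. }
assert (Hder : forall (h h1 : R -> R) (s : R), 0 < s -> is_derive h s (h1 s) ->
   is_derive (fun y => h (Rabs y)) s (h1 (Rabs s))).
{ intros h h1 s Hs Dh. replace (h1 (Rabs s)) with (h1 s) by (rewrite Rabs_pos_eq; [reflexivity | lra]).
  apply (is_derive_ext_loc h); [| exact Dh].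
  generalize (Habs s Hs). apply filter_imp. now intros y ->. }
assert (Heq : profile_equation m al g g1 (fun s => f2 (Rabs s))).
{ intros e s He Hs Hsgn. rewrite S_INR in Hneg, Hpos.
  unfold g, g1 in *. rewrite (Rabs_pos_eq s) in Hsgn |- * by lra.
  unfold beta_coef. destruct (unit_sign e He) as [-> | ->].
  - destruct (Hpos s Hs ltac:(lra)) as [D E]. split.
    + rewrite <- (Rabs_pos_eq s) at 2 by lra. now apply (Hder f1 f2).
    + rewrite <- E. field. lra.
  - destruct (Hneg s Hs ltac:(lra)) as [D E]. split.
    + rewrite <- (Rabs_pos_eq s) at 2 by lra. now apply (Hder f1 f2).
    + rewrite <- E. field. lra. }
assert (Dg : forall s, 0 < s -> is_derive g s (g1 s)).
{ intros s Hs. apply (Hder f f1); [assumption |]. apply is_derive_of_D_in; [assumption | apply HD; lra]. }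
assert (Hg10 : g1 0 = 0) by (unfold g1; now rewrite Rabs_R0).
pose proof (fun M => profile_integrates m al g g1 _ M Cf Cf1 Dg Hg10 Heq) as Hint. rewrite Hg0 in Hint.
assert (Hnd : forall s, 0 <= s -> 0 < g s * g s + g1 s * g1 s).
{ apply positive_persists.
  - intros s _. apply continuous_Rplus; apply continuous_Rmult; auto.
  - rewrite Hg0, Hg10. nra.
  - intros t Ht Hbefore. destruct (Hint t) with (s := t) as [-> ->]; [| lra |].
    + intros s Hs. specialize (Hbefore s Hs). simpl in Hbefore.
      destruct (Req_dec (g s) 0) as [E | ]; [| now left]. right. intros E1. rewrite E, E1 in Hbefore. lra.
    + destruct (prof_nondegenerate m al (f 0) t Hf0 ltac:(lra)); nra. }
intros s Hs. rewrite <- (Rabs_pos_eq s Hs) at 1. change (f (Rabs s)) with (g s).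
apply (Hint s); [| lra]. intros t Ht. specialize (Hnd t (proj1 Ht)). simpl in Hnd.
destruct (Req_dec (g t) 0) as [E | ]; [| now left]. right. intros E1. rewrite E, E1 in Hnd. lra.
Qed.

Lemma lipschitz_of_derive (f df : R -> R) M B :
  (forall x, continuous f x) -> (forall x, 0 < x -> is_derive f x (df x)) ->
  (forall x, 0 <= x <= M -> Rabs (df x) <= B) ->
  forall s r, 0 <= s <= M -> 0 <= r <= M -> Rabs (f s - f r) <= B * Rabs (s - r).
Proof.
intros Hc Hd HB.
assert (H : forall s r, 0 <= s <= M -> 0 <= r <= M -> s < r -> Rabs (f s - f r) <= B * Rabs (s - r)).
{ intros s r Hs Hr Hsr. destruct (derive_mean_value f df s r Hsr) as (x & Hx & E).
  - intros; apply Hc.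
  - intros x Hx. apply Hd. lra.
  - rewrite (Rabs_minus_sym (f s)), E, Rabs_mult, (Rabs_minus_sym s).
    apply Rmult_le_compat_r; [apply Rabs_pos | apply HB; lra]. }
intros s r Hs Hr. destruct (Rtotal_order s r) as [Hlt | [-> | Hgt]].
- now apply H.
- rewrite !Rminus_diag, Rabs_R0. lra.
- rewrite (Rabs_minus_sym (f s)), (Rabs_minus_sym s). now apply H.
Qed.

Lemma prof_is_profile m al sg : sg <> 0 -> is_profile (S m) al (prof m al sg).
Proof.
intros Hsg.
(* At the zeros of [f] the second branch is an arbitrary value, since the definition constrains [f2]
   only off them. *)
exists (prof1 m al sg), (fun s => if Rlt_dec (prof m al sg s) 0 then prof2 m al sg (-1) s else prof2 m al sg 1 s).
split; [split |].
- intros s Hs. apply (D_in_of_is_derive _ _ (fun s => sg + RInt (prof1 m al sg) 0 s)); [assumption | apply prof_integral |].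
  rewrite <- (Rplus_0_l (prof1 m al sg s)).
  apply is_derive_Rplus; [apply is_derive_Rconst | apply is_derive_RInt_all, prof1_continuous].
- intros M HM.
  destruct (continuous_bounded _ M (prof_continuous m al sg)) as (B0 & HB0 & H0).
  destruct (continuous_bounded _ M (prof1_continuous m al sg)) as (B1 & HB1 & H1).
  destruct (continuous_bounded _ M (flux1_continuous m al sg)) as (B2 & HB2 & H2).
  (* [f'] need not be differentiable at a zero of [f], so its Lipschitz constant is read off from
     [f' = s beta(f) / 2 + flux]: [B0] and [B1] bound [f] and [f'], and [B2] bounds the derivative
     of the flux. *)
  exists ((M * (2 * B1) + 2 * B0) / 2 + B2). intros s r Hs Hr.
  pose proof (lipschitz_of_derive _ _ M B1 (prof_continuous m al sg) (prof_derive m al sg) H1 s r Hs Hr) as L1.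
  pose proof (lipschitz_of_derive _ _ M B2 (flux_continuous m al sg) (flux_derive m al sg) H2 s r Hs Hr) as L2.
  rewrite !prof1_flux.
  assert (L3 : Rabs (s * beta (prof m al sg s) - r * beta (prof m al sg r)) <=
     M * (2 * (B1 * Rabs (s - r))) + 2 * B0 * Rabs (s - r)).
  { apply product_lipschitz.
    - rewrite Rabs_pos_eq; lra.
    - pose proof (beta_bound (prof m al sg r)). specialize (H0 r Hr). simpl in H0. lra.
    - lra.
    - pose proof (beta_lipschitz (prof m al sg s) (prof m al sg r)). lra. }
  replace (s * beta (prof m al sg s) / 2 + flux m al sg s - (r * beta (prof m al sg r) / 2 + flux m al sg r))
    with ((s * beta (prof m al sg s) - r * beta (prof m al sg r)) * / 2 + (flux m al sg s - flux m al sg r)) by field.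
  eapply Rle_trans; [apply Rabs_triang |]. rewrite Rabs_mult, (Rabs_pos_eq (/ 2)) by lra. lra.
- rewrite prof_0, prof1_0. split; [assumption |]. split; [reflexivity |].
  rewrite S_INR. split; intros s Hs Hsgn.
  + destruct Rlt_dec; [| lra]. split; [apply prof1_derive; lra |].
    unfold prof2, beta_coef. field. lra.
  + destruct Rlt_dec; [lra |]. split; [apply prof1_derive; lra |].
    unfold prof2, beta_coef. field. lra.
Qed.

(** * From eigenvalues to solutions *)

Lemma changes_sign_ext f g j :
  (forall s, 0 <= s -> f s = g s) -> changes_sign_at_least f j -> changes_sign_at_least g j.
Proof.
intros Hfg (s & Hs0 & Hs). exists s. split; [assumption |].
assert (Hnonneg : forall i, (i <= j)%nat -> 0 <= s i).
{ induction i as [|i IH]; intros Hi; [assumption |].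
  specialize (IH ltac:(lia)). destruct (Hs i ltac:(lia)). lra. }
intros i Hi. rewrite <- !Hfg by (apply Hnonneg; lia). now apply Hs.
Qed.

Lemma changes_sign_exactly_ext f g j :
  (forall s, 0 <= s -> f s = g s) -> changes_sign_exactly f j -> changes_sign_exactly g j.
Proof.
intros Hfg [H1 H2]. split.
- now apply (changes_sign_ext f).
- intros H. apply H2. apply (changes_sign_ext g); [| assumption]. intros s Hs. symmetry. now apply Hfg.
Qed.

Lemma growth_bounded_ext al f g :
  (forall s, 0 <= s -> f s = g s) -> profile_growth_bounded al f -> profile_growth_bounded al g.
Proof.
intros Hfg (M & S & HS & H). exists M, S. split; [assumption |].
intros s Hs. rewrite <- Hfg by lra. now apply H.
Qed.

Lemma euclid_norm_zero N : euclid_norm (Vector.const 0 N) = 0.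
Proof.
unfold euclid_norm.
replace (Vector.fold_right (fun a s => a ^ 2 + s) (Vector.const 0 N) 0) with 0; [apply sqrt_0 |].
induction N as [|N IH]; [reflexivity |].
transitivity (0 ^ 2 + Vector.fold_right (fun a s => a ^ 2 + s) (Vector.const 0 N) 0); [rewrite <- IH; ring | reflexivity].
Qed.

Lemma solution_at_origin N al f w :
  radial_homogeneous_solution N al f w -> w (Vector.const 0 N) (-1) = f 0.
Proof.
intros [_ Hw]. rewrite Hw by lra. replace (- -1) with 1 by ring. rewrite euclid_norm_zero, sqrt_1.
unfold Rpower. rewrite ln_1, Rmult_0_r, exp_0. unfold Rdiv. rewrite Rmult_0_l. ring.
Qed.

Lemma solution_exists_iff_eigen m al sg :
  sg ^ 2 = 1 -> 0 < al ->
  (exists (w : Vector.t R (S m) -> R -> R) f,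
     locally_bounded_solution (S m) al f w /\ w (Vector.const 0 (S m)) (-1) = sg) <->
  (exists k, (1 <= k)%nat /\ eigen m sg k al).
Proof.
intros Hsg Hal. split.
- intros (w & f & [Hsol Hb] & Hw). rewrite (solution_at_origin _ _ _ _ Hsol) in Hw.
  apply eigen_of_bounded; [assumption | assumption |].
  apply (growth_bounded_ext al f); [| assumption]. rewrite <- Hw. apply profile_is_prof, Hsol.
- intros (k & _ & _ & Hb & _).
  set (w := fun (x : Vector.t R (S m)) t =>
    Rpower (- t) (al / 2) * prof m al sg (euclid_norm x / sqrt (- t))).
  assert (Hsol : radial_homogeneous_solution (S m) al (prof m al sg) w).
  { split; [apply prof_is_profile; now apply unit_sign_neq0 | reflexivity]. }
  exists w, (prof m al sg). split; [now split |].
  rewrite (solution_at_origin _ _ _ _ Hsol). apply prof_0.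
Qed.

Lemma eigen_sign_changes m sg k al f w :
  sg ^ 2 = 1 -> eigen m sg k al -> locally_bounded_solution (S m) al f w -> f 0 = sg ->
  changes_sign_exactly f k.
Proof.
intros Hsg (_ & _ & Hc & Hn) [[Hprof _] _] Hf0.
apply (changes_sign_exactly_ext (prof m al sg)).
- intros s Hs. rewrite <- Hf0. symmetry. now apply profile_is_prof.
- now apply changes_sign_exactly_crosses.
Qed.

Theorem theorem1p1 (N : nat) (hN : (1 <= N)%nat) :
  exists ap am : nat -> R,
    (forall k, (1 <= k)%nat -> 0 < ap k /\ 0 < am k) /\
    (* (i) *)
    (forall alpha, 0 < alpha ->
       ((exists (w : Vector.t R N -> R -> R) (f : R -> R),
           locally_bounded_solution N alpha f w /\
           w (Vector.const 0 N) (-1) = 1) <->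
        (exists k, (1 <= k)%nat /\ alpha = ap k)) /\
       ((exists (w : Vector.t R N -> R -> R) (f : R -> R),
           locally_bounded_solution N alpha f w /\
           w (Vector.const 0 N) (-1) = -1) <->
        (exists k, (1 <= k)%nat /\ alpha = am k))) /\
    (* (ii) *)
    (forall k, (1 <= k)%nat ->
       (forall (w : Vector.t R N -> R -> R) (f : R -> R),
          locally_bounded_solution N (ap k) f w ->
          f 0 = 1 -> changes_sign_exactly f k) /\
       (forall (w : Vector.t R N -> R -> R) (f : R -> R),
          locally_bounded_solution N (am k) f w ->
          f 0 = -1 -> changes_sign_exactly f k)) /\
    (* (iii) *)
    (forall k, (1 <= k)%nat -> ap k < ap (k + 1)%nat /\ am k < am (k + 1)%nat) /\
    (forall B, (exists k, (1 <= k)%nat /\ B < ap k) /\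
               (exists k, (1 <= k)%nat /\ B < am k)) /\
    (* (iv) *)
    (0 < am 1%nat /\ am 1%nat < 2 /\ 2 < ap 1%nat) /\
    (* (v) *)
    (forall k, (1 <= k)%nat ->
       am k < ap (k + 1)%nat /\ ap (k + 1)%nat < am (k + 2)%nat).
Proof.
destruct N as [|m]; [lia |].
assert (Hp : 1 ^ 2 = 1) by ring. assert (Hm : (-1) ^ 2 = 1) by ring.
set (ap := fun k => proj1_sig (constructive_indefinite_description _ (eigen_exists m 1 k Hp))).
set (am := fun k => proj1_sig (constructive_indefinite_description _ (eigen_exists m (-1) k Hm))).
assert (Ep : forall k, eigen m 1 k (ap k)).
{ intros k. exact (proj2_sig (constructive_indefinite_description _ (eigen_exists m 1 k Hp))). }
assert (Em : forall k, eigen m (-1) k (am k)).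
{ intros k. exact (proj2_sig (constructive_indefinite_description _ (eigen_exists m (-1) k Hm))). }
clearbody ap am. exists ap, am.
split; [| split; [| split; [| split; [| split; [| split]]]]].
- intros k Hk. split; [now apply (eigen_positive m 1 k) | now apply (eigen_positive m (-1) k)].
- intros al Hal. split.
  + rewrite (solution_exists_iff_eigen m al 1 Hp Hal). split; intros (k & Hk & H); exists k; (split; [assumption |]).
    * now apply (eigen_unique m 1 k).
    * rewrite H. apply Ep.
  + rewrite (solution_exists_iff_eigen m al (-1) Hm Hal). split; intros (k & Hk & H); exists k; (split; [assumption |]).
    * now apply (eigen_unique m (-1) k).
    * rewrite H. apply Em.
- intros k Hk. split; intros w f Hsol Hf0.
  + now apply (eigen_sign_changes m 1 k (ap k) f w).
  + now apply (eigen_sign_changes m (-1) k (am k) f w).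
- intros k Hk. split.
  + apply (eigen_increasing m 1 k (k + 1)); try assumption; [apply Ep | apply Ep | lia].
  + apply (eigen_increasing m (-1) k (k + 1)); try assumption; [apply Em | apply Em | lia].
- intros B. split.
  + destruct (eigen_unbounded m 1 B Hp) as (k & Hk & H). exists k. split; [assumption | apply H, Ep].
  + destruct (eigen_unbounded m (-1) B Hm) as (k & Hk & H). exists k. split; [assumption | apply H, Em].
- split; [now apply (eigen_positive m (-1) 1) |].
  split; [apply (eigen_1_negative_sign m), Em | apply (eigen_1_positive_sign m), Ep].
- intros k Hk. split.
  + apply (eigen_interlace m (-1) k); [assumption | apply Em |].
    replace (- -1) with 1 by ring. rewrite Nat.add_1_r. apply Ep.
  + apply (eigen_interlace m 1 (k + 1)); [assumption | apply Ep |].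
    replace (S (k + 1)) with (k + 2)%nat by lia. apply Em.
Qed.
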